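(* Let $m\ge 2$, and assume the model $F_\theta(\mathbf{x})=\prod_{j=1}^m x_j+\theta\,\Omega_m(\mathbf{x})$, $\mathbf{x}\in I^m=[0,1]^m$, for sufficiently small $\theta\ge 0$, with dependence function $\Omega_m$ satisfying conditions (C1)–(C4) listed in the context. Let $\gamma_{m,n}$ be the power function of the test of approximate level $\alpha\in(0,1)$ based on $S_{m,n}$, and for $h\ge 0$ let $\gamma_m(h)=\lim_{n\to\infty}\gamma_{m,n}(h/\sqrt n)$. Then $$\gamma_m(h)=1-\Phi\left(z_\alpha-\frac{2^m}{\left((4/3)^m-m/3-1\right)^{1/2}}\;h\int_{I^m}\Omega_m(\mathbf{x})\,d\mathbf{x}\right).$$
   Context: Model. Fix $m\ge 2$ and $I^m=[0,1]^m$; $\lambda_m$ is Lebesgue measure on $\mathbb{R}^m$. $F_\theta$ is an absolutely continuous cdf on $I^m$ which, for sufficiently small $\theta\ge 0$, has the form $F_\theta(\mathbf{x})=\prod_{j=1}^m x_j+\theta\,\Omega_m(\mathbf{x})$, where the dependence function $\Omega_m$ satisfies: (C1) $\Omega_m(\mathbf{x})\ge 0$ for $\mathbf{x}\in I^m$; (C2) $\Omega_m(\mathbf{x})|_{x_k=0}=0$ and $\Omega_m(1,\ldots,1,x_k,1,\ldots,1)=0$ for $x_k\in[0,1]$, $1\le k\le m$; (C3) $\Omega_m(\mathbf{x})|_{x_k=1}=\Omega_{m-1}(x_1,\ldots,x_{k-1},x_{k+1},\ldots,x_m)$, $1\le k\le m$, where $\Omega_{m-1}$ is the dependence function of the corresponding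 $(m-1)$-dimensional model (for $m=2$, $\Omega_1\equiv 0$, in accordance with (C2)); (C4) there exists a non-zero mixed derivative $\omega_m(\mathbf{x})=\dfrac{\partial^m\Omega_m(\mathbf{x})}{\partial x_{i_1}\cdots\partial x_{i_m}}$ for $\lambda_m$-almost all $\mathbf{x}\in I^m$, with $\omega_m\in L_2(I^m)$, where $(i_1,\ldots,i_m)$ is an arbitrary permutation of $\{1,\ldots,m\}$. The distribution $\mathbf{P}_\theta$ with cdf $F_\theta$ has uniform $[0,1]$ margins and density $1+\theta\omega_m$ with respect to $\lambda_m$. One observes i.i.d. vectors $\mathbf{X}_i=(X_{i1},\ldots,X_{im})$, $i=1,\ldots,n$, with distribution $\mathbf{P}_\theta$; $\mathbf{P}_\theta^n$ is their joint law. Test statistic. $R_{ij}$ is the rank of $X_{ij}$ among $X_{1j},\ldots,X_{nj}$, and $$S_{m,n}=\frac{1}{C_m}\left\{n^{-1}\sum_{i=1}^n\prod_{j=1}^m(n+1-R_{ij})-\left(\frac{n+1}{2}\right)^m\right\},\qquad C_m=n^{-1}\sum_{i=1}^n i^m-\left(\frac{n+1}{2}\right)^m.$$ Put $$\sigma_m^2(0)=\frac{(m+1)^2}{(2^m-(m+1))^2}\left(\left(\tfrac43\right)^m-\tfrac m3-1\right).$$ $\Phi$ is the standard normal cdf and $z_\alpha=\Phi^{-1}(1-\alpha)$. The test rejects $\theta=0$ (against $\theta>0$) when $\sqrt n\,S_{m,n}/\sigma_m(0)>z_\alpha$, and its power function is $\gamma_{m,n}(\theta)=\mathbf{P}^n_\theta(\sqrt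 n\,S_{m,n}/\sigma_m(0)>z_\alpha)$, considered at $\theta=h/\sqrt n$, $h\ge 0$ (for $n$ large enough). *)

(* Defs.v *)
From HB Require Import structures.
From mathcomp Require Import all_boot all_order all_algebra.
From mathcomp Require Import all_classical all_reals all_analysis.

Set Implicit Arguments.
Unset Strict Implicit.
Unset Printing Implicit Defensive.
Import Order.TTheory GRing.Theory Num.Theory.
Import numFieldNormedType.Exports.

Local Open Scope classical_set_scope.
Local Open Scope ring_scope.

Definition cons_pair (T : Type) (n : nat) (p : T * n.-tuple T) : n.+1.-tuple T :=
  [tuple of p.1 :: p.2].

Lemma measurable_cons_pair (d : measure_display) (T : measurableType d) (n : nat) :
  measurable_fun [set: T * n.-tuple T] (@cons_pair T n).
Proof. exact: measurable_cons. Qed.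

(* The library proves this only as a local fact, and the canonical structure
   found for [m1 \x m2] is the one for products of subprobabilities. *)
Lemma sigma_finite_product (d1 d2 : measure_display) (T1 : measurableType d1)
    (T2 : measurableType d2) (R : realType)
    (m1 : {sigma_finite_measure set T1 -> \bar R})
    (m2 : {sigma_finite_measure set T2 -> \bar R}) :
  sigma_finite setT (m1 \x m2)%E.
Proof.
have /sigma_finiteP[F [TF ndF Foo]] := sigma_finiteT m1.
have /sigma_finiteP[G [TG ndG Goo]] := sigma_finiteT m2.
exists (fun n => F n `*` G n).
  rewrite -setXTT TF TG predeqE => -[x y]; split.
    move=> [/= [n _ Fnx] [k _ Gky]]; exists (maxn n k) => //; split.
    - by move: x Fnx; exact/subsetPset/ndF/leq_maxl.
    - by move: y Gky; exact/subsetPset/ndG/leq_maxr.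
  by move=> [n _ []/= ? ?]; split; exists n.
move=> k; have [? ?] := Foo k; have [? ?] := Goo k.
split; first exact: measurableX.
by rewrite product_measure1E// lte_mul_pinfty// ge0_fin_numE.
Qed.

Section cons_measure.
Context (d : measure_display) (T : measurableType d) (R : realType) (n : nat).
Context (mu : {sigma_finite_measure set T -> \bar R}).
Context (nu : {sigma_finite_measure set (n.-tuple T) -> \bar R}).

Definition cons_measure : set (n.+1.-tuple T) -> \bar R :=
  pushforward (mu \x nu)%E (@cons_pair T n).

Let cons_measure0 : cons_measure set0 = 0%E.
Proof. by rewrite /cons_measure /pushforward preimage_set0 measure0. Qed.

Let cons_measure_ge0 A : (0 <= cons_measure A)%E.
Proof. by rewrite /cons_measure /pushforward; exact: measure_ge0. Qed.

Let cons_measure_sigma_additive : semi_sigma_additive cons_measure.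
Proof.
move=> F mF tF mUF; rewrite /cons_measure /pushforward preimage_bigcup.
have mf := @measurable_cons_pair d T n.
apply: measure_semi_sigma_additive.
- by move=> k; rewrite -[X in measurable X]setTI; exact: mf.
- apply/trivIsetP => /= i j _ _ ij; rewrite -preimage_setI.
  by move/trivIsetP : tF => /(_ _ _ _ _ ij) ->//; rewrite preimage_set0.
- by rewrite -preimage_bigcup -[X in measurable X]setTI; exact: mf.
Qed.

HB.instance Definition _ := isMeasure.Build _ _ _ cons_measure
  cons_measure0 cons_measure_ge0 cons_measure_sigma_additive.

Let cons_measure_sigma_finite : sigma_finite setT cons_measure.
Proof.
have [F FT mF] := sigma_finite_product mu nu.
pose uncons (t : n.+1.-tuple T) : T * n.-tuple T :=
  (thead t, [tuple of behead t]).
have unconsK (t : n.+1.-tuple T) : cons_pair (uncons t) = t.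
  by rewrite [RHS]tuple_eta; exact: val_inj.
have consK p : uncons (cons_pair p) = p.
  by case: p => a t; congr pair; exact: val_inj.
have muncons : measurable_fun setT uncons.
  apply/measurable_fun_pairP; split => /=.
    exact: (@measurable_tnth _ T n.+1 ord0).
  exact: measurable_behead.
exists (fun k => uncons @^-1` F k).
  by rewrite -preimage_bigcup -FT preimage_setT.
move=> k; have [mFk Fk] := mF k; split.
  by rewrite -[X in measurable X]setTI; exact: muncons.
rewrite /cons_measure /pushforward.
rewrite (_ : _ @^-1` _ = F k)//.
by apply/seteqP; split => p /=; rewrite consK.
Qed.

HB.instance Definition _ := Measure_isSigmaFinite.Build _ _ _ cons_measure
  cons_measure_sigma_finite.

End cons_measure.

(* The n-fold product measure mu x ... x mu. *)
Fixpoint power_measure (d : measure_display) (T : measurableType d) (R : realType)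
    (mu : {sigma_finite_measure set T -> \bar R}) (n : nat) :
    {sigma_finite_measure set (n.-tuple T) -> \bar R} :=
  match n with
  | 0 => @dirac _ (0.-tuple T) [tuple] R
  | k.+1 => @cons_measure d T R k mu (power_measure mu k)
  end.

Notation vec R m := (m.-tuple (measurableTypeR R)).

Definition lebesgue_vec (R : realType) (m : nat) :
    {sigma_finite_measure set (vec R m) -> \bar R} :=
  power_measure (@lebesgue_measure R) m.

Definition cube (R : realType) (m : nat) : set (vec R m) :=
  [set x | forall j, 0 <= (tnth x j : R) <= 1].

Definition set_coord (R : realType) (m : nat) (x : vec R m) (k : 'I_m) (t : R) :
    vec R m :=
  [tuple if j == k then t else tnth x j | j < m].

Definition del_coord (R : realType) (m : nat) (k : 'I_m.+1) (x : vec R m.+1) :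
    vec R m :=
  [tuple tnth x (lift k j) | j < m].

Definition mcdf (R : realType) (m : nat) (P : set (vec R m) -> \bar R)
    (x : vec R m) : \bar R :=
  P [set y | forall j, (tnth y j : R) <= tnth x j].

(* [mixed_partial [:: k1; ...; kr] f] is d^r f / dx_k1 ... dx_kr, the partial
   derivative with respect to x_kr being taken first; its value is meaningful
   only where [mixed_derivable] holds. *)
Fixpoint mixed_partial (R : realType) (m : nat) (s : seq 'I_m)
    (f : vec R m -> R) (x : vec R m) : R :=
  if s is k :: s' then
    derive1 (fun t : R => mixed_partial s' f (set_coord x k t)) (tnth x k)
  else f x.

Fixpoint mixed_derivable (R : realType) (m : nat) (s : seq 'I_m)
    (f : vec R m -> R) (x : vec R m) : Prop :=
  if s is k :: s' then
    (\forall t \near (tnth x k : R), mixed_derivable s' f (set_coord x k t)) /\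
    derivable (fun t : R => mixed_partial s' f (set_coord x k t))
      (tnth x k : R) 1
  else True.

(* Conditions (C1)-(C3), by recursion on the dimension: in dimension one the
   only dependence function is 0. *)
Fixpoint dependence_function (R : realType) (m : nat) : (vec R m -> R) -> Prop :=
  if m is p.+1 return (vec R m -> R) -> Prop then fun Omega =>
    if p is 0 then forall x, cube x -> Omega x = 0 else
    [/\ forall x, cube x -> 0 <= Omega x,
        forall x k, cube x -> tnth x k = 0 -> Omega x = 0,
        forall x k, cube x -> (forall j, j != k -> tnth x j = 1) -> Omega x = 0
      & exists2 Omega' : vec R p -> R, dependence_function Omega' &
          forall x k, cube x -> tnth x k = 1 ->
            Omega x = Omega' (del_coord k x)]
  else fun _ => False.

(* Condition (C4); "non-zero" means that the derivative does not vanish almost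
   everywhere. *)
Definition L2_mixed_derivative (R : realType) (m : nat) (Omega : vec R m -> R) :=
  exists omega : vec R m -> R,
    [/\ patch (fun=> 0) (@cube R m) omega \in Lfun (lebesgue_vec R m) 2%:E,
        ~ {ae lebesgue_vec R m, forall x, cube x -> omega x = 0}
      & forall s : seq 'I_m, perm_eq s (enum 'I_m) ->
          {ae lebesgue_vec R m, forall x, cube x ->
             mixed_derivable s Omega x /\ mixed_partial s Omega x = omega x}].

(* The cdf is only prescribed on the cube: by (C2) it equals 1 at (1, ..., 1) and
   0 when a coordinate is 0, so [P theta] is carried by the cube. *)
Definition dependence_model (R : realType) (m : nat) (Omega : vec R m -> R)
    (P : R -> probability (vec R m) R) : Prop :=
  exists2 theta0 : R, 0 < theta0 &
    forall theta, 0 <= theta < theta0 ->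
      P theta `<< lebesgue_vec R m /\
      forall x, cube x ->
        mcdf (P theta) x =
          ((\prod_(j < m) (tnth x j : R)) + theta * Omega x)%:E.

(* Tied observations share the largest rank; ties have probability 0 here. *)
Definition rank (R : realType) (m n : nat) (X : n.-tuple (vec R m))
    (i : 'I_n) (j : 'I_m) : nat :=
  #|[pred k : 'I_n | (tnth (tnth X k) j : R) <= tnth (tnth X i) j]|.

Definition Cconst (R : realType) (m n : nat) : R :=
  n%:R^-1 * \sum_(1 <= i < n.+1) i%:R ^+ m - ((n%:R + 1) / 2) ^+ m.

Definition spearman (R : realType) (m n : nat) (X : n.-tuple (vec R m)) : R :=
  (Cconst R m n)^-1 *
  (n%:R^-1 * \sum_(i < n) \prod_(j < m) (n%:R + 1 - (rank X i j)%:R)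
   - ((n%:R + 1) / 2) ^+ m).

Definition sigma2 (R : realType) (m : nat) : R :=
  (m%:R + 1) ^+ 2 / (2 ^+ m - (m%:R + 1)) ^+ 2 *
  ((4 / 3) ^+ m - m%:R / 3 - 1).

Definition Phi (R : realType) (z : R) : R :=
  fine (normal_prob (0 : R) 1 `]-oo, z]).

Definition zquantile (R : realType) (alpha : R) : R :=
  'pinv_(fun=> 0) [set: R] (@Phi R) (1 - alpha).

Definition power_fun (R : realType) (m n : nat)
    (P : R -> probability (vec R m) R) (alpha theta : R) : R :=
  fine (power_measure (P theta) n
    [set X | zquantile alpha <
             Num.sqrt n%:R * spearman X / Num.sqrt (sigma2 R m)]).

(* Main.v *)
Require Import Defs.
From mathcomp Require Import all_boot all_order all_algebra.
From mathcomp Require Import all_classical all_reals all_analysis.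
From HB Require Import structures.
From mathcomp Require Import measurable_realfun ring lra zify.
Set Implicit Arguments.
Unset Strict Implicit.
Unset Printing Implicit Defensive.
Import Order.TTheory GRing.Theory Num.Theory.
Import numFieldNormedType.Exports.
Local Open Scope classical_set_scope.
Local Open Scope ring_scope.

(** Up to an error that vanishes in mean, the normalized rank statistic is a sum
    of i.i.d. bounded scores. Such a sum is asymptotically normal, and the
    alternatives h / sqrt n act on the limit only through the mean of the score.

    Ranks. Write s_j = 1 - x_j on the cube. The relative rank (n + 1 - R_ij) / n
    differs from s_j (X_i) by an empirical fluctuation of order 1 / sqrt n.
    Expanding the product over j to first order (prod_taylor) leaves an error of
    order 1 / n in mean (rank_dev_sq). The linear term is a U-statistic;
    subtracting its projection on the single observations leaves the kernel kern,
    which has conditional mean zero given the first argument and conditional mean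
    of order theta given the second, so that its contribution vanishes too
    (ustat_sq). What remains, by rankmean_linear, is the sum of the scores
      score = prod_j s_j - 2^-m - 2^(1-m) sum_j (s_j - 1/2).

    Alternatives. The distribution function of P_theta is affine in theta, and a
    law is determined by its distribution function (cdf_unique), so P_theta itself
    is affine in theta: it is a mixture of the uniform law on the cube and of a
    fixed P_theta1 (law_mixture). Hence the expectation of any bounded function
    moves by O(theta) only (law_perturb), and the variance of the score tends to
    its value 4^-m ((4/3)^m - m/3 - 1) under independence (ucube_score_sq). For
    the mean, prod_j s_j (x) is the volume of the points of the cube above x, so
    exchanging integrals gives
      E_theta prod_j s_j = int F_theta = 2^-m + theta int Omega
    (Ex_prod_surv), while the other terms of the score are centred because the
    margins are uniform. At theta = h / sqrt n the normalized sum of scores thus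
    has mean h int Omega.

    Normality. Stein's method bounds the distance between E g(W) and E g(Z) for a
    Lipschitz function g with values in [0, 1], a normalized sum W of bounded
    i.i.d. variables and Z standard normal (clt_bound). A ramp is such a function;
    it brackets an indicator, and it turns the error in mean of the linearization
    into an error of the same order on E g (prob_le_Phi).

    For each n this yields an explicit bound on the distance between the power and
    the claimed limit (power_bound). As C_(m,n) / n^m tends to 1/(m+1) - 2^-m, the
    bound tends to a multiple of the width of the ramp, which is arbitrary. *)

(** * Expectations of bounded measurable functions *)

Section bounded_measurable.
Context d (T : measurableType d) (R : realType).
Implicit Types (f g : T -> R).

(** All expectations below are taken of functions in this class. It is closed
    under algebraic operations and integrable for every probability, so side
    conditions on integrals reduce to membership in it. *)
Definition bm f := measurable_fun [set: T] f /\ exists M, forall x, `|f x| <= M.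

Lemma bm_cst (c : R) : bm (fun=> c).
Proof. by split; [exact: measurable_cst | exists `|c|]. Qed.

Lemma bmD f g : bm f -> bm g -> bm (fun x => f x + g x).
Proof.
move=> [mf [M fM]] [mg [N gN]]; split; first exact: measurable_funD.
by exists (M + N) => x; rewrite (le_trans (ler_normD _ _))// lerD.
Qed.

Lemma bmM f g : bm f -> bm g -> bm (fun x => f x * g x).
Proof.
move=> [mf [M fM]] [mg [N gN]]; split; first exact: measurable_funM.
by exists (M * N) => x; rewrite normrM ler_pM.
Qed.

Lemma bmZ (c : R) f : bm f -> bm (fun x => c * f x).
Proof. by move=> bf; apply: bmM => //; exact: bm_cst. Qed.

Lemma bmN f : bm f -> bm (fun x => - f x).
Proof.
move=> bf; rewrite (_ : (fun x => - f x) = fun x => -1 * f x); first exact: bmZ.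
by apply/funext => x; rewrite mulN1r.
Qed.

Lemma bmB f g : bm f -> bm g -> bm (fun x => f x - g x).
Proof. by move=> bf bg; apply: bmD => //; exact: bmN. Qed.

Lemma bm_norm f : bm f -> bm (fun x => `|f x|).
Proof.
move=> [mf [M fM]]; split; first exact: measurableT_comp.
by exists M => x; rewrite normr_id.
Qed.

Lemma bm_exp f k : bm f -> bm (fun x => f x ^+ k).
Proof.
move=> bf; elim: k => [|k ih]; first by under eq_fun do [rewrite expr0]; exact: bm_cst.
by under eq_fun do [rewrite exprS]; exact: bmM.
Qed.

Lemma bm_sum (I : Type) (s : seq I) (P : pred I) (F : I -> T -> R) :
  (forall i, bm (F i)) -> bm (fun x => \sum_(i <- s | P i) F i x).
Proof.
move=> bF; elim: s => [|i s ih].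
  rewrite [X in bm X](_ : _ = fun=> 0); first exact: bm_cst.
  by apply/funext => x; rewrite big_nil.
rewrite [X in bm X](_ : _ = fun x => if P i then F i x + \sum_(j <- s | P j) F j x
                           else \sum_(j <- s | P j) F j x).
  by case: (P i) => //; exact: bmD.
by apply/funext => x; rewrite big_cons.
Qed.

Lemma bm_prod (I : Type) (s : seq I) (P : pred I) (F : I -> T -> R) :
  (forall i, bm (F i)) -> bm (fun x => \prod_(i <- s | P i) F i x).
Proof.
move=> bF; elim: s => [|i s ih].
  rewrite [X in bm X](_ : _ = fun=> 1); first exact: bm_cst.
  by apply/funext => x; rewrite big_nil.
rewrite [X in bm X](_ : _ = fun x => if P i then F i x * \prod_(j <- s | P j) F j x
                           else \prod_(j <- s | P j) F j x).
  by case: (P i) => //; exact: bmM.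
by apply/funext => x; rewrite big_cons.
Qed.

Lemma bm_bool (b : T -> bool) : measurable_fun setT b -> bm (fun x => (b x)%:R).
Proof.
move=> mb; split; last by exists 1 => x; case: (b x); rewrite ?normr1 ?normr0.
rewrite (_ : (fun x => (b x)%:R) = \1_[set x | b x]); last first.
  by apply/funext => x; rewrite indicE; congr (_%:R); rewrite mem_setE.
apply: measurable_indic; rewrite -[X in measurable X]setTI; exact: mb.
Qed.

End bounded_measurable.

Lemma bm_comp d d' (T : measurableType d) (T' : measurableType d') (R : realType)
    (g : T -> T') (f : T' -> R) :
  bm f -> measurable_fun setT g -> bm (fun x => f (g x)).
Proof.
move=> [mf [M fM]] mg; split; first exact: (measurableT_comp mf mg).
by exists M => x.
Qed.

Section expectation.
Context d (T : measurableType d) (R : realType) (mu : probability T R).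
Implicit Types (f g : T -> R).

Definition Ex f : R := \int[mu]_x f x.

Lemma bm_integrable f : bm f -> mu.-integrable setT (EFin \o f).
Proof.
move=> [mf [M fM]]; apply: measurable_bounded_integrable => //.
  by rewrite (le_lt_trans (probability_le1 _ _))// ltry.
exists `|M|; split; first exact: normr_real.
by move=> N MN x _ /=; rewrite (le_trans (fM x))// (le_trans (ler_norm _))// ltW.
Qed.

Lemma ExE f : bm f -> (Ex f)%:E = (\int[mu]_x (f x)%:E)%E.
Proof.
by move=> bf; rewrite /Ex /Rintegral fineK//; apply: integrable_fin_num => //; exact: bm_integrable.
Qed.

Lemma Ex_cst c : Ex (fun=> c) = c.
Proof. by rewrite /Ex Rintegral_cst//= [X in fine X](_ : _ = 1%E) ?mulr1//; exact: probability_setT. Qed.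

Lemma ExD f g : bm f -> bm g -> Ex (fun x => f x + g x) = Ex f + Ex g.
Proof. by move=> bf bg; rewrite /Ex RintegralD//; exact: bm_integrable. Qed.

Lemma ExB f g : bm f -> bm g -> Ex (fun x => f x - g x) = Ex f - Ex g.
Proof. by move=> bf bg; rewrite /Ex RintegralB//; exact: bm_integrable. Qed.

Lemma ExZ c f : bm f -> Ex (fun x => c * f x) = c * Ex f.
Proof. by move=> bf; rewrite /Ex RintegralZl//; exact: bm_integrable. Qed.

Lemma Ex_sum (I : Type) (s : seq I) (P : pred I) (F : I -> T -> R) :
  (forall i, bm (F i)) ->
  Ex (fun x => \sum_(i <- s | P i) F i x) = \sum_(i <- s | P i) Ex (F i).
Proof.
move=> bF; elim: s => [|i s ih].
  rewrite big_nil -[RHS](Ex_cst 0); congr Ex; apply/funext => x; exact: big_nil.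
rewrite big_cons -ih (_ : (fun x => _) = fun x => if P i
    then F i x + \sum_(j <- s | P j) F j x else \sum_(j <- s | P j) F j x).
  by case: (P i) => //; rewrite ExD//; exact: bm_sum.
by apply/funext => x; rewrite big_cons.
Qed.

Lemma le_Ex f g : bm f -> bm g -> (forall x, f x <= g x) -> Ex f <= Ex g.
Proof. by move=> bf bg fg; apply: le_Rintegral => //; exact: bm_integrable. Qed.

Lemma Ex_ge0 f : (forall x, 0 <= f x) -> 0 <= Ex f.
Proof. by move=> f0; apply: Rintegral_ge0. Qed.

Lemma norm_Ex_le f : bm f -> `|Ex f| <= Ex (fun x => `|f x|).
Proof. by move=> bf; apply: le_normr_Rintegral => //; exact: bm_integrable. Qed.

Lemma norm_Ex_bound f M : bm f -> (forall x, `|f x| <= M) -> `|Ex f| <= M.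
Proof.
move=> bf fM; rewrite (le_trans (norm_Ex_le bf))// -(Ex_cst M).
by apply: le_Ex => //; [exact: bm_norm | exact: bm_cst].
Qed.

Lemma norm_ExB_le f g e : bm f -> bm g -> bm e ->
  (forall x, `|f x - g x| <= e x) -> `|Ex f - Ex g| <= Ex e.
Proof.
move=> bf bg be H; rewrite -ExB// (le_trans (norm_Ex_le _))//; first exact: bmB.
by apply: le_Ex => //; apply: bm_norm; exact: bmB.
Qed.

Lemma Ex_indic (A : set T) : measurable A -> Ex (\1_A) = fine (mu A).
Proof. by move=> mA; rewrite /Ex /Rintegral integral_indic// setIT. Qed.

(** The variance of |f| is nonnegative. *)
Lemma Ex_norm_le_sqrt f : bm f -> Ex (fun x => `|f x|) <= Num.sqrt (Ex (fun x => f x ^+ 2)).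
Proof.
move=> bf; have b2 := bm_exp 2 bf; have bn := bm_norm bf.
set a := Ex (fun x => `|f x|).
have a0 : 0 <= a by exact: Ex_ge0.
rewrite -(ger0_norm a0) -sqrtr_sqr ler_sqrt; last by apply: Ex_ge0 => x; exact: sqr_ge0.
have : 0 <= Ex (fun x => (f x ^+ 2 - 2 * a * `|f x|) + a ^+ 2).
  apply: Ex_ge0 => x; rewrite -(real_normK (num_real (f x))).
  rewrite (_ : _ + _ = (`|f x| - a) ^+ 2); first exact: sqr_ge0.
  by move: (`|f x|) => t; ring.
rewrite ExD ?ExB ?ExZ ?Ex_cst//; try by [exact: bmZ|exact: bm_cst|apply: bmB => //; exact: bmZ].
rewrite -/a; move: (Ex _) => v; nra.
Qed.

End expectation.

Section fubini_expectation.
Context d1 d2 (T1 : measurableType d1) (T2 : measurableType d2) (R : realType).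
Variables (m1 : probability T1 R) (m2 : probability T2 R).
Variable f : T1 * T2 -> R.
Hypothesis bf : bm f.

Lemma bm_pair1 x : bm (fun y => f (x, y)).
Proof. by apply: (bm_comp bf); exact: measurable_pair1. Qed.

Lemma bm_pair2 y : bm (fun x => f (x, y)).
Proof. by apply: (bm_comp bf); exact: measurable_pair2. Qed.

Lemma bm_integrable_prod : (m1 \x m2)%E.-integrable setT (EFin \o f).
Proof.
case: bf => mf [M fM]; apply: measurable_bounded_integrable => //.
  rewrite -setXTT /= product_measure1E// (_ : (_ * _)%E = (1 * 1)%E).
    by rewrite mule1 ltry.
  by congr (_ * _)%E; exact: probability_setT.
exists `|M|; split; first exact: normr_real.
by move=> N MN x _ /=; rewrite (le_trans (fM x))// (le_trans (ler_norm _))// ltW.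
Qed.

Lemma bm_Ex : bm (fun x => Ex m2 (fun y => f (x, y))).
Proof.
split.
  apply/measurable_EFinP.
  rewrite (_ : EFin \o _ = fubini_F m2 (EFin \o f)).
    exact: (measurable_fubini_F bm_integrable_prod).
  by apply/funext => x /=; rewrite /fubini_F ExE//; exact: bm_pair1.
case: (bf) => mf [M fM]; exists M => x.
apply: norm_Ex_bound => //; exact: bm_pair1.
Qed.

Lemma Ex_prod : Ex m1 (fun x => Ex m2 (fun y => f (x, y))) =
  fine (\int[(m1 \x m2)%E]_z (f z)%:E)%E.
Proof.
rewrite -integral12_prod_meas1; last exact: bm_integrable_prod.
rewrite /Ex {1}/Rintegral; congr fine; apply: eq_integral => x _.
by rewrite /fubini_F/= -ExE//; exact: bm_pair1.
Qed.

End fubini_expectation.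

Lemma Ex_swap d1 d2 (T1 : measurableType d1) (T2 : measurableType d2) (R : realType)
    (m1 : probability T1 R) (m2 : probability T2 R) (f : T1 -> T2 -> R) :
  bm (fun z => f z.1 z.2) ->
  Ex m1 (fun x => Ex m2 (fun y => f x y)) = Ex m2 (fun y => Ex m1 (fun x => f x y)).
Proof.
move=> bf; have H := bm_integrable_prod m1 m2 bf.
rewrite /Ex /Rintegral; congr fine.
transitivity (\int[m1]_x \int[m2]_y ((f x y)%:E))%E.
  apply: eq_integral => x _; rewrite -[LHS]/((Ex m2 (fun y => f x y))%:E) ExE//.
  exact: (bm_pair1 bf).
rewrite (Fubini H); apply: eq_integral => y _.
rewrite -[RHS]/((Ex m1 (fun x => f x y))%:E) ExE//.
exact: (bm_pair2 bf).
Qed.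

(** * Product measures and resampling *)

Section rectangles.
Context d (T : measurableType d) (R : realType) (n : nat).

Definition rect (A : 'I_n -> set T) : set (n.-tuple T) :=
  [set t | forall i, A i (tnth t i)].

Lemma measurable_rect A : (forall i, measurable (A i)) -> measurable (rect A).
Proof.
move=> mA; have -> : rect A = \bigcap_(i in [set: 'I_n]) ((@tnth n T)^~ i @^-1` A i).
  apply/seteqP; split => t /=; first by move=> H i _; exact: H.
  by move=> H i; exact: (H i I).
apply: fin_bigcap_measurable => // i _.
rewrite -[X in measurable X]setTI; exact: (@measurable_tnth _ T n i).
Qed.

(** The pi-lambda theorem for tuples: rectangles with sides in a generating
    pi-system form a generating pi-system. *)
Lemma tuple_measure_unique (G : set (set T)) (mG : d.-measurable = <<s G>>)
    (GI : setI_closed G) (GT : G setT) (mu nu : {measure set (n.-tuple T) -> \bar R}) :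
  (mu setT < +oo)%E ->
  (forall A, (forall i, G (A i)) -> mu (rect A) = nu (rect A)) ->
  forall B, measurable B -> mu B = nu B.
Proof.
move=> muoo mn.
pose H := [set B | exists2 A, (forall i, G (A i)) & B = rect A].
have GM A : G A -> measurable A by move=> GA; rewrite mG; exact: sub_sigma_algebra.
have rT : rect (fun=> setT) = setT by apply/seteqP; split.
apply: (measure_unique H (fun=> setT)) => //.
- apply/seteqP; split.
    rewrite [X in X `<=` _]/measurable /=.
    rewrite -[X in _ `<=` X]/(H.-sigma.-measurable).
    apply: smallest_sub; first exact: sigma_algebra_measurable.
    rewrite -bigcup_seq/= => B [i _] /= Bi.
    have : <<s preimage_set_system setT ((@tnth n T)^~ i) G>> B.
      rewrite g_sigma_preimageE; move: Bi; rewrite mG; exact.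
    move: B {Bi}; apply: smallest_sub; first exact: sigma_algebra_measurable.
    move=> _ [A GA <-]; apply: sub_sigma_algebra.
    exists (fun j => if j == i then A else setT).
      by move=> j; case: ifP.
    apply/seteqP; split => t /=.
      by move=> [_ At] j; case: eqP => // ->.
    by move=> /(_ i); rewrite eqxx.
  apply: smallest_sub; first exact: sigma_algebra_measurable.
  by move=> _ [A GA ->]; apply: measurable_rect => i; exact: GM.
- move=> _ _ [A GA ->] [B GB ->]; exists (fun i => A i `&` B i).
    by move=> i; exact: GI.
  apply/seteqP; split => t /=; first by move=> [H1 H2] i; split.
  by move=> H1; split => i; case: (H1 i).
- by move=> _; exists (fun=> setT).
- by apply/seteqP; split => // x _; exists 0%N.
- by move=> _ [A GA ->]; exact: mn.
Qed.

End rectangles.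

Lemma power_measure_rect d (T : measurableType d) (R : realType)
    (mu : {sigma_finite_measure set T -> \bar R}) n (A : 'I_n -> set T) :
  (forall i, measurable (A i)) -> (forall i, (mu (A i) < +oo)%E) ->
  power_measure mu n (rect A) = (\prod_(i < n) fine (mu (A i)))%:E.
Proof.
elim: n A => [|n ih] A mA Aoo.
  rewrite /= diracE big_ord0.
  have -> : ([tuple] \in rect A) = true by apply/mem_set => -[].
  by [].
rewrite /= /cons_measure /pushforward.
rewrite (_ : _ @^-1` _ = A ord0 `*` rect (fun i => A (lift ord0 i))); last first.
  apply/seteqP; split => -[x t] /=.
    by move=> H; split; [exact: (H ord0) | move=> i; have := H (lift ord0 i); rewrite tnthS].
  move=> [A0 H] i; case: (unliftP ord0 i) => [j ->|-> //].
  rewrite tnthS; exact: H.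
rewrite product_measure1E//; last exact: measurable_rect.
rewrite -[X in (_ * X)%E]/(power_measure mu n _) ih// big_ord_recl EFinM fineK//.
by rewrite ge0_fin_numE.
Qed.

Section iid.
Context d (T : measurableType d) (R : realType) (P : probability T R).

(** The power measure of a probability, under a name that carries the structure
    of a probability. *)
Definition iid n : set (n.-tuple T) -> \bar R := power_measure P n.
Arguments iid : clear implicits.

HB.instance Definition _ n := SigmaFiniteMeasure.copy (iid n) (power_measure P n).

Lemma iid_rect n (A : 'I_n -> set T) : (forall i, measurable (A i)) ->
  iid n (rect A) = (\prod_(i < n) fine (P (A i)))%:E.
Proof.
move=> mA; apply: power_measure_rect => // i.
by rewrite (le_lt_trans (probability_le1 _ _))// ltry.
Qed.

Lemma iid_setT n : iid n setT = 1%E.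
Proof.
have -> : [set: n.-tuple T] = rect (fun=> setT) by apply/seteqP; split.
by rewrite iid_rect// big1// => i _; rewrite probability_setT.
Qed.

HB.instance Definition _ n := Measure_isProbability.Build _ _ _ (iid n) (iid_setT n).

End iid.
Arguments iid {d T R} P n A.

Section iid_expectation.
Context d (T : measurableType d) (R : realType) (P : probability T R).
Local Notation EP := (Ex P).

(** Resampling the entry i. All independence arguments below go through this
    operation and [Ex_upd]. *)
Definition upd n (i : 'I_n) (X : n.-tuple T) (y : T) : n.-tuple T :=
  [tuple if j == i then y else tnth X j | j < n].

Lemma tnth_upd n (i j : 'I_n) X y : tnth (upd i X y) j = if j == i then y else tnth X j.
Proof. by rewrite tnth_mktuple. Qed.

Lemma measurable_upd n (i : 'I_n) :
  measurable_fun [set: (n.-tuple T) * T] (fun z => upd i z.1 z.2).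
Proof.
apply/measurable_fun_tnthP => j /=.
rewrite (_ : _ \o _ = fun z : (n.-tuple T) * T => if j == i then z.2 else tnth z.1 j).
  case: (j == i); first exact: measurable_snd.
  by apply: (@measurableT_comp _ _ _ _ _ _ (fun x => tnth x j)) => //=; exact: measurable_tnth.
by apply/funext => z /=; rewrite tnth_upd.
Qed.

(** Resampling one entry of an i.i.d. sample preserves its law, because it does
    so on rectangles. *)
Lemma iid_upd n (i : 'I_n) (B : set (n.-tuple T)) : measurable B ->
  iid P n B = pushforward (iid P n \x P)%E (fun z => upd i z.1 z.2) B.
Proof.
pose nu := measure_function_pushforward__canonical__measure_function_Measure
  (iid P n \x P)%E (measurable_upd i).
move: B; apply: (@tuple_measure_unique _ _ _ _ measurable _ _ _ (iid P n) nu) => //.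
- by rewrite sigma_algebra_id//; exact: sigma_algebra_measurable.
- exact: measurableI.
- by rewrite (le_lt_trans (probability_le1 _ _))// ltry.
move=> A mA; rewrite /= /pushforward.
rewrite (_ : _ @^-1` _ = rect (fun j => if j == i then setT else A j) `*` A i); last first.
  apply/seteqP; split => -[X y] /=.
    move=> H; split; last by have := H i; rewrite tnth_upd eqxx.
    by move=> j; have := H j; rewrite tnth_upd; case: ifP.
  move=> [H Ay] j; have := H j; rewrite tnth_upd.
  by case: eqP => // ->.
have mA' j : measurable (if j == i then setT else A j) by case: ifP.
rewrite product_measure1E//; last exact: measurable_rect.
rewrite -[X in (X * _)%E]/(iid P n _) -[X in X = _]/(iid P n _) !iid_rect//.
rewrite (bigD1 i)//= [X in (X%:E * _)%E](bigD1 i)//= eqxx.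
rewrite [X in fine X * \prod_(j < n | _) fine (P (if _ then _ else _))](_ : _ = 1%E).
  rewrite mul1r mulrC EFinM; congr (_ * _)%E; last first.
    by rewrite fineK// ge0_fin_numE// (le_lt_trans (probability_le1 _ _))// ltry.
  by congr _%:E; apply: eq_bigr => j /negbTE ->.
exact: probability_setT.
Qed.

Lemma bm_upd n (i : 'I_n) (f : n.-tuple T -> R) : bm f -> bm (fun z => f (upd i z.1 z.2)).
Proof. by move=> bf; apply: (bm_comp bf); exact: measurable_upd. Qed.

(** Conditioning on all entries but one: the inner expectation is the
    conditional expectation of f given the entries other than the i-th. *)
Lemma Ex_upd n (i : 'I_n) (f : n.-tuple T -> R) : bm f ->
  Ex (iid P n) f = Ex (iid P n) (fun X => EP (fun y => f (upd i X y))).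
Proof.
move=> bf; have bf' := bm_upd i bf.
rewrite (Ex_prod _ _ bf') /Ex /Rintegral; congr fine.
pose nu := measure_function_pushforward__canonical__measure_function_Measure
  (iid P n \x P)%E (measurable_upd i).
transitivity (\int[nu]_x (f x)%:E)%E.
  by apply: eq_measure_integral => A mA _; exact: iid_upd.
rewrite /nu integral_pushforward//=.
- exact: measurable_upd.
- by apply/measurable_EFinP; case: bf.
- by rewrite preimage_setT; exact: bm_integrable_prod.
Qed.

Lemma bm_Ex_upd n (i : 'I_n) (f : n.-tuple T -> R) : bm f ->
  bm (fun X => EP (fun y => f (upd i X y))).
Proof. move=> bf; exact: (bm_Ex (iid P n) P (bm_upd i bf)). Qed.

Lemma bm_tnth n (i : 'I_n) (f : T -> R) : bm f -> bm (fun X : n.-tuple T => f (tnth X i)).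
Proof. by move=> bf; apply: (bm_comp bf); exact: measurable_tnth. Qed.

Lemma Ex_tnth n (i : 'I_n) (f : T -> R) : bm f ->
  Ex (iid P n) (fun X => f (tnth X i)) = EP f.
Proof.
move=> bf; rewrite (Ex_upd i); last exact: bm_tnth.
rewrite -[RHS](Ex_cst (iid P n)); congr Ex; apply/funext => X.
by congr Ex; apply/funext => y; rewrite tnth_upd eqxx.
Qed.

Lemma Ex_indep n (i : 'I_n) (f : T -> R) (g : n.-tuple T -> R) : bm f -> bm g ->
  (forall X y, g (upd i X y) = g X) ->
  Ex (iid P n) (fun X => f (tnth X i) * g X) = EP f * Ex (iid P n) g.
Proof.
move=> bf bg gi; rewrite (Ex_upd i); last by apply: bmM => //; exact: bm_tnth.
rewrite -ExZ//; congr Ex; apply/funext => X.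
rewrite mulrC -ExZ//; congr Ex; apply/funext => y.
by rewrite gi tnth_upd eqxx mulrC.
Qed.

(** The factors are replaced by their means one at a time; q k is the product
    in which the first k of them have been replaced. *)
Lemma Ex_prod_tnth n (p : 'I_n -> T -> R) : (forall i, bm (p i)) ->
  Ex (iid P n) (fun X => \prod_i p i (tnth X i)) = \prod_i EP (p i).
Proof.
move=> bp; pose q k (X : n.-tuple T) := \prod_(i < n) (if (i < k)%N then EP (p i) else p i (tnth X i)).
have bq k : bm (q k).
  by apply: bm_prod => i /=; case: (i < k)%N; [exact: bm_cst|exact: bm_tnth].
have q0 : (fun X : n.-tuple T => \prod_i p i (tnth X i)) = q 0%N.
  by apply/funext => X; apply: eq_bigr => i _.
have qn : Ex (iid P n) (q n) = \prod_i EP (p i).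
  rewrite -[RHS](Ex_cst (iid P n)); congr Ex; apply/funext => X.
  by apply: eq_bigr => i _; rewrite ltn_ord.
rewrite q0 -qn.
have step k : (k < n)%N -> Ex (iid P n) (q k) = Ex (iid P n) (q k.+1).
  move=> kn; pose i0 := Ordinal kn.
  pose r (X : n.-tuple T) := \prod_(i < n | i != i0) (if (i < k)%N then EP (p i) else p i (tnth X i)).
  have br : bm r by apply: bm_prod => i /=; case: (i < k)%N; [exact: bm_cst|exact: bm_tnth].
  have -> : q k = fun X => p i0 (tnth X i0) * r X.
    by apply/funext => X; rewrite /q (bigD1 i0)//= ltnn.
  have -> : q k.+1 = fun X => EP (p i0) * r X.
    apply/funext => X; rewrite /q (bigD1 i0)//= ltnSn; congr (_ * _).
    apply: eq_bigr => i ii0; rewrite ltnS leq_eqVlt.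
    by have /negbTE -> : (i : nat) != k by apply: contraNneq ii0 => ik; apply/eqP/val_inj.
  rewrite Ex_indep// ?ExZ// => X y; apply: eq_bigr => i ii0.
  by rewrite tnth_upd (negbTE ii0).
suff H k : (k <= n)%N -> Ex (iid P n) (q 0%N) = Ex (iid P n) (q k) by apply: (H n (leqnn n)).
elim: k => [_|k ih kn]; first by [].
rewrite (ih (ltnW kn)); exact: step.
Qed.

End iid_expectation.

(** * The Stein equation of the standard normal law *)

Section stein_equation.
Context (R : realType).
Notation mu := (@lebesgue_measure R).
Local Notation p := (@normal_pdf R 0 1).

Lemma pdfE (x : R) : p x = normal_peak 1 * expR (- x ^+ 2 / 2).
Proof. by rewrite normal_pdfE// /normal_fun subr0 expr1n. Qed.

Lemma pdf_gt0 (x : R) : 0 < p x.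
Proof. by rewrite pdfE mulr_gt0 ?expR_gt0// normal_peak_gt0. Qed.

Lemma pdfN (x : R) : p (- x) = p x.
Proof. by rewrite !pdfE sqrrN. Qed.

Lemma pdf_le (x y : R) : `|x| <= `|y| -> p y <= p x.
Proof.
move=> xy; rewrite !pdfE ler_pM2l ?normal_peak_gt0// ler_expR.
by rewrite !mulNr lerN2 ler_pM2r// -(real_normK (num_real x)) -(real_normK (num_real y)) ler_sqr ?nnegrE.
Qed.

Lemma pdf_continuous : continuous p.
Proof. by apply: continuous_normal_pdf; exact: oner_neq0. Qed.

Lemma is_derive_pdf (x : R) : is_derive x 1 p (- x * p x).
Proof.
rewrite (_ : p = fun x => normal_peak 1 * expR (- x ^+ 2 / 2)); last first.
  by apply/funext => y; exact: pdfE.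
apply: is_derive_eq.
rewrite /GRing.scale /=; move: (expR _) (normal_peak _) => e k.
by field.
Qed.

Lemma pdf_cvg0 : p x @[x --> +oo] --> 0.
Proof.
have s0 : 0 < (Num.sqrt 2)^-1 :> R by rewrite invr_gt0 sqrtr_gt0.
rewrite (_ : (fun x => p x) = fun x : R => normal_peak 1 * gauss_fun (x * (Num.sqrt 2)^-1)); last first.
  apply/funext => x; rewrite pdfE /gauss_fun exprMn exprVn sqr_sqrtr//.
  by rewrite mulNr.
rewrite -[X in _ --> X](mulr0 (normal_peak 1)); apply: cvgM; first exact: cvg_cst.
apply: cvg_comp; last exact: cvg_gauss_fun.
exact: gt0_cvgMly.
Qed.

Lemma pdf_integrable (A : set R) : measurable A -> mu.-integrable A (EFin \o p).
Proof.
by move=> mA; apply: (integrableS measurableT) => //; exact: integrable_normal_pdf.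
Qed.

(** Mills' bound: p(t) <= t p(t) / a for t >= a, and t p(t) = - p'(t). *)
Lemma pdf_tail (a : R) : 0 < a -> \int[mu]_(x in `[a, +oo[) p x <= p a / a.
Proof.
move=> a0.
have E : (\int[mu]_(x in `[a, +oo[) (x * p x)%:E = (p a)%:E)%E.
  rewrite (@ge0_continuous_FTC2y _ _ (fun x => - p x) a 0).
  - by rewrite -EFinB sub0r opprK.
  - by move=> x ax; rewrite mulr_ge0 ?normal_pdf_ge0// (le_trans _ ax)// ltW.
  - apply: continuous_subspaceT => x; apply: cvgM; first exact: cvg_id.
    exact: pdf_continuous.
  - by rewrite -[X in _ --> X]oppr0; apply: cvgN; exact: pdf_cvg0.
  - move=> x _; have := is_derive_pdf x => ?; exact: ex_derive.
  - by apply: cvgN; apply: cvg_at_right_filter; exact: pdf_continuous.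
  - move=> x _; have := is_derive_pdf x => ?.
    by rewrite derive1E derive_val mulNr opprK.
rewrite ler_pdivlMr// -lee_fin -E /Rintegral.
rewrite mulrC EFinM fineK; last first.
  by apply: integrable_fin_num => //; exact: pdf_integrable.
rewrite -ge0_integralZl//=; first last.
- by rewrite lee_fin ltW.
- by move=> x _; rewrite lee_fin normal_pdf_ge0.
- by apply/measurable_EFinP; apply: measurable_funTS; exact: measurable_normal_pdf.
apply: ge0_le_integral => //=.
- by move=> x _; rewrite lee_fin mulr_ge0 ?normal_pdf_ge0// ltW.
- apply/measurable_EFinP; apply: measurable_funTS; apply: measurable_funM => //.
  exact: measurable_normal_pdf.
- apply/measurable_EFinP; apply: measurable_funTS; apply: measurable_funM => //.
  exact: measurable_normal_pdf.
- move=> x; rewrite in_itv/= andbT => ax.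
  by rewrite lee_fin ler_wpM2r ?normal_pdf_ge0.
Qed.

Lemma pdf_tailN (a : R) : 0 < a -> \int[mu]_(x in `]-oo, (- a)%R]) p x <= p a / a.
Proof.
move=> a0; rewrite [leLHS](_ : _ = \int[mu]_(x in `[a, +oo[) p x); first exact: pdf_tail.
congr fine; rewrite (@ge0_integration_by_substitutionNy _ p a).
- by apply: eq_integral => x _; rewrite -[in RHS]pdfN.
- by apply: continuous_subspaceT => x; exact: pdf_continuous.
- by move=> x _; exact: normal_pdf_ge0.
Qed.

Lemma pdf_int1 : \int[mu]_x p x = 1.
Proof. by rewrite /Rintegral integral_normal_pdf. Qed.

Variable h : R -> R.
Hypothesis hc : continuous h.
Hypothesis h01 : forall x, 0 <= h x <= 1.

(** The mean of h under the standard normal law. *)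
Definition gauss_mean := \int[mu]_x (h x * p x).
Let c := gauss_mean.

Let bounded_integrable (g : R -> R) : continuous g -> (forall x, `|g x| <= 1) ->
  forall A : set R, measurable A -> mu.-integrable A (EFin \o (fun x => g x * p x)).
Proof.
move=> gc g1 A mA; apply: (integrableS measurableT) => //.
apply: (@le_integrable _ _ _ mu setT measurableT _ (EFin \o p)) => //; last exact: pdf_integrable.
  apply/measurable_EFinP; apply: measurable_funM; first exact: continuous_measurable_fun.
  exact: measurable_normal_pdf.
move=> x _ /=; rewrite lee_fin normrM ler_piMl//.
Qed.

Lemma gauss_mean01 : 0 <= c <= 1.
Proof.
apply/andP; split.
  apply: Rintegral_ge0 => x _; rewrite mulr_ge0 ?normal_pdf_ge0//.
  by case/andP: (h01 x).
rewrite -[leRHS]pdf_int1; apply: le_Rintegral => //.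
- by apply: bounded_integrable => // x; rewrite ger0_norm; case/andP: (h01 x).
- exact: pdf_integrable.
- by move=> x _; rewrite ler_piMl ?normal_pdf_ge0//; case/andP: (h01 x).
Qed.

Let g x := h x - c.
Let gc : continuous g. Proof. by move=> x; apply: cvgB; [exact: hc|exact: cvg_cst]. Qed.
Let g1 x : `|g x| <= 1.
Proof.
rewrite /g; have := gauss_mean01; have := h01 x.
by rewrite ler_norml => /andP[? ?] /andP[? ?]; apply/andP; split; lra.
Qed.

Let gp x := g x * p x.
Let igp A : measurable A -> mu.-integrable A (EFin \o gp).
Proof. exact: bounded_integrable. Qed.

Let F x := \int[mu]_(t in `]-oo, x]) gp t.

Let int_gp_le A : measurable A -> `|\int[mu]_(t in A) gp t| <= \int[mu]_(t in A) p t.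
Proof.
move=> mA; rewrite (le_trans (le_normr_Rintegral _ _))//; first exact: igp.
apply: le_Rintegral => //; [exact: integrable_norm (igp mA)|exact: pdf_integrable|].
by move=> x _; rewrite normrM (ger0_norm (normal_pdf_ge0 _ _ _)) ler_piMl ?normal_pdf_ge0.
Qed.

Let gpT : \int[mu]_t gp t = 0.
Proof.
transitivity (\int[mu]_t (h t * p t - c * p t)).
  by apply: eq_Rintegral => x _; rewrite /gp /g mulrBl.
rewrite RintegralB//.
- by rewrite RintegralZl//; [rewrite pdf_int1 mulr1 subrr|exact: pdf_integrable].
- by apply: bounded_integrable => // x; rewrite ger0_norm; case/andP: (h01 x).
- apply: bounded_integrable => //; first by move=> x; exact: cvg_cst.
  by move=> _; have := gauss_mean01 => /andP[? ?]; rewrite ger0_norm.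
Qed.

(** The integral of g p over the line is 0, by the choice of the constant
    [gauss_mean]. *)
Let F_right x : F x = - \int[mu]_(t in `]x, +oo[) gp t.
Proof.
apply/eqP; rewrite -subr_eq0 opprK; apply/eqP; rewrite -[RHS]gpT.
rewrite /F -Rintegral_setU//.
- by congr Rintegral; apply/seteqP; split => // t _ /=; rewrite !in_itv/= andbT; case: (leP t x); [left|right].
- by apply: igp; exact: measurableU.
- apply/disj_set2P/seteqP; split => // t [] /=.
  by rewrite !in_itv/= andbT => /le_lt_trans /[apply]; rewrite ltxx.
Qed.

Let F_le1 x : `|F x| <= 1.
Proof.
rewrite (le_trans (int_gp_le _))// -[leRHS]pdf_int1 /Rintegral fine_le//.
- by apply: integrable_fin_num => //; exact: pdf_integrable.
- by apply: integrable_fin_num => //; exact: pdf_integrable.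
apply: ge0_subset_integral => //.
  by apply/measurable_EFinP; exact: measurable_normal_pdf.
by move=> t _; rewrite lee_fin normal_pdf_ge0.
Qed.

(** The representation of F by the nearer tail makes Mills' bound applicable on
    each half line. *)
Let F_mills x : `|x * F x| <= p x.
Proof.
have [->|x0] := eqVneq x 0; first by rewrite mul0r normr0 ltW// pdf_gt0.
rewrite normrM mulrC -ler_pdivlMr ?normr_gt0//.
case: (ltrgtP x 0) x0 => // {}x0 _; last first.
  rewrite (gtr0_norm x0) F_right normrN (le_trans (int_gp_le _))//.
  by rewrite Rintegral_itv_obnd_cbnd ?pdf_tail//; exact: pdf_integrable.
rewrite (ltr0_norm x0) (le_trans (int_gp_le _))// -pdfN.
by have := @pdf_tailN (- x); rewrite oppr_gt0 opprK; exact.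
Qed.

(** The bounded solution f of f'(x) - x f(x) = h(x) - E h(Z). *)
Definition stein x := F x / p x.
Definition stein' x := x * stein x + g x.

Lemma is_derive_stein (x : R) : is_derive x 1 stein (stein' x).
Proof.
have [dF F'] : derivable F x 1 /\ derive1 F x = gp x.
  apply: (@continuous_FTC1 _ _ _ _ (x + 1)) => //.
  - by rewrite ltrDl.
  - exact: igp.
  - exact: ltNyr.
  - by apply: cvgM; [exact: gc|exact: pdf_continuous].
have iF : is_derive x 1 F (gp x) by apply: DeriveDef => //; rewrite -derive1E.
have ip := is_derive_pdf x.
have p0 := lt0r_neq0 (pdf_gt0 x).
have iV : is_derive x 1 (fun y => (p y)^-1) (- (p x) ^- 2 *: (- x * p x)).
  exact: is_deriveV.
rewrite /stein; apply: is_derive_eq.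
rewrite /stein' /stein /gp /GRing.scale/=.
by field.
Qed.

Lemma stein'E x : stein' x = x * stein x + h x - gauss_mean.
Proof. by rewrite /stein' /g addrA. Qed.

Lemma x_stein_le x : `|x * stein x| <= 1.
Proof.
rewrite /stein mulrA normrM normfV ler_pdivrMr ?normr_gt0 ?gt_eqF ?pdf_gt0// mul1r.
by rewrite (le_trans (F_mills x))// ler_norm.
Qed.

Lemma stein'_le x : `|stein' x| <= 2.
Proof.
rewrite /stein' (le_trans (ler_normD _ _))// (_ : 2 = 1 + 1)// lerD//.
exact: x_stein_le.
Qed.

(** Away from 0 the bound on x f(x) applies; on [-1, 1] the density is bounded
    below. *)
Lemma stein_le x : `|stein x| <= 1 + (p 1)^-1.
Proof.
have [x1|x1] := leP `|x| 1.
  rewrite /stein normrM (@le_trans _ _ (1 * (p 1)^-1))//.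
    rewrite ler_pM// normfV lef_pV2 ?posrE ?normr_gt0 ?gt_eqF ?pdf_gt0//.
    by rewrite (le_trans _ (ler_norm _))// pdf_le// normr1.
  by rewrite mul1r lerDr.
have := x_stein_le x; rewrite normrM => H.
have : `|stein x| <= `|x| * `|stein x| by rewrite ler_peMl// ltW.
move=> /le_trans /(_ H) H2; rewrite (le_trans H2)// lerDl invr_ge0 ltW// pdf_gt0//.
Qed.

End stein_equation.

Lemma mvt_between (R : realType) (f f' : R -> R) (w y : R) :
  (forall x : R, is_derive x 1 f (f' x)) ->
  exists2 t, `|t| <= `|y| & f (w + y) - f w = f' (w + t) * y.
Proof.
move=> df.
have cf a b : {within `[a, b], continuous f}.
  apply: continuous_subspaceT => x; have := df x => ?.
  by apply: differentiable_continuous; apply/derivable1_diffP; exact: ex_derive.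
have [y0|y0|<-] := ltrgtP 0 y.
- have wy : w < w + y by rewrite ltrDl.
  have [c] := MVT wy (fun x _ => df x) (cf _ _).
  rewrite in_itv/= => /andP[wc cy] ->; exists (c - w).
    by rewrite !gtr0_norm ?subr_gt0// lerBlDl ltW.
  by rewrite subrKC addrC addKr.
- have wy : w + y < w by rewrite gtrDl.
  have [c] := MVT wy (fun x _ => df x) (cf _ _).
  rewrite in_itv/= => /andP[yc cw] E; exists (c - w).
    by rewrite !ltr0_norm ?subr_lt0// lerN2 lerBrDl ltW.
  by rewrite -[LHS]opprB E subrKC opprD addrA subrr add0r mulrN opprK.
- by exists 0 => //; rewrite addr0 subrr mulr0.
Qed.

Section smooth_stein.
Context (R : realType).
Variables (h : R -> R) (L : R).
Hypothesis L0 : 0 <= L.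
Hypothesis hL : forall x y, `|h x - h y| <= L * `|x - y|.
Hypothesis h01 : forall x, 0 <= h x <= 1.

Lemma lipschitz_continuous : continuous h.
Proof.
move=> x; apply/cvgrPdist_lt => e e0; near=> t.
rewrite (le_lt_trans (hL _ _))//.
have L1 : 0 < L + 1 by rewrite ltr_wpDl.
rewrite (@le_lt_trans _ _ ((L + 1) * `|x - t|))//; first by rewrite ler_wpM2r// lerDl.
rewrite -ltr_pdivlMl//; near: t.
apply: cvgr_dist_lt; first exact: cvg_id.
by rewrite mulr_gt0// invr_gt0 ltr_wpDl.
Unshelve. all: by end_near. Qed.
Let hc := lipschitz_continuous.

Local Notation f := (stein h).
Local Notation f' := (stein' h).
Definition stein_cst := L + (1 + (@normal_pdf R 0 1 1)^-1).
Local Notation K := stein_cst.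

Lemma stein_cst_ge0 : 0 <= K.
Proof. by rewrite addr_ge0// addr_ge0// invr_ge0 normal_pdf_ge0. Qed.

Lemma stein_continuous : continuous f.
Proof.
move=> x; have := is_derive_stein hc h01 x => ?.
by apply: differentiable_continuous; apply/derivable1_diffP; exact: ex_derive.
Qed.

Lemma stein'_continuous : continuous f'.
Proof.
move=> x; apply: cvgD; last by apply: cvgB; [exact: hc|exact: cvg_cst].
by apply: cvgM; [exact: cvg_id|exact: stein_continuous].
Qed.

(** A Lipschitz constant growing linearly in w is enough for the central limit
    theorem, since it is integrated against a variable with bounded variance. It
    follows from the equation itself, without a second derivative of f. *)
Lemma stein'_lip (w t : R) : `|f' (w + t) - f' w| <= (K + 2 * `|w|) * `|t|.
Proof.
have [u _ fE] := mvt_between w t (is_derive_stein hc h01).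
rewrite !stein'E.
have -> : (w + t) * f (w + t) + h (w + t) - gauss_mean h - (w * f w + h w - gauss_mean h) =
    w * (f (w + t) - f w) + t * f (w + t) + (h (w + t) - h w) by ring.
rewrite fE (le_trans (ler_normD _ _))//.
have H1 : `|h (w + t) - h w| <= L * `|t| by rewrite (le_trans (hL _ _))// addrAC subrr add0r.
have H2 : `|w * (f' (w + u) * t) + t * f (w + t)| <=
    `|w| * 2 * `|t| + `|t| * (1 + (@normal_pdf R 0 1 1)^-1).
  rewrite (le_trans (ler_normD _ _))// lerD//.
    by rewrite mulrA !normrM ler_wpM2r// ler_wpM2l// stein'_le.
  by rewrite normrM ler_wpM2l// stein_le.
by rewrite (le_trans (lerD H2 H1))// /stein_cst; lra.
Qed.

Lemma stein_taylor (w t : R) : `|f (w + t) - f w - f' w * t| <= (K + 2 * `|w|) * t ^+ 2.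
Proof.
have [u ut ->] := mvt_between w t (is_derive_stein hc h01).
rewrite -mulrBl normrM -(real_normK (num_real t)) expr2 mulrA ler_wpM2r//.
rewrite (le_trans (stein'_lip _ _))// ler_wpM2l// addr_ge0// ?stein_cst_ge0//.
Qed.

End smooth_stein.

Lemma bm_continuous d (T : measurableType d) (R : realType) (g : R -> R) (W : T -> R) :
  continuous g -> bm W -> bm (fun x => g (W x)).
Proof.
move=> gc [mW [M WM]]; split.
  by apply: (measurableT_comp _ mW); exact: continuous_measurable_fun.
have MM : - `|M| <= `|M| by rewrite (@le_trans _ _ 0)// oppr_le0.
have cg : {within `[- `|M|, `|M|], continuous (fun x => `|g x|)}.
  apply: continuous_subspaceT => x; apply: cvg_norm; exact: gc.
have [c _ H] := EVT_max MM cg.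
exists `|g c| => x; apply: H.
by rewrite in_itv/= -ler_norml (le_trans (WM x))// ler_norm.
Qed.

(** * A quantitative central limit theorem *)

Section clt_bound.
Context d (T : measurableType d) (R : realType) (P : probability T R) (n : nat).
Local Notation EP := (Ex P).
Local Notation EN := (Ex (iid P n)).
Variables (y : T -> R) (b : R).
Hypothesis (by_ : bm y) (y0 : EP y = 0) (yb : forall x, `|y x| <= b) (b1 : b <= 1).

Definition iidsum (X : n.-tuple T) : R := \sum_i y (tnth X i).
Local Notation W := iidsum.
Let tau := EP (fun x => y x ^+ 2).

Lemma bm_iidsum : bm W.
Proof. by apply: bm_sum => i; exact: bm_tnth. Qed.

Lemma iidsum_var : EN (fun X => W X ^+ 2) = n%:R * tau.
Proof.
have bij i j : bm (fun X : n.-tuple T => y (tnth X i) * y (tnth X j)).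
  by apply: bmM; exact: bm_tnth.
transitivity (EN (fun X => \sum_i \sum_j y (tnth X i) * y (tnth X j))).
  by congr Ex; apply/funext => X; rewrite expr2 /iidsum big_distrlr.
rewrite Ex_sum; last by move=> i; exact: bm_sum.
transitivity (\sum_(i < n) tau); last by rewrite sumr_const card_ord mulr_natl.
apply: eq_bigr => i _; rewrite Ex_sum// (bigD1 i)//= big1 ?addr0; last first.
  move=> j ji; rewrite Ex_indep ?y0 ?mul0r//; first exact: bm_tnth.
  by move=> X z; rewrite tnth_upd (negbTE ji).
rewrite /tau -(Ex_tnth P i); last exact: bm_exp.
by congr Ex; apply/funext => X; rewrite expr2.
Qed.

Variables (h : R -> R) (L : R).
Hypothesis L0 : 0 <= L.
Hypothesis hL : forall x y, `|h x - h y| <= L * `|x - y|.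
Hypothesis h01 : forall x, 0 <= h x <= 1.
Local Notation f := (stein h).
Local Notation f' := (stein' h).
Local Notation K := (stein_cst L).
Let fc : continuous f := stein_continuous L0 hL h01.
Let f'c : continuous f' := stein'_continuous L0 hL h01.

(** With w the sum of the other terms, y f(w + y) is compared with
    y f(w) + y^2 f'(w): the first term is centred, and the second has mean
    tau f'(w). *)
Lemma stein_local (w : R) :
  `|EP (fun x => y x * f (w + y x)) - tau * EP (fun x => f' (w + y x))|
    <= 2 * b ^+ 3 * (K + 2 * `|w|).
Proof.
have bw : bm (fun x => w + y x) by apply: bmD => //; exact: bm_cst.
have bf := bm_continuous fc bw; have bf' := bm_continuous f'c bw.
have by2 := bm_exp 2 by_.
have b0 : 0 <= b by apply: le_trans (yb point).
have tau0 : 0 <= tau by apply: Ex_ge0 => x; exact: sqr_ge0.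
have taub : tau <= b ^+ 2.
  rewrite -[leRHS](Ex_cst P); apply: le_Ex => //; first exact: bm_cst.
  by move=> x; rewrite -(real_normK (num_real (y x))) ler_sqr ?nnegrE.
have Kw : 0 <= K + 2 * `|w| by rewrite addr_ge0 ?mulr_ge0// stein_cst_ge0.
have E1 : EP (fun x => y x * f (w + y x)) - tau * f' w =
    EP (fun x => y x * (f (w + y x) - f w - f' w * y x)).
  rewrite (_ : (fun x => _ * (_ - _ - _)) = fun x => y x * f (w + y x) - (f w * y x + f' w * y x ^+ 2)).
    rewrite ExB; [|exact: bmM|by apply: bmD; exact: bmZ].
    by rewrite ExD ?ExZ ?y0//; [rewrite /tau; ring|exact: bmZ|exact: bmZ].
  by apply/funext => x; ring.
have B1 : `|EP (fun x => y x * f (w + y x)) - tau * f' w| <= b ^+ 3 * (K + 2 * `|w|).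
  rewrite E1; apply: norm_Ex_bound.
    apply: bmM => //; apply: bmB; last exact: bmZ.
    by apply: bmB => //; exact: bm_cst.
  move=> x; rewrite normrM exprS -mulrA ler_pM//.
  rewrite (le_trans (stein_taylor L0 hL h01 _ _))// mulrC ler_wpM2r//.
  by rewrite -(real_normK (num_real (y x))) ler_sqr ?nnegrE.
have B2 : `|tau * EP (fun x => f' (w + y x)) - tau * f' w| <= b ^+ 3 * (K + 2 * `|w|).
  rewrite -mulrBr normrM (ger0_norm tau0) exprSr -mulrA ler_pM//.
  rewrite -[X in _ - X](Ex_cst P) -ExB//; last exact: bm_cst.
  apply: norm_Ex_bound; first by apply: bmB => //; exact: bm_cst.
  move=> x; rewrite (le_trans (stein'_lip L0 hL h01 _ _))// mulrC ler_wpM2r//.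
move: B1 B2; move: (EP _) (tau * EP _) (tau * f' w) => A B C.
rewrite (distrC B C) => B1 B2.
rewrite -(subrKA C) (le_trans (ler_normD _ _))// (le_trans (lerD B1 B2))//.
by rewrite [leRHS](_ : _ = b ^+ 3 * (K + 2 * `|w|) + b ^+ 3 * (K + 2 * `|w|)) //; ring.
Qed.

(** By the Stein equation, E h(W) - E h(Z) = E f'(W) - E W f(W). Resampling the
    i-th summand of W f(W) turns the claim into [stein_local]. The factor
    2 + n tau comes from |w| <= 2 + W^2 for the sum w without one term, as
    E W^2 = n tau. *)
Theorem clt_bound :
  `|EN (fun X => h (W X)) - gauss_mean h| <=
    2 * `|n%:R * tau - 1| + n%:R * (2 * b ^+ 3 * (K + 2 * (2 + n%:R * tau))).
Proof.
have hc := lipschitz_continuous L0 hL.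
have bW := bm_iidsum.
have bfW := bm_continuous fc bW; have bf'W := bm_continuous f'c bW.
have b0 : 0 <= b by apply: le_trans (yb point).
have tau0 : 0 <= tau by apply: Ex_ge0 => x; exact: sqr_ge0.
have ntau0 : 0 <= n%:R * tau by rewrite mulr_ge0.
pose rest i (X : n.-tuple T) := \sum_(j < n | j != i) y (tnth X j).
have brest i : bm (rest i) by apply: bm_sum => j; exact: bm_tnth.
have WE i X z : W (upd i X z) = rest i X + y z.
  rewrite /iidsum (bigD1 i)//= tnth_upd eqxx addrC; congr (_ + _).
  by apply: eq_bigr => j ji; rewrite tnth_upd (negbTE ji).
have one (i : 'I_n) : `|EN (fun X => y (tnth X i) * f (W X)) - tau * EN (fun X => f' (W X))|
    <= 2 * b ^+ 3 * (K + 2 * (2 + n%:R * tau)).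
  rewrite (Ex_upd P i) ?(Ex_upd P i bf'W); last by apply: bmM => //; exact: bm_tnth.
  rewrite -ExZ; last exact: (bm_Ex_upd P i bf'W).
  apply: (@le_trans _ _ (EN (fun X => 2 * b ^+ 3 * (K + 2 * (2 + W X ^+ 2))))).
    apply: norm_ExB_le.
    - by apply: (@bm_Ex_upd _ _ _ P _ i (fun X => y (tnth X i) * f (W X))); apply: bmM => //; exact: bm_tnth.
    - by apply: bmZ; exact: (bm_Ex_upd P i bf'W).
    - apply: bmZ; apply: bmD; first exact: bm_cst.
      by apply: bmZ; apply: bmD; [exact: bm_cst|exact: bm_exp].
    move=> X.
    rewrite (_ : (fun z => _ * f _) = fun z => y z * f (rest i X + y z)); last first.
      by apply/funext => z; rewrite WE tnth_upd eqxx.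
    rewrite (_ : (fun z => f' _) = fun z => f' (rest i X + y z)); last first.
      by apply/funext => z; rewrite WE.
    rewrite (le_trans (stein_local _))// ler_wpM2l ?mulr_ge0 ?exprn_ge0//.
    rewrite lerD2l ler_wpM2l//.
    have -> : rest i X = W X - y (tnth X i).
      by rewrite /iidsum (bigD1 i)//= addrAC subrr add0r.
    rewrite (le_trans (ler_normB _ _))//.
    have := yb (tnth X i); have : `|W X| <= 1 + W X ^+ 2.
      rewrite -(real_normK (num_real (W X))); move: `|_| => t; nra.
    by move: `|W X| (W X ^+ 2) `|y _| => u v s H1 H2; move: b1; lra.
  rewrite ExZ; last first.
    apply: bmD; first exact: bm_cst.
    by apply: bmZ; apply: bmD; [exact: bm_cst|exact: bm_exp].
  rewrite ExD; [|exact: bm_cst|by apply: bmZ; apply: bmD; [exact: bm_cst|exact: bm_exp]].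
  rewrite Ex_cst ExZ; last by apply: bmD; [exact: bm_cst|exact: bm_exp].
  by rewrite ExD ?Ex_cst ?iidsum_var//; [exact: bm_cst|exact: bm_exp].
have E : EN (fun X => h (W X)) - gauss_mean h =
    (1 - n%:R * tau) * EN (fun X => f' (W X)) -
    \sum_(i < n) (EN (fun X => y (tnth X i) * f (W X)) - tau * EN (fun X => f' (W X))).
  rewrite sumrB sumr_const card_ord -mulr_natl -Ex_sum; last first.
    by move=> i; apply: bmM => //; exact: bm_tnth.
  have -> : (fun X => \sum_(i < n) y (tnth X i) * f (W X)) = fun X => W X * f (W X).
    by apply/funext => X; rewrite -mulr_suml.
  have bWf : bm (fun X => W X * f (W X)) by exact: bmM.
  have bh := bm_continuous hc bW.
  have : EN (fun X => h (W X) - gauss_mean h) = EN (fun X => f' (W X) - W X * f (W X)).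
    by congr Ex; apply/funext => X; rewrite stein'E; ring.
  by rewrite !ExB ?Ex_cst//; [move=> ->; ring|exact: bm_cst].
rewrite E (le_trans (ler_normB _ _))// lerD//.
  rewrite normrM mulrC distrC ler_wpM2r//.
  by apply: norm_Ex_bound => // X; exact: stein'_le.
rewrite (le_trans (ler_norm_sum _ _ _))// (le_trans (ler_sum _ (fun i _ => one i)))//.
by rewrite sumr_const card_ord [leRHS]mulr_natl.
Qed.

End clt_bound.

(** * Second moments of U-statistics *)

Section ustat.
Context d (T : measurableType d) (R : realType) (P : probability T R) (n : nat).
Local Notation EP := (Ex P).
Local Notation EN := (Ex (iid P n)).

Lemma bm_pair_tnth (u : T -> T -> R) (i k : 'I_n) : bm (fun p => u p.1 p.2) ->
  bm (fun X : n.-tuple T => u (tnth X i) (tnth X k)).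
Proof.
move=> bu; apply: (@bm_comp _ _ _ _ _ (fun X : n.-tuple T => (tnth X i, tnth X k)) _ bu).
by apply: measurable_fun_pair; exact: measurable_tnth.
Qed.

(** Conditioning on the entries other than the k-th, on which G depends. *)
Lemma Ex_cond_bound (k : 'I_n) (F G : n.-tuple T -> R) (r M : R) : bm F -> bm G ->
  (forall X z, G (upd k X z) = G X) -> (forall X, `|G X| <= M) ->
  (forall X, `|EP (fun z => F (upd k X z))| <= r) ->
  `|EN (fun X => F X * G X)| <= r * M.
Proof.
move=> bF bG Gk GM Fr; rewrite (Ex_upd P k); last exact: bmM.
apply: norm_Ex_bound; first by apply: (@bm_Ex_upd _ _ _ P _ k (fun X => F X * G X)); exact: bmM.
move=> X; rewrite (_ : (fun y => _) = fun z => G X * F (upd k X z)); last first.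
  by apply/funext => z; rewrite Gk mulrC.
rewrite ExZ; last exact: (bm_pair1 (bm_upd k bF) X).
by rewrite normrM mulrC ler_pM.
Qed.

Lemma sum_sq (I : finType) (F : I -> n.-tuple T -> R) (B : I -> I -> R) :
  (forall i, bm (F i)) ->
  (forall i k, `|EN (fun X => F i X * F k X)| <= B i k) ->
  EN (fun X => (\sum_i F i X) ^+ 2) <= \sum_i \sum_k B i k.
Proof.
move=> bF FB; have bFF i k : bm (fun X => F i X * F k X) by exact: bmM.
rewrite (_ : (fun X => _) = fun X => \sum_i \sum_k F i X * F k X); last first.
  by apply/funext => X; rewrite expr2 big_distrlr.
rewrite Ex_sum; last by move=> i; exact: bm_sum.
apply: ler_sum => i _; rewrite Ex_sum//; apply: ler_sum => k _.
by rewrite (le_trans (ler_norm _))// FB.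
Qed.

(** A cross term with k <> l vanishes: one of k and l differs from i and from
    the other index, and can be integrated out. *)
Lemma empirical_sq (v : T -> T -> R) (i : 'I_n) : bm (fun p => v p.1 p.2) ->
  (forall x y, `|v x y| <= 1) -> (forall x, EP (v x) = 0) ->
  EN (fun X => (\sum_k v (tnth X i) (tnth X k)) ^+ 2) <= n%:R.
Proof.
move=> bv v1 v0.
have bvik k := bm_pair_tnth i k bv.
have out k l : k != i -> k != l ->
    `|EN (fun X => v (tnth X i) (tnth X k) * v (tnth X i) (tnth X l))| <= 0.
  move=> ki kl; rewrite -[leRHS](mul0r 1); apply: (Ex_cond_bound (k := k)) => //.
    by move=> X z; rewrite !tnth_upd eq_sym (negbTE ki) eq_sym (negbTE kl).
  move=> X; rewrite (_ : (fun z => _) = v (tnth X i)) ?v0 ?normr0//.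
  by apply/funext => z; rewrite !tnth_upd eqxx eq_sym (negbTE ki).
apply: (@le_trans _ _ (\sum_(k < n) \sum_(l < n) (if l == k then 1 else 0))).
  apply: sum_sq => // k l; case: eqVneq => [->|lk].
    apply: norm_Ex_bound; first exact: bmM.
    by move=> X; rewrite normrM -[leRHS]mulr1 ler_pM.
  have [ki|ki] := eqVneq k i; last by apply: out => //; rewrite eq_sym.
  under [X in Ex _ X]eq_fun do rewrite mulrC.
  by apply: out => //; rewrite -ki.
under eq_bigr do rewrite -big_mkcond big_pred1_eq.
by rewrite sumr_const card_ord.
Qed.

(** In the expansion of the square, a pair of terms (i, k), (i', k') contributes
    only if it is equal to (i, k) or (k, i), or if k' = k; the n^3 terms of the last kind carry
    the factor r, as the index i can be integrated out. *)
Lemma ustat_sq (u : T -> T -> R) (M r : R) : bm (fun p => u p.1 p.2) ->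
  (forall x y, `|u x y| <= M) -> (forall x, EP (u x) = 0) ->
  (forall y, `|EP (u ^~ y)| <= r) ->
  EN (fun X => (\sum_i \sum_(k | k != i) u (tnth X i) (tnth X k)) ^+ 2)
    <= n%:R ^+ 2 * (2 * M ^+ 2 + n%:R * (r * M)).
Proof.
move=> bu uM u0 ur.
have M0 : 0 <= M by apply: le_trans (uM point point).
have r0 : 0 <= r by apply: le_trans (ur point).
pose v (p : 'I_n * 'I_n) (X : n.-tuple T) :=
  if p.2 != p.1 then u (tnth X p.1) (tnth X p.2) else 0.
have bv p : bm (v p).
  by rewrite /v; case: (p.2 != p.1); [exact: bm_pair_tnth|exact: bm_cst].
have vM p X : `|v p X| <= M by rewrite /v; case: ifP => // _; rewrite normr0.
rewrite (_ : (fun X => _) = fun X => (\sum_p v p X) ^+ 2); last first.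
  apply/funext => X; congr (_ ^+ 2); rewrite pair_big_dep /=.
  by rewrite big_mkcond.
pose B (p q : 'I_n * 'I_n) : R := (if q == p then M ^+ 2 else 0) +
  (if q == (p.2, p.1) then M ^+ 2 else 0) + (if q.2 == p.2 then r * M else 0).
have c0 (b : bool) (x : R) : 0 <= x -> 0 <= (if b then x else 0) by case: b.
have M20 : 0 <= M ^+ 2 by exact: sqr_ge0.
have rM0 : 0 <= r * M by exact: mulr_ge0.
apply: (@le_trans _ _ (\sum_p \sum_q B p q)).
  apply: sum_sq => // -[i k] [i' k'].
  have trivial : `|EN (fun X => v (i, k) X * v (i', k') X)| <= M ^+ 2.
    apply: norm_Ex_bound; first exact: bmM.
    by move=> X; rewrite normrM ler_pM.
  have [ik|ik] := eqVneq k i.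
    rewrite (_ : (fun X => _) = fun=> 0) ?Ex_cst ?normr0 ?addr_ge0 ?c0//.
    by apply/funext => X; rewrite /v/= ik eqxx mul0r.
  have [ik'|ik'] := eqVneq k' i'.
    rewrite (_ : (fun X => _) = fun=> 0) ?Ex_cst ?normr0 ?addr_ge0 ?c0//.
    by apply/funext => X; rewrite /v/= ik' eqxx mulr0.
  rewrite /B !xpair_eqE/=.
  have [kk|kk] := eqVneq k' k.
    rewrite andbT; have [ii|ii] := eqVneq i' i.
      by rewrite (le_trans trivial)// -addrA lerDl addr_ge0// c0.
    rewrite (@le_trans _ _ (r * M))//; last by rewrite lerDr addr_ge0// c0.
    apply: (Ex_cond_bound (k := i)) => //.
      by move=> X z; rewrite /v/= !tnth_upd kk (negbTE ii) (negbTE ik).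
    move=> X; rewrite (_ : (fun z => _) = u ^~ (tnth X k))//.
    by apply/funext => z; rewrite /v/= ik !tnth_upd eqxx (negbTE ik).
  rewrite andbF add0r addr0.
  have [ki'|ki'] := eqVneq i' k.
    have [k'i|k'i] := eqVneq k' i; first by rewrite (le_trans trivial).
    rewrite /= -(mul0r M).
    under [X in Ex _ X]eq_fun do rewrite mulrC.
    apply: (Ex_cond_bound (k := k')) => //.
      by move=> X z; rewrite /v/= !tnth_upd (eq_sym i k') (negbTE k'i) (eq_sym k k') (negbTE kk).
    move=> X; rewrite (_ : (fun z => _) = u (tnth X i')) ?u0 ?normr0//.
    by apply/funext => z; rewrite /v/= ik' !tnth_upd eqxx (eq_sym i' k') (negbTE ik').
  rewrite /= -(mul0r M).
  apply: (Ex_cond_bound (k := k)) => //.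
    by move=> X z; rewrite /v/= !tnth_upd (negbTE ki') (negbTE kk).
  move=> X; rewrite (_ : (fun z => _) = u (tnth X i)) ?u0 ?normr0//.
  by apply/funext => z; rewrite /v/= ik !tnth_upd eqxx (eq_sym i k) (negbTE ik).
have Bp p : \sum_q B p q = 2 * M ^+ 2 + n%:R * (r * M).
  rewrite /B !big_split/= -!big_mkcond/= !big_pred1_eq.
  rewrite -(pair_big xpredT (fun k => k == p.2) (fun _ _ => r * M))/=.
  under eq_bigr do rewrite big_pred1_eq.
  by rewrite sumr_const card_ord mulr_natl mulr2n mulr_natl.
under eq_bigr do rewrite Bp.
by rewrite sumr_const card_prod card_ord [leRHS]mulrC -natrX mulr_natr.
Qed.

End ustat.

(** * First-order expansion of a product *)

(** The two bounds are proved together because the induction step for the second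
    uses the first. *)
Lemma prod_taylor (R : realType) m (s e : 'I_m -> R) :
  (forall j, 0 <= s j <= 1) -> (forall j, 0 <= s j + e j <= 1) ->
  `|\prod_j (s j + e j) - \prod_j s j| <= \sum_j `|e j| /\
  `|\prod_j (s j + e j) - \prod_j s j - \sum_j e j * \prod_(l | l != j) s l|
    <= (\sum_j `|e j|) ^+ 2.
Proof.
elim: m s e => [|m ih] s e s01 a01.
  by rewrite !big_ord0 subrr subr0 normr0 expr0n; split.
have [H1 H2] := ih (fun j => s (lift ord0 j)) (fun j => e (lift ord0 j))
  (fun j => s01 _) (fun j => a01 _).
rewrite !big_ord_recl/=.
set A := \prod_(i < m) (_ + _) in H1 H2 *.
have -> : \prod_(l < m.+1 | l != ord0) s l = \prod_(j < m) s (lift ord0 j).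
  by rewrite big_mkcond big_ord_recl/= mul1r.
set S := \prod_(i < m) _ in H1 H2 *.
have -> : \sum_(i < m) e (lift ord0 i) * \prod_(l | l != lift ord0 i) s l =
    s ord0 * \sum_(i < m) e (lift ord0 i) * \prod_(l | l != i) s (lift ord0 l).
  rewrite mulr_sumr; apply: eq_bigr => i _.
  rewrite big_mkcond big_ord_recl neq_lift mulrCA.
  congr (_ * (_ * _)); rewrite [RHS]big_mkcond; apply: eq_bigr => l _.
  by rewrite (inj_eq lift_inj).
set D := \sum_(i < m) _ in H2 *.
set E := \sum_(i < m) `|_| in H1 H2 *.
have E0 : 0 <= E by exact: sumr_ge0.
have A1 : 0 <= A <= 1.
  rewrite prodr_ge0 => [|i _]; last by case/andP: (a01 (lift ord0 i)).
  by apply: prodr_ile1 => i _; exact: a01.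
have S1 : 0 <= S <= 1.
  rewrite prodr_ge0 => [|i _]; last by case/andP: (s01 (lift ord0 i)).
  by apply: prodr_ile1 => i _; exact: s01.
have /andP[s0 s1] := s01 ord0.
split.
  have -> : (s ord0 + e ord0) * A - s ord0 * S = e ord0 * A + s ord0 * (A - S) by ring.
  rewrite (le_trans (ler_normD _ _))// lerD// normrM.
    by rewrite ler_piMr// ger0_norm; case/andP: A1.
  by rewrite ger0_norm// (le_trans _ H1)// ler_piMl.
have -> : (s ord0 + e ord0) * A - s ord0 * S - (e ord0 * S + s ord0 * D) =
  s ord0 * (A - S - D) + e ord0 * (A - S) by ring.
rewrite (le_trans (ler_normD _ _))// !normrM (ger0_norm s0).
have K1 : s ord0 * `|A - S - D| <= E ^+ 2 by rewrite (le_trans _ H2)// ler_piMl.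
have K2 : `|e ord0| * `|A - S| <= `|e ord0| * E by rewrite ler_wpM2l.
rewrite (le_trans (lerD K1 K2))//.
have := normr_ge0 (e ord0); move: (`|e ord0|) E0 => t; nra.
Qed.

Lemma sqr_sum_le (R : realType) m (a : 'I_m -> R) :
  (\sum_j a j) ^+ 2 <= m%:R * \sum_j a j ^+ 2.
Proof.
elim: m a => [|m ih] a; first by rewrite !big_ord0 expr0n mul0r.
rewrite !big_ord_recl; have := ih (fun j => a (lift ord0 j)).
set A := \sum_(_ < m) _; set B := \sum_(_ < m) _ => AB.
have B0 : 0 <= B by apply: sumr_ge0 => j _; exact: sqr_ge0.
have H : 2 * (a ord0 * A) <= m%:R * a ord0 ^+ 2 + B.
  move: AB; have : 0 <= m%:R :> R by [].
  move: (m%:R) (a ord0) => k t; rewrite le_eqVlt => /predU1P[<-|k0] AB.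
    move: AB; rewrite mul0r => A0.
    have -> : A = 0 by apply/eqP; rewrite -sqrf_eq0 eq_le A0 sqr_ge0.
    by rewrite !mulr0 mul0r add0r.
  rewrite -(ler_pM2l k0).
  have := sqr_ge0 (k * t - A); nra.
rewrite -natr1; nra.
Qed.

(** * Linearization of the rank statistic *)

Section survival.
Context (R : realType).

(** The survival function of the uniform law on [0, 1]. *)
Definition usurv (x : R) : R := Num.max 0 (Num.min 1 (1 - x)).

Lemma usurv01 x : 0 <= usurv x <= 1.
Proof. by rewrite /usurv le_max lexx/= ge_max ler01 ge_min lexx. Qed.

Lemma usurv_itv x : 0 <= x <= 1 -> usurv x = 1 - x.
Proof.
move=> /andP[x0 x1]; rewrite /usurv min_r ?max_r ?subr_ge0//.
by rewrite gerBl.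
Qed.

Lemma bm_usurv d (T : measurableType d) (f : T -> R) : measurable_fun setT f ->
  bm (fun x => usurv (f x)).
Proof.
move=> mf; split; last first.
  by exists 1 => x; case/andP: (usurv01 (f x)) => ? ?; rewrite ger0_norm.
apply: measurable_maxr => //; apply: measurable_minr => //.
exact: measurable_funB.
Qed.

End survival.

Section rank_expansion.
Context (R : realType) (m n : nat) (P : probability (vec R m) R).
Local Notation EP := (Ex P).
Local Notation EN := (Ex (iid P n)).
Implicit Types (x y : vec R m) (X : n.-tuple (vec R m)).

Definition surv x j : R := usurv (tnth x j : R).
(** The centred contribution of the observation y to the relative rank of x_j. *)
Definition exceed (j : 'I_m) x y : R := ((tnth x j : R) < tnth y j)%R%:R - surv x j.
Definition others (j : 'I_m) x : R := \prod_(l | l != j) surv x l.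
Definition half_pow : R := (2 ^+ m)^-1.
Local Notation w := half_pow.
(** The influence function of the rank statistic at the independence model. *)
Definition score x : R := \prod_j surv x j - w - 2 * w * \sum_j (surv x j - 2^-1).
(** The first-order term of the rank statistic, minus its projection on the
    second observation at the independence model. *)
Definition kern x y : R :=
  \sum_j (exceed j x y * others j x - 2 * w * (2^-1 - surv y j)).
Definition relrank X i j : R := n%:R^-1 * (n%:R + 1 - (rank X i j)%:R).
Definition rankmean X : R := n%:R^-1 * \sum_i \prod_j relrank X i j.

Lemma surv01 x j : 0 <= surv x j <= 1. Proof. exact: usurv01. Qed.

Lemma measurable_coord (j : 'I_m) : measurable_fun setT (fun x => tnth x j : R).
Proof. exact: (@measurable_tnth _ (measurableTypeR R) m j). Qed.

Lemma bm_surv j : bm (surv^~ j).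
Proof. by apply: bm_usurv; exact: measurable_coord. Qed.

Lemma bm_exceed j : bm (fun p : vec R m * vec R m => exceed j p.1 p.2).
Proof.
apply: bmB; last by apply: (bm_comp (bm_surv j)); exact: measurable_fst.
apply: bm_bool; apply: measurable_fun_ltr.
  by apply: (measurableT_comp (measurable_coord j)); exact: measurable_fst.
by apply: (measurableT_comp (measurable_coord j)); exact: measurable_snd.
Qed.

Lemma bm_others j : bm (others j).
Proof. by apply: bm_prod => l; exact: bm_surv. Qed.

Lemma bm_score : bm score.
Proof.
apply: bmB; first by apply: bmB; [apply: bm_prod => j; exact: bm_surv|exact: bm_cst].
by apply: bmZ; apply: bm_sum => j; apply: bmB; [exact: bm_surv|exact: bm_cst].
Qed.

Lemma bm_kern : bm (fun p : vec R m * vec R m => kern p.1 p.2).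
Proof.
apply: bm_sum => j; apply: bmB.
  apply: bmM; first exact: bm_exceed.
  by apply: (bm_comp (bm_others j)); exact: measurable_fst.
apply: bmZ; apply: bmB; first exact: bm_cst.
by apply: (bm_comp (bm_surv j)); exact: measurable_snd.
Qed.

Lemma others01 j x : 0 <= others j x <= 1.
Proof.
rewrite prodr_ge0/= => [|l _]; last by case/andP: (surv01 x l).
by apply: prodr_ile1 => l _; exact: surv01.
Qed.

Lemma exceed_le1 j x y : `|exceed j x y| <= 1.
Proof.
rewrite /exceed; have := surv01 x j.
by case: (_ < _) => /andP[? ?]; rewrite ler_norml; apply/andP; split => /=; lra.
Qed.

Lemma half_pow01 : 0 <= w <= 1.
Proof.
rewrite /half_pow invr_ge0 exprn_ge0//= invf_le1 ?exprn_gt0//.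
by rewrite exprn_ege1// ler1n.
Qed.

Lemma kern_le x y : `|kern x y| <= 2 * m%:R.
Proof.
rewrite (le_trans (ler_norm_sum _ _ _))//.
apply: (@le_trans _ _ (\sum_(j < m) 2)); last by rewrite sumr_const card_ord mulr_natr.
apply: ler_sum => j _; rewrite (le_trans (ler_normB _ _))// (_ : 2 = 1 + 1)// lerD//.
  rewrite normrM -[leRHS]mulr1 ler_pM ?exceed_le1//.
  by case/andP: (others01 j x) => ? ?; rewrite ger0_norm.
have /andP[w0 w1] := half_pow01; have /andP[s0 s1] := surv01 y j.
have ws0 := mulr_ge0 w0 s0; have ws1 : w * surv y j <= w by rewrite ler_piMr.
rewrite (_ : 2 * w * (2^-1 - surv y j) = w - 2 * (w * surv y j)); last by field.
by rewrite ler_norml; apply/andP; split; lra.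
Qed.

Hypothesis n0 : (0 < n)%N.
Let n0' : 0 < n%:R :> R. Proof. by rewrite ltr0n. Qed.
Let nV0 : 0 <= n%:R^-1 :> R. Proof. by rewrite invr_ge0 ltW. Qed.
Let nV : n%:R * n%:R^-1 = 1 :> R. Proof. by rewrite divff// gt_eqF. Qed.

(** Tied observations share the largest rank, so n - R_ij counts the observations
    strictly larger than X_ij. The extra n^-1 is of smaller order than the
    fluctuation. *)
Lemma relrankE X i j : relrank X i j = surv (tnth X i) j +
  (n%:R^-1 + n%:R^-1 * \sum_k exceed j (tnth X i) (tnth X k)).
Proof.
have -> : \sum_k exceed j (tnth X i) (tnth X k) =
    n%:R - (rank X i j)%:R - n%:R * surv (tnth X i) j.
  rewrite /exceed sumrB sumr_const card_ord mulr_natl; congr (_ - _).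
  rewrite /rank -sum1_card natr_sum.
  have -> : n%:R = \sum_(k < n) 1 :> R by rewrite sumr_const card_ord.
  rewrite [X in _ - X]big_mkcond -sumrB; apply: eq_bigr => k _.
  by rewrite inE ltNge; case: (_ <= _); rewrite ?subrr ?subr0.
rewrite /relrank !mulrBr mulrA [n%:R^-1 * n%:R]mulrC nV mul1r !mulrDr mulrC nV; ring.
Qed.

Definition rank_dev X i j : R := n%:R^-1 + n%:R^-1 * \sum_k exceed j (tnth X i) (tnth X k).

Lemma relrank01 X i j : 0 <= relrank X i j <= 1.
Proof.
have r1 : (1 <= rank X i j)%N.
  by rewrite /rank (cardD1 i) inE lexx.
have rn : (rank X i j <= n)%N by rewrite /rank -[leqRHS]card_ord max_card.
rewrite /relrank mulr_ge0//=; last first.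
  by rewrite subr_ge0 (@le_trans _ _ n%:R)// ?ler_nat// lerDl.
rewrite mulrC ler_pdivrMr// mul1r lerBlDr lerD2l.
by rewrite (_ : 1 = 1%:R)// ler_nat.
Qed.

Lemma bm_rank_dev i j : bm (fun X => rank_dev X i j).
Proof.
apply: bmD; first exact: bm_cst.
apply: bmZ; apply: bm_sum => k.
exact: (bm_pair_tnth i k (bm_exceed j)).
Qed.

Lemma bm_relrank i j : bm (fun X => relrank X i j).
Proof.
rewrite (_ : (fun X => _) = fun X => surv (tnth X i) j + rank_dev X i j).
  by apply: bmD; [exact: (bm_tnth i (bm_surv j))|exact: bm_rank_dev].
by apply/funext => X; rewrite relrankE.
Qed.

Lemma bm_rankmean : bm rankmean.
Proof. by apply: bmZ; apply: bm_sum => i; apply: bm_prod => j; exact: bm_relrank. Qed.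

Definition offdiag_sum X : R := \sum_i \sum_(k | k != i) kern (tnth X i) (tnth X k).

(** The first two errors are the quadratic remainder of the product and the
    diagonal and n^-1 terms; the projection of the linear term is part of the
    score. *)
Lemma rankmean_expansion X :
  `|(rankmean X - w) - n%:R^-1 * \sum_i score (tnth X i)| <=
    n%:R^-1 * \sum_i (m%:R * \sum_j rank_dev X i j ^+ 2) + n%:R^-1 * (3 * m%:R)
    + n%:R^-1 ^+ 2 * `|offdiag_sum X|.
Proof.
pose Q i := \prod_j relrank X i j - \prod_j surv (tnth X i) j
            - \sum_j rank_dev X i j * others j (tnth X i).
have -> : rankmean X - w - n%:R^-1 * \sum_i score (tnth X i) =
    n%:R^-1 * \sum_i Q i
    + n%:R^-1 ^+ 2 * (\sum_i \sum_j others j (tnth X i))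
    + n%:R^-1 ^+ 2 * (\sum_i kern (tnth X i) (tnth X i))
    + n%:R^-1 ^+ 2 * offdiag_sum X.
  have E1 : \sum_i score (tnth X i) = \sum_i \prod_j surv (tnth X i) j - n%:R * w
      - 2 * w * \sum_i \sum_j (surv (tnth X i) j - 2^-1).
    by rewrite /score sumrB sumrB sumr_const card_ord -[w *+ n]mulr_natl mulr_sumr.
  have E2 : \sum_i Q i = \sum_i \prod_j relrank X i j
      - \sum_i \prod_j surv (tnth X i) j
      - \sum_i \sum_j rank_dev X i j * others j (tnth X i).
    by rewrite /Q sumrB sumrB.
  have E3 : \sum_i \sum_j rank_dev X i j * others j (tnth X i) =
      n%:R^-1 * \sum_i \sum_j others j (tnth X i)
      + n%:R^-1 * \sum_i \sum_k \sum_j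
          exceed j (tnth X i) (tnth X k) * others j (tnth X i).
    rewrite !mulr_sumr -big_split; apply: eq_bigr => i _ /=.
    rewrite exchange_big/= !mulr_sumr -big_split; apply: eq_bigr => j _ /=.
    by rewrite /rank_dev mulrDl -mulr_suml mulrA.
  have E4 : \sum_i kern (tnth X i) (tnth X i) + offdiag_sum X =
      \sum_i \sum_k \sum_j exceed j (tnth X i) (tnth X k) * others j (tnth X i)
      + n%:R * (2 * w * \sum_k \sum_j (surv (tnth X k) j - 2^-1)).
    rewrite /offdiag_sum -big_split/=.
    transitivity (\sum_i \sum_k kern (tnth X i) (tnth X k)).
      by apply: eq_bigr => i _; rewrite [RHS](bigD1 i).
    have -> : n%:R * (2 * w * \sum_k \sum_j (surv (tnth X k) j - 2^-1)) =
        \sum_(i < n) \sum_k \sum_j 2 * w * (surv (tnth X k) j - 2^-1).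
      rewrite sumr_const card_ord -[RHS]mulr_natl mulr_sumr; congr (_ * _).
      by apply: eq_bigr => k _; rewrite mulr_sumr.
    rewrite -big_split; apply: eq_bigr => i _; rewrite -big_split; apply: eq_bigr => k _ /=.
    rewrite -big_split; apply: eq_bigr => j _ /=; ring.
  have -> : offdiag_sum X = (\sum_i kern (tnth X i) (tnth X i) + offdiag_sum X)
      - \sum_i kern (tnth X i) (tnth X i) by ring.
  rewrite E4 E1 E2 E3 /rankmean.
  move: nV; move: (n%:R) (n%:R^-1) => a b ab.
  have a0 : a != 0 by apply/eqP => a0; move: ab; rewrite a0 mul0r => /eqP; rewrite eq_sym oner_eq0.
  have -> : b = a^-1 by rewrite -[RHS]mulr1 -ab mulKf.
  by field.
have HQ : `|n%:R^-1 * \sum_i Q i| <= n%:R^-1 * \sum_i (m%:R * \sum_j rank_dev X i j ^+ 2).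
  rewrite normrM (ger0_norm nV0) ler_wpM2l// (le_trans (ler_norm_sum _ _ _))//.
  apply: ler_sum => i _; have [_] := @prod_taylor R m (surv (tnth X i)) (rank_dev X i)
    (surv01 (tnth X i)) (fun j => ltac:(by rewrite -relrankE relrank01)).
  rewrite /Q; under eq_bigr do rewrite -relrankE.
  move=> H; rewrite (le_trans H)// (le_trans (sqr_sum_le _))// ler_wpM2l//.
  by apply: ler_sum => j _; rewrite real_normK ?num_real.
have nVn : n%:R^-1 ^+ 2 * n%:R = n%:R^-1 :> R by rewrite expr2 -mulrA [_ * n%:R]mulrC nV mulr1.
have HO : `|n%:R^-1 ^+ 2 * \sum_i \sum_j others j (tnth X i)| <= n%:R^-1 * m%:R.
  rewrite normrM ger0_norm ?exprn_ge0// -[in leRHS]nVn -[leRHS]mulrA ler_wpM2l ?exprn_ge0//.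
  rewrite (le_trans (ler_norm_sum _ _ _))// mulr_natl -[X in _ *+ X](card_ord n) -sumr_const.
  apply: ler_sum => i _; rewrite (le_trans (ler_norm_sum _ _ _))//.
  rewrite -[m in m%:R](card_ord m) -sumr_const; apply: ler_sum => j _.
  by case/andP: (others01 j (tnth X i)) => ? ?; rewrite ger0_norm.
have HK : `|n%:R^-1 ^+ 2 * \sum_i kern (tnth X i) (tnth X i)| <= n%:R^-1 * (2 * m%:R).
  rewrite normrM ger0_norm ?exprn_ge0// -[in leRHS]nVn -[leRHS]mulrA ler_wpM2l ?exprn_ge0//.
  rewrite (le_trans (ler_norm_sum _ _ _))// [leRHS]mulr_natl -[X in _ *+ X](card_ord n) -sumr_const.
  by apply: ler_sum => i _; exact: kern_le.
rewrite (le_trans (ler_normD _ _))// lerD//; last by rewrite normrM ger0_norm ?exprn_ge0.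
rewrite (_ : 3 * m%:R = m%:R + 2 * m%:R); last by ring.
rewrite [n%:R^-1 * (_ + _)]mulrDr addrA (le_trans (ler_normD _ _))// lerD//.
by rewrite (le_trans (ler_normD _ _))// lerD.
Qed.

Hypothesis margin : forall j x, EP (fun y => ((tnth x j : R) < tnth y j)%R%:R) = surv x j.
Hypothesis half : forall j, EP (surv^~ j) = 2^-1.

Lemma Ex_exceed j x : EP (exceed j x) = 0.
Proof.
rewrite /exceed ExB ?margin ?Ex_cst ?subrr//; last exact: bm_cst.
by apply: bm_bool; apply: measurable_fun_ltr => //; exact: measurable_coord.
Qed.

Lemma Ex_kern x : EP (kern x) = 0.
Proof.
have be j : bm (exceed j x) by exact: (bm_pair1 (bm_exceed j) x).
have bh j : bm (fun y => 2^-1 - surv y j) by apply: bmB; [exact: bm_cst|exact: bm_surv].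
rewrite /kern Ex_sum; last first.
  move=> j; apply: bmB; last exact: bmZ.
  by apply: bmM => //; exact: bm_cst.
apply: big1 => j _.
rewrite (_ : (fun _ => _) = fun y => others j x * exceed j x y - 2 * w * (2^-1 - surv y j)); last first.
  by apply/funext => y; rewrite [others _ _ * _]mulrC.
rewrite ExB; [|exact: bmZ|exact: bmZ].
rewrite !ExZ// Ex_exceed ExB; [|exact: bm_cst|exact: bm_surv].
by rewrite Ex_cst half subrr !mulr0 subrr.
Qed.

Lemma rank_dev_sq i j : EN (fun X => rank_dev X i j ^+ 2) <= 4 * n%:R^-1.
Proof.
have bs : bm (fun X => \sum_k exceed j (tnth X i) (tnth X k)).
  by apply: bm_sum => k; exact: (bm_pair_tnth i k (bm_exceed j)).
have bs2 := bm_exp 2 bs.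
have Vn := empirical_sq i (bm_exceed j) (exceed_le1 j) (Ex_exceed j).
set V := Ex _ _ in Vn.
apply: (@le_trans _ _ (EN (fun X => 2 * n%:R^-1 ^+ 2 +
    2 * n%:R^-1 ^+ 2 * (\sum_k exceed j (tnth X i) (tnth X k)) ^+ 2))).
  apply: le_Ex; first by apply: bm_exp; exact: bm_rank_dev.
    by apply: bmD; [exact: bm_cst|exact: bmZ].
  move=> X; rewrite /rank_dev; move: (\sum_k _) (n%:R^-1) => s b.
  have := sqr_ge0 (b - b * s); nra.
rewrite ExD ?Ex_cst ?ExZ -/V//; [|exact: bm_cst|exact: bmZ].
have n1 : n%:R^-1 <= 1 :> R by rewrite invf_le1// ler1n.
have H1 : 2 * n%:R^-1 ^+ 2 <= 2 * n%:R^-1 :> R.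
  by rewrite expr2 ler_wpM2l// ler_piMr.
have H2 : 2 * n%:R^-1 ^+ 2 * V <= 2 * n%:R^-1 :> R.
  rewrite (@le_trans _ _ (2 * n%:R^-1 ^+ 2 * n%:R))// ?ler_wpM2l ?mulr_ge0 ?exprn_ge0//.
  by rewrite expr2 -!mulrA [_ * n%:R]mulrC nV mulr1.
rewrite (le_trans (lerD H1 H2))// -mulrDl; lra.
Qed.

Variable r : R.
Hypothesis kern_r : forall y, `|EP (kern^~ y)| <= r.

(** The three errors of [rankmean_expansion] after multiplication by sqrt n.
    The first ones are of order 1 / sqrt n; the U-statistic is controlled by its
    second moment. *)
Theorem rankmean_linear :
  EN (fun X => `|Num.sqrt n%:R * (rankmean X - w) -
                 (Num.sqrt n%:R)^-1 * \sum_i score (tnth X i)|) <=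
  (4 * m%:R ^+ 2 + 3 * m%:R) / Num.sqrt n%:R +
  Num.sqrt (8 * m%:R ^+ 2 / n%:R + 2 * m%:R * r).
Proof.
have s0 : 0 < Num.sqrt n%:R :> R by rewrite sqrtr_gt0.
have sV : (Num.sqrt n%:R)^-1 = Num.sqrt n%:R * n%:R^-1 :> R.
  by rewrite -[in n%:R^-1](@sqr_sqrtr _ n%:R)// expr2 invfM mulVKf// gt_eqF.
have bS : bm (fun X => \sum_i score (tnth X i)).
  by apply: bm_sum => i; exact: (bm_tnth i bm_score).
have bD : bm (fun X => \sum_i (m%:R * \sum_j rank_dev X i j ^+ 2)).
  apply: bm_sum => i; apply: bmZ; apply: bm_sum => j; apply: bm_exp; exact: bm_rank_dev.
have bU : bm offdiag_sum.
  by apply: bm_sum => i; apply: bm_sum => k; exact: (bm_pair_tnth i k bm_kern).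
have bUn := bm_norm bU.
apply: (@le_trans _ _ (EN (fun X => Num.sqrt n%:R * (
    (n%:R^-1 * \sum_i (m%:R * \sum_j rank_dev X i j ^+ 2) + n%:R^-1 * (3 * m%:R))
    + n%:R^-1 ^+ 2 * `|offdiag_sum X|)))).
  apply: le_Ex.
  - apply: bm_norm; apply: bmB; last exact: bmZ.
    by apply: bmZ; apply: bmB; [exact: bm_rankmean|exact: bm_cst].
  - apply: bmZ; apply: bmD; last exact: bmZ.
    by apply: bmD; [exact: bmZ|exact: bm_cst].
  move=> X; rewrite sV -mulrA -mulrBr normrM (ger0_norm (ltW s0)) ler_wpM2l ?(ltW s0)//.
  exact: rankmean_expansion.
rewrite ExZ; last first.
  apply: bmD; last exact: bmZ.
  by apply: bmD; [exact: bmZ|exact: bm_cst].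
rewrite ExD; [|by apply: bmD; [exact: bmZ|exact: bm_cst]|exact: bmZ].
rewrite mulrDr lerD//.
  rewrite sV [leRHS]mulrCA ler_wpM2l ?(ltW s0)//.
  rewrite ExD; [|exact: bmZ|exact: bm_cst].
  rewrite Ex_cst [leRHS]mulrC mulrDr lerD2r//.
  rewrite ExZ// ler_wpM2l//.
  rewrite Ex_sum; last by move=> i; apply: bmZ; apply: bm_sum => j; apply: bm_exp; exact: bm_rank_dev.
  apply: (@le_trans _ _ (\sum_(i < n) (4 * m%:R ^+ 2 * n%:R^-1))); last first.
    by rewrite sumr_const card_ord -[leLHS]mulr_natl [leLHS]mulrCA nV mulr1.
  apply: ler_sum => i _; rewrite ExZ; last by apply: bm_sum => j; apply: bm_exp; exact: bm_rank_dev.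
  rewrite Ex_sum; last by move=> j; apply: bm_exp; exact: bm_rank_dev.
  rewrite (_ : 4 * m%:R ^+ 2 * n%:R^-1 = m%:R * (m%:R * (4 * n%:R^-1))); last by ring.
  rewrite ler_wpM2l// (le_trans (ler_sum _ (fun j _ => rank_dev_sq i j)))//.
  by rewrite sumr_const card_ord -[leLHS]mulr_natl.
rewrite ExZ// mulrA.
have nn0 : 0 <= Num.sqrt n%:R * n%:R^-1 ^+ 2 :> R by rewrite mulr_ge0 ?exprn_ge0// ltW.
apply: (le_trans (ler_wpM2l nn0 (Ex_norm_le_sqrt _ bU))).
rewrite -(ger0_norm nn0) -sqrtr_sqr -sqrtrM ?sqr_ge0//.
apply: ler_wsqrtr.
have := ustat_sq n bm_kern kern_le Ex_kern kern_r.
have -> : (Num.sqrt n%:R * n%:R^-1 ^+ 2) ^+ 2 = n%:R^-1 ^+ 3 :> R.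
  by rewrite exprMn sqr_sqrtr// -exprM (exprS _ 3) mulrA nV mul1r.
rewrite -/(offdiag_sum _) => H.
have H2 := ler_wpM2l (exprn_ge0 3 nV0) H.
apply: (le_trans H2).
move: nV => /=; move: (n%:R) (n%:R^-1) => a b ab.
have -> : b ^+ 3 * (a ^+ 2 * (2 * (2 * m%:R) ^+ 2 + a * (r * (2 * m%:R)))) =
  (a * b) ^+ 2 * (8 * m%:R ^+ 2 * b) + (a * b) ^+ 3 * (2 * m%:R * r) by ring.
by rewrite ab !expr1n !mul1r.
Qed.

End rank_expansion.

(** * Laws concentrated on the cube *)

Section cube_measures.
Context (R : realType) (m : nat).
Implicit Types (x y : vec R m).

Definition clip (t : R) : R := Num.max 0 (Num.min 1 t).

Lemma clip01 t : 0 <= clip t <= 1.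
Proof. by rewrite /clip le_max lexx/= ge_max ler01 ge_min lexx. Qed.

Lemma clip_id t : 0 <= t <= 1 -> clip t = t.
Proof. by move=> /andP[t0 t1]; rewrite /clip min_r// max_r. Qed.

Lemma usurvE t : usurv t = 1 - clip t.
Proof.
rewrite /usurv /clip !minEle !maxEle.
by case: (leP 1 (1 - t)); case: (leP 1 t) => H1 H2; do ?case: leP => ?; lra.
Qed.

Lemma le_clip (s t : R) : 0 < s <= 1 -> (s <= clip t) = (s <= t).
Proof.
move=> /andP[s0 s1]; rewrite /clip le_max le_min s1/=.
by rewrite leNgt s0.
Qed.

Definition clipv x : vec R m := [tuple clip (tnth x j : R) | j < m].

Lemma tnth_clipv x j : tnth (clipv x) j = clip (tnth x j : R).
Proof. by rewrite tnth_mktuple. Qed.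

Lemma cube_clipv x : cube (clipv x).
Proof. by move=> j; rewrite tnth_clipv; exact: clip01. Qed.

Lemma clipv_id x : cube x -> clipv x = x.
Proof. by move=> cx; apply: eq_from_tnth => j; rewrite tnth_clipv clip_id. Qed.

Definition box x : set (vec R m) := [set y | forall j, (tnth y j : R) <= tnth x j].

Lemma boxE x : box x = rect (fun j => [set` `]-oo, (tnth x j : R)]] : set (measurableTypeR R)).
Proof. by apply/seteqP; split => y H j; have := H j; rewrite /= in_itv. Qed.

Lemma measurable_box x : measurable (box x).
Proof. by rewrite boxE; apply: measurable_rect => j; exact: measurable_itv. Qed.

(** The half-open cube. The boundary at 0 is removed so that clipping a threshold
    to [0, 1] does not change which of these points lie below it. *)
Definition hcube : set (vec R m) :=
  rect (fun=> [set` `]0%R, 1%R]] : set (measurableTypeR R)).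

Lemma measurable_hcube : measurable hcube.
Proof. by apply: measurable_rect => j; exact: measurable_itv. Qed.

Lemma measure_hcube (mu : {measure set (vec R m) -> \bar R}) (A : set (vec R m)) :
  mu (~` hcube) = 0%E -> measurable A -> mu A = mu (A `&` hcube).
Proof.
move=> mu0 mA; rewrite (measureDI mu mA measurable_hcube) [X in (X + _)%E](_ : _ = 0%E) ?add0e//.
apply/eqP; rewrite eq_le measure_ge0 andbT -mu0 setDE.
by apply: le_measure; rewrite ?inE//; [apply: measurableI => //|]; try apply: measurableC; exact: measurable_hcube.
Qed.

(** The full line is included so that rectangles with free coordinates are
    available. *)
Definition rays : set (set (measurableTypeR R)) :=
  [set A | A = setT \/ exists t : R, A = [set` `]-oo, t]]].

Lemma rays_generate : (@measurable _ (measurableTypeR R)) = <<s rays >>.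
Proof.
apply/seteqP; split; last first.
  apply: smallest_sub; first exact: sigma_algebra_measurable.
  by move=> A [->//|[t ->]]; exact: measurable_itv.
rewrite [X in X `<=` _](RGenOInfty.measurableE R).
apply: smallest_sub; first exact: smallest_sigma_algebra.
move=> A [t ->]; rewrite -setCitvl.
have [_ + _] : sigma_algebra setT <<s rays>> by exact: smallest_sigma_algebra.
move=> /(_ [set` `]-oo, t]]); rewrite setTD; apply.
by apply: sub_sigma_algebra; right; exists t.
Qed.

(** On the half-open cube a free coordinate is the constraint x_j <= 1. *)
Lemma rays_rect (A : 'I_m -> set (measurableTypeR R)) : (forall j, rays (A j)) ->
  exists2 x, cube x & rect A `&` hcube = box x `&` hcube.
Proof.
move=> rA.
have /choice[t tA] : forall j, exists t : R, forall s : R, 0 < s <= 1 -> A j s <-> s <= clip t.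
  move=> j; case: (rA j) => [->|[t ->]].
    by exists 1 => s s01; rewrite clip_id ?ler01 ?lexx//; split => // _; case/andP: s01.
  by exists t => s s01; rewrite le_clip//= in_itv.
exists (clipv [tuple t j | j < m]); first exact: cube_clipv.
apply/seteqP; split => y /= [H hy]; split => // j.
  rewrite tnth_clipv tnth_mktuple; apply/tA; last exact: H.
  by have := hy j; rewrite /= in_itv.
by apply/tA; [have := hy j; rewrite /= in_itv|have := H j; rewrite tnth_clipv tnth_mktuple].
Qed.

Lemma cdf_unique (mu nu : {measure set (vec R m) -> \bar R}) :
  (mu setT < +oo)%E -> mu (~` hcube) = 0%E -> nu (~` hcube) = 0%E ->
  (forall x, cube x -> mu (box x) = nu (box x)) ->
  forall B, measurable B -> mu B = nu B.
Proof.
move=> muoo mu0 nu0 mn; apply: (tuple_measure_unique rays_generate) => //.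
- move=> A B [->|[s ->]] [->|[t ->]]; rewrite ?setTI ?setIT; [by left|by right; exists t|by right; exists s|].
  right; exists (Num.min s t); apply/seteqP; split => y /=; rewrite !in_itv/= le_min.
    by move=> [-> ->].
  by move=> /andP[].
- by left.
move=> A rA.
have mA : measurable (rect A).
  by apply: measurable_rect => j; case: (rA j) => [->//|[t ->]]; exact: measurable_itv.
have [x cx E] := rays_rect rA.
have mb := measurable_box x.
rewrite (measure_hcube mu0 mA) (measure_hcube nu0 mA) E -(measure_hcube mu0 mb) -(measure_hcube nu0 mb).
exact: mn.
Qed.

End cube_measures.

(** * The uniform law on the cube *)

Section uniform.
Context (R : realType).
Notation leb := (@lebesgue_measure R).

Definition unif : probability (measurableTypeR R) R := uniform_prob (@ltr01 R).

Lemma unifE (A : set (measurableTypeR R)) : measurable A ->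
  unif A = leb (A `&` [set` `[0, 1]]).
Proof.
move=> mA; rewrite /unif /= /uniform_prob integral_uniform_pdf.
rewrite (eq_integral (fun=> 1%:E)); last first.
  by move=> x; rewrite inE/= in_itv/= /uniform_pdf => -[_ ->]; rewrite subr0 invr1.
by rewrite integral_cst ?mul1e//; exact: measurableI.
Qed.

Lemma unif_le (t : R) : unif [set` `]-oo, t]] = (clip t)%:E.
Proof.
rewrite unifE; last exact: measurable_itv.
rewrite -set_itvI.
have [t0|t0] := ltP t 0.
  rewrite (_ : [set` _] = set0) ?measure0; last first.
    by apply/seteqP; split => x //=; rewrite in_itvI !in_itv/= => /andP[? /andP[? _]]; lra.
  by rewrite /clip min_r ?max_l// ltW// (lt_trans t0).
have [t1|t1] := leP t 1.
  rewrite (_ : [set` _] = [set` `[0, t]]); last first.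
    apply/seteqP; split => x /=; rewrite in_itvI !in_itv/=.
      by move=> /andP[-> /andP[-> _]].
    by move=> /andP[x0 xt]; rewrite x0 xt (le_trans xt).
  rewrite lebesgue_measure_itv/= lte_fin clip_id ?t0//.
  by case: ltgtP t0 => // [_ _|<- _]; rewrite ?oppr0 ?adde0.
rewrite (_ : [set` _] = [set` `[0, 1]]); last first.
  apply/seteqP; split => x /=; rewrite in_itvI !in_itv/=; first by move=> /andP[].
  by move=> /andP[x0 xt]; rewrite x0 xt (le_trans xt)//= ltW.
rewrite lebesgue_measure_itv/= lte_fin ltr01 oppr0 adde0.
by rewrite /clip min_l ?max_r// ltW.
Qed.

Lemma unif_oc : unif [set` `]0, 1]] = 1%E.
Proof.
rewrite unifE; last exact: measurable_itv.
rewrite -set_itvI (_ : [set` _] = [set` `]0, 1]]); last first.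
  apply/seteqP; split => x /=; rewrite in_itvI !in_itv/=; first by move=> /andP[].
  by move=> /andP[x0 xt]; rewrite x0 xt (ltW x0).
by rewrite lebesgue_measure_itv/= lte_fin ltr01 oppr0 adde0.
Qed.

Lemma Ex_unif_usurv k : Ex unif (fun s => usurv s ^+ k) = k.+1%:R^-1.
Proof.
rewrite -Rintegral_onemXn /Ex /Rintegral; congr fine.
have mf : measurable_fun setT (fun s : R => usurv s ^+ k).
  by apply: measurable_funX; case: (@bm_usurv R _ (measurableTypeR R) id (@measurable_id _ _ setT)).
rewrite integral_uniform.
- rewrite subr0 invr1 mul1e; apply: eq_integral => x.
  by rewrite inE/= in_itv/= => x01; rewrite usurv_itv.
- exact/measurable_EFinP.
- by move=> x; rewrite lee_fin exprn_ge0//; case/andP: (usurv01 x).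
Qed.

Lemma bm_le (t : R) : bm (fun s : measurableTypeR R => ((s : R) <= t)%R%:R : R).
Proof. by apply: bm_bool; apply: measurable_fun_ler. Qed.

Lemma Ex_unif_le (t : R) : Ex unif (fun s => ((s : R) <= t)%R%:R) = clip t.
Proof.
rewrite (_ : (fun s => _) = \1_[set` `]-oo, t]]); last first.
  by apply/funext => s; rewrite indicE mem_setE in_itv.
by rewrite Ex_indic ?unif_le//; exact: measurable_itv.
Qed.

(** The uniform law has no atoms, so weak and strict inequalities agree. *)
Lemma Ex_unif_eq (t : R) : Ex unif (fun s => ((s : R) == t)%:R) = 0.
Proof.
rewrite (_ : (fun s => _) = \1_[set t]); last first.
  apply/funext => s; rewrite indicE; congr (nat_of_bool _)%:R.
  by apply/eqP/idP => [->|/set_mem//]; exact/mem_set.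
have mt : measurable ([set t] : set (measurableTypeR R)) by exact: measurable_set1.
rewrite Ex_indic// unifE//.
suff -> : lebesgue_measure ([set t] `&` [set` `[0, 1]]) = 0%E by [].
apply/eqP; rewrite eq_le measure_ge0 andbT -(lebesgue_measure_set1 t).
by apply: le_measure; rewrite ?inE//; apply: measurableI.
Qed.

Lemma Ex_unif_lt (t : R) : Ex unif (fun s => ((s : R) < t)%R%:R) = clip t.
Proof.
have be : bm (fun s : measurableTypeR R => ((s : R) == t)%:R : R).
  by apply: bm_bool; apply: measurable_fun_eqr.
rewrite -Ex_unif_le -[LHS]addr0 -(Ex_unif_eq t) -ExD//; last first.
  by apply: bm_bool; apply: measurable_fun_ltr.
by congr Ex; apply/funext => s; rewrite -natrD le_eqVlt; case: ltgtP.
Qed.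

Lemma Ex_unif_ge (t : R) : Ex unif (fun s => (t <= (s : R))%R%:R) = usurv t.
Proof.
have bl : bm (fun s : measurableTypeR R => ((s : R) < t)%R%:R : R).
  by apply: bm_bool; apply: measurable_fun_ltr.
rewrite usurvE -(Ex_unif_lt t) -[X in X - _](Ex_cst unif) -ExB//; last exact: bm_cst.
by congr Ex; apply/funext => s; rewrite ltNge; case: (t <= s); rewrite ?subr0 ?subrr.
Qed.

End uniform.

Section uniform_cube.
Context (R : realType) (m : nat).
Implicit Types (x y : vec R m).
Local Notation U := (@unif R).
Definition ucube : probability (vec R m) R := iid U m.

Lemma ucube_hcube : ucube (~` @hcube R m) = 0%E.
Proof.
rewrite probability_setC; last exact: measurable_hcube.
rewrite /ucube /= /hcube iid_rect; last by move=> j; exact: measurable_itv.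
rewrite big1 ?subee// => j _; by rewrite unif_oc.
Qed.

Lemma ucube_box x : ucube (box x) = (\prod_j clip (tnth x j : R))%:E.
Proof.
rewrite boxE /ucube /= iid_rect; last by move=> j; exact: measurable_itv.
by congr _%:E; apply: eq_bigr => j _; rewrite unif_le.
Qed.

Lemma cubeE : @cube R m = rect (fun=> [set` `[0%R, 1%R]] : set (measurableTypeR R)).
Proof. by apply/seteqP; split => y H j; have := H j; rewrite /= in_itv. Qed.

Lemma measurable_cube : measurable (@cube R m).
Proof. by rewrite cubeE; apply: measurable_rect => j; exact: measurable_itv. Qed.

Lemma lebesgue_vec_rect (i : 'I_m -> interval R) (v : 'I_m -> R) :
  (forall j, lebesgue_measure ([set` i j] : set R) = (v j)%:E) ->
  lebesgue_vec R m (rect (fun j => [set` i j] : set (measurableTypeR R))) =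
    (\prod_j v j)%:E.
Proof.
move=> iv; rewrite /lebesgue_vec power_measure_rect.
- by congr _%:E; apply: eq_bigr => j _; rewrite -[RHS]/(fine (v j)%:E) -iv.
- by move=> j; exact: measurable_itv.
- by move=> j; apply: (@le_lt_trans _ _ (v j)%:E); [rewrite -iv|exact: ltry].
Qed.

Lemma leb_cc (t : R) : 0 <= t -> lebesgue_measure ([set` `[0, t]] : set R) = t%:E.
Proof.
move=> t0; rewrite lebesgue_measure_itv/= lte_fin.
by case: ltgtP t0 => // [_ _|<- _]; rewrite ?oppr0 ?adde0.
Qed.

(** Restricted to the cube, Lebesgue measure has the distribution function of the
    uniform law. *)
Lemma lebesgue_vec_cube (A : set (vec R m)) : measurable A -> A `<=` @cube R m ->
  lebesgue_vec R m A = ucube A.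
Proof.
move=> mA Ac.
have lc : lebesgue_vec R m (@cube R m) = 1%E.
  by rewrite cubeE (lebesgue_vec_rect (v := fun=> 1)) ?big1// => j; exact: leb_cc.
have lh : lebesgue_vec R m (@hcube R m) = 1%E.
  rewrite /hcube (lebesgue_vec_rect (v := fun=> 1)) ?big1// => j.
  by rewrite lebesgue_measure_itv/= lte_fin ltr01 oppr0 adde0.
have hc : @hcube R m `<=` @cube R m.
  by move=> y H j; have := H j; rewrite /= in_itv/= => /andP[/ltW -> ->].
rewrite -(setIidl Ac) -[LHS]/(mrestr (lebesgue_vec R m) measurable_cube A) (setIidl Ac).
move: A mA {Ac}; apply: cdf_unique.
- by rewrite /= /mrestr setTI [X in (X < _)%E]lc ltry.
- rewrite /= /mrestr setIC -setDE measureD//=.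
  + by rewrite setIidr// -[X in (X - _)%E]/(lebesgue_vec R m (@cube R m)) lc lh subee.
  + exact: measurable_cube.
  + exact: measurable_hcube.
  + by rewrite -[X in (X < _)%E]/(lebesgue_vec R m (@cube R m)) lc ltry.
- exact: ucube_hcube.
move=> x cx; rewrite /= /mrestr ucube_box.
rewrite (_ : _ `&` _ = rect (fun j => [set` `[0, (tnth x j : R)]] : set (measurableTypeR R))).
  rewrite -[LHS]/(lebesgue_vec R m _) (lebesgue_vec_rect (v := fun j => tnth x j)).
    by congr _%:E; apply: eq_bigr => j _; rewrite clip_id.
  by move=> j; rewrite leb_cc//; case/andP: (cx j).
apply/seteqP; split => y /=.
  by move=> [yx yc] j /=; rewrite in_itv/= yx; case/andP: (yc j) => ->.
move=> H; split => j; have := H j; rewrite /= in_itv/= => /andP[y0 yx]//.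
by rewrite y0 (le_trans yx)//; case/andP: (cx j).
Qed.

End uniform_cube.

(** * Laws of the dependence model *)

Section model_law.
Context (R : realType) (m : nat) (Omega : vec R m -> R).
Implicit Types (x y : vec R m).
Hypothesis Omega1 : forall x k, cube x -> (forall j, j != k -> tnth x j = 1) -> Omega x = 0.

Definition one_at (k : 'I_m) (t : R) : vec R m := [tuple if j == k then t else 1 | j < m].

Lemma tnth_one_at k t j : tnth (one_at k t) j = if j == k then t else 1.
Proof. by rewrite tnth_mktuple. Qed.

Lemma cube_one_at k t : 0 <= t <= 1 -> cube (one_at k t).
Proof. by move=> t01 j; rewrite tnth_one_at; case: eqP => // _; rewrite ler01 lexx. Qed.

Lemma prod_one_at k t : \prod_j (tnth (one_at k t) j : R) = t.
Proof.
rewrite (bigD1 k)//= tnth_one_at eqxx big1 ?mulr1// => j /negbTE jk.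
by rewrite tnth_one_at jk.
Qed.

Section one_law.
Variables (theta : R) (Q : probability (vec R m) R).
Hypothesis Qcdf : forall x, cube x ->
  mcdf Q x = ((\prod_(j < m) (tnth x j : R)) + theta * Omega x)%:E.

Lemma law_one_at k t : 0 <= t <= 1 -> Q (box (one_at k t)) = t%:E.
Proof.
move=> t01; have c1 := cube_one_at k t01.
rewrite -[LHS]/(mcdf Q _) Qcdf// prod_one_at (Omega1 (k := k)) ?mulr0 ?addr0// => j /negbTE jk.
by rewrite tnth_one_at jk.
Qed.

(** The complement of the half-open cube is covered by the complement of
    {x <= 1} and by the sets {x_k <= 0, x <= 1}, which the distribution function
    shows to be null. *)
Lemma law_hcube : (0 < m)%N -> Q (~` @hcube R m) = 0%E.
Proof.
move=> m0; pose k0 := Ordinal m0.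
have Q1 : Q.-negligible (~` box (one_at k0 1)).
  apply/negligibleP; first by apply: measurableC; exact: measurable_box.
  apply: (etrans (probability_setC Q (measurable_box _))).
  by rewrite law_one_at ?subee// ler01 lexx.
have Q0 k : Q.-negligible (box (one_at k 0)).
  apply/negligibleP; first exact: measurable_box.
  by apply: law_one_at; rewrite lexx ler01.
apply/negligibleP; first by apply: measurableC; exact: measurable_hcube.
(* The null sets are indexed by nat, with empty sets beyond m. *)
pose F i := if insub i is Some k then box (one_at k 0) else set0.
have QF : Q.-negligible (\bigcup_i F i).
  apply: negligible_bigcup => i; rewrite /F; case: insubP => // _.
  exact: negligible_set0.
apply: negligibleS (negligibleU Q1 QF) => y yN.
have [y1|y1] := pselect (forall j, (tnth y j : R) <= 1); last first.
  left => H; apply: y1 => j; have := H j; rewrite tnth_one_at.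
  by case: eqP.
right; apply: contrapT => H; apply: yN => j /=.
rewrite in_itv/= y1 andbT ltNge; apply/negP => yj0; apply: H.
exists j => //; rewrite /F valK => l; rewrite tnth_one_at.
by case: eqP => [->|].
Qed.

Hypothesis m0 : (0 < m)%N.

Lemma law_hcube_le (A B : set (vec R m)) : measurable A -> measurable B ->
  A `&` @hcube R m = B `&` @hcube R m -> Q A = Q B.
Proof.
move=> mA mB AB; rewrite (measure_hcube (law_hcube m0) mA) AB.
by rewrite -(measure_hcube (law_hcube m0) mB).
Qed.

Lemma law_box x : Q (box x) =
  (\prod_j clip (tnth x j : R) + theta * Omega (clipv x))%:E.
Proof.
rewrite (law_hcube_le (B := box (clipv x))); try exact: measurable_box.
  rewrite -[LHS]/(mcdf Q _) Qcdf; last exact: cube_clipv.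
  by congr (_ + _)%:E; apply: eq_bigr => j _; rewrite tnth_clipv.
apply/seteqP; split => y /= [H hy]; split => // j; have := hy j; rewrite /= in_itv/= => yj.
  by rewrite tnth_clipv le_clip.
by have := H j; rewrite tnth_clipv le_clip.
Qed.

Lemma law_margin_le k t : Ex Q (fun y => ((tnth y k : R) <= t)%R%:R) = clip t.
Proof.
have mk : measurable [set y : vec R m | (tnth y k : R) <= t].
  rewrite -[X in measurable X]setTI; apply: measurable_fun_ler => //.
  exact: measurable_coord.
rewrite (_ : (fun y => _) = \1_[set y | (tnth y k : R) <= t]); last first.
  by apply/funext => s; rewrite indicE mem_setE.
rewrite Ex_indic// (law_hcube_le (B := box (one_at k (clip t))))//.
- by rewrite law_one_at// clip01.
- exact: measurable_box.
apply/seteqP; split => y /= [H hy]; split => //.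
  move=> j; have := hy j; rewrite /= in_itv/= tnth_one_at => yj.
  by case: eqP => [jk|_]; [rewrite le_clip ?jk// -jk|case/andP: yj].
have := H k; have := hy k; rewrite /= in_itv/= tnth_one_at eqxx => yk.
by rewrite le_clip.
Qed.

Lemma law_margin k x : Ex Q (fun y => ((tnth x k : R) < tnth y k)%R%:R) = surv x k.
Proof.
have bl : bm (fun y : vec R m => ((tnth y k : R) <= tnth x k)%R%:R : R).
  by apply: bm_bool; apply: measurable_fun_ler => //; exact: measurable_coord.
rewrite /surv usurvE -(law_margin_le k) -[X in X - _](Ex_cst Q) -ExB//; last exact: bm_cst.
by congr Ex; apply/funext => s; rewrite ltNge; case: (_ <= _); rewrite ?subr0 ?subrr.
Qed.

(** usurv u is the probability that an independent uniform variable exceeds u;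
    integrating over x_k first leaves the mean of that variable. *)
Lemma law_half k : Ex Q ((@surv R m)^~ k) = 2^-1.
Proof.
pose f (y : vec R m) (s : measurableTypeR R) : R := ((tnth y k : R) <= s)%R%:R.
have bf : bm (fun z : vec R m * measurableTypeR R => f z.1 z.2).
  apply: bm_bool; apply: measurable_fun_ler.
    by apply: (measurableT_comp (measurable_coord k)); exact: measurable_fst.
  exact: measurable_snd.
transitivity (Ex Q (fun y => Ex (@unif R) (f y))).
  by congr Ex; apply/funext => y; rewrite /f Ex_unif_ge.
rewrite (Ex_swap _ _ bf).
transitivity (Ex (@unif R) (fun s => 1 - usurv s ^+ 1)).
  by congr Ex; apply/funext => s; rewrite /f law_margin_le usurvE expr1 subKr.
rewrite ExB; [|exact: bm_cst|by apply: bm_exp; apply: bm_usurv].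
by rewrite Ex_cst Ex_unif_usurv; lra.
Qed.

(** prod_j s_j (y) is the uniform measure of the points above y; exchanging the
    two integrals leaves the integral of the distribution function. The argument
    of Omega is clipped to the cube, which makes the integrand measurable on the
    whole space. *)
Lemma Ex_prod_surv : bm (fun x => Omega (clipv x)) ->
  Ex Q (fun y => \prod_j surv y j) =
  half_pow R m + theta * Ex (ucube R m) (fun x => Omega (clipv x)).
Proof.
move=> bO.
pose f (y x : vec R m) : R := \prod_j ((tnth y j : R) <= tnth x j)%R%:R.
have bf : bm (fun z : vec R m * vec R m => f z.1 z.2).
  apply: bm_prod => j; apply: bm_bool; apply: measurable_fun_ler.
    by apply: (measurableT_comp (measurable_coord j)); exact: measurable_fst.
  by apply: (measurableT_comp (measurable_coord j)); exact: measurable_snd.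
transitivity (Ex Q (fun y => Ex (ucube R m) (f y))).
  congr Ex; apply/funext => y; rewrite /f.
  rewrite (@Ex_prod_tnth _ _ _ (@unif R) m (fun j (s : measurableTypeR R) => ((tnth y j : R) <= s)%R%:R)).
    by apply: eq_bigr => j _; rewrite Ex_unif_ge.
  by move=> j; apply: bm_bool; apply: measurable_fun_ler.
rewrite (Ex_swap _ _ bf).
transitivity (Ex (ucube R m) (fun x => \prod_j clip (tnth x j : R) + theta * Omega (clipv x))).
  congr Ex; apply/funext => x; rewrite -[RHS]/(fine _%:E) -law_box -Ex_indic; last exact: measurable_box.
  congr Ex; apply/funext => y; rewrite /f indicE.
  have [H|H] := pselect (forall j, (tnth y j : R) <= tnth x j).
    by rewrite big1 ?mem_set// => j _; rewrite H.
  rewrite memNset//; move/existsNP : H => [j /negP /negbTE Hj].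
  by rewrite (bigD1 j)//= Hj mul0r.
have bc (j : 'I_m) : bm (fun s : measurableTypeR R => clip (s : R)).
  rewrite (_ : (fun s => _) = fun s : measurableTypeR R => 1 - usurv (s : R)).
    by apply: bmB; [exact: bm_cst|apply: bm_usurv].
  by apply/funext => s; rewrite usurvE subKr.
rewrite ExD; last 2 first.
- by apply: bm_prod => j; exact: (bm_tnth j (bc j)).
- exact: bmZ.
rewrite ExZ//; congr (_ + _).
rewrite (@Ex_prod_tnth _ _ _ (@unif R) m (fun j (s : measurableTypeR R) => clip (s : R)))//.
rewrite /half_pow -exprVn -[in RHS](card_ord m) -prodr_const; apply: eq_bigr => j _.
transitivity (Ex (@unif R) (fun s => 1 - usurv s ^+ 1)).
  by congr Ex; apply/funext => s; rewrite usurvE expr1 subKr.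
rewrite ExB; [|exact: bm_cst|by apply: bm_exp; apply: bm_usurv].
by rewrite Ex_cst Ex_unif_usurv; lra.
Qed.

Lemma bm_clip : bm (fun s : measurableTypeR R => clip (s : R)).
Proof.
rewrite (_ : (fun s => _) = fun s : measurableTypeR R => 1 - usurv (s : R)).
  by apply: bmB; [exact: bm_cst|apply: bm_usurv].
by apply/funext => s; rewrite usurvE subKr.
Qed.

(** Omega is recovered from the distribution function at a positive theta. *)
Lemma bm_Omega_clipv : theta != 0 -> bm (fun x => Omega (clipv x)).
Proof.
move=> th0.
pose f (x y : vec R m) : R := \prod_j ((tnth y j : R) <= tnth x j)%R%:R.
have bf : bm (fun z : vec R m * vec R m => f z.1 z.2).
  apply: bm_prod => j; apply: bm_bool; apply: measurable_fun_ler.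
    by apply: (measurableT_comp (measurable_coord j)); exact: measurable_snd.
  by apply: (measurableT_comp (measurable_coord j)); exact: measurable_fst.
rewrite (_ : (fun x => _) = fun x => theta^-1 * (Ex Q (f x) - \prod_j clip (tnth x j : R))).
  apply: bmZ; apply: bmB; first exact: (bm_Ex Q Q bf).
  by apply: bm_prod => j; exact: (bm_tnth j bm_clip).
apply/funext => x; rewrite /f.
rewrite (_ : Ex Q _ = fine (Q (box x))).
  by rewrite law_box/= addrAC subrr add0r mulKf.
rewrite -Ex_indic; last exact: measurable_box.
congr Ex; apply/funext => y; rewrite indicE.
have [H|H] := pselect (forall j, (tnth y j : R) <= tnth x j).
  by rewrite big1 ?mem_set// => j _; rewrite H.
rewrite memNset//; move/existsNP : H => [j /negP /negbTE Hj].
by rewrite (bigD1 j)//= Hj mul0r.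
Qed.

End one_law.

Lemma int_Omega_cube : bm (fun x => Omega (clipv x)) ->
  \int[lebesgue_vec R m]_(x in @cube R m) Omega x = Ex (ucube R m) (fun x => Omega (clipv x)).
Proof.
move=> bO; have mc := @measurable_cube R m.
rewrite /Ex /Rintegral; congr fine.
transitivity (\int[lebesgue_vec R m]_(x in @cube R m) (Omega (clipv x))%:E)%E.
  by apply: eq_integral => x /set_mem cx; rewrite clipv_id.
rewrite [LHS](eq_measure_integral (ucube R m)); last by move=> A mA Ac; exact: lebesgue_vec_cube.
rewrite [RHS](negligible_integral (N := ~` @cube R m)) ?setTD ?setCK//.
- exact: measurableC.
- exact: bm_integrable.
apply/eqP; rewrite eq_le measure_ge0 andbT -(ucube_hcube R m).
apply: le_measure; rewrite ?inE; try (by apply: measurableC => //; exact: measurable_hcube).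
by apply: subsetC => y H j; have := H j; rewrite /= in_itv/= => /andP[/ltW -> ->].
Qed.

Section mixture.
Variables (theta theta1 : R) (Q Q1 : probability (vec R m) R).
Hypothesis m0 : (0 < m)%N.
Hypotheses (theta_ge0 : 0 <= theta) (theta_le : theta <= theta1) (theta1_gt0 : 0 < theta1).
Hypothesis Qcdf : forall x, cube x ->
  mcdf Q x = ((\prod_(j < m) (tnth x j : R)) + theta * Omega x)%:E.
Hypothesis Q1cdf : forall x, cube x ->
  mcdf Q1 x = ((\prod_(j < m) (tnth x j : R)) + theta1 * Omega x)%:E.
Let lam := theta / theta1.

Let lam0 : 0 <= lam. Proof. by rewrite divr_ge0// ltW. Qed.
Let lam1 : 0 <= 1 - lam. Proof. by rewrite subr_ge0 ler_pdivrMr// mul1r. Qed.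

Let mix : {measure set (vec R m) -> \bar R} :=
  measure_add (mscale (NngNum lam1) (ucube R m)) (mscale (NngNum lam0) Q1).

Let mixE A : mix A = ((1 - lam)%:E * ucube R m A + lam%:E * Q1 A)%E.
Proof. exact: (measure_addE (mscale (NngNum lam1) (ucube R m)) (mscale (NngNum lam0) Q1) A). Qed.

(** A law is determined by its distribution function, which is affine in theta. *)
Lemma law_mixture (A : set (vec R m)) : measurable A -> Q A = mix A.
Proof.
move: A; apply: cdf_unique.
- by rewrite (le_lt_trans (probability_le1 _ _))// ltry.
- exact: (law_hcube Qcdf).
- by apply: (etrans (mixE _)); rewrite ucube_hcube (law_hcube Q1cdf)// !mule0 adde0.
move=> x cx; apply: (etrans (law_box Qcdf m0 x)); apply: esym.
apply: (etrans (mixE _)); rewrite (law_box Q1cdf m0) ucube_box -!EFinM -EFinD.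
by congr _%:E; rewrite /lam; field; rewrite gt_eqF.
Qed.

Let Ex_mixture_ge0 f : bm f -> (forall x, 0 <= f x) ->
  Ex Q f = (1 - lam) * Ex (ucube R m) f + lam * Ex Q1 f.
Proof.
move=> bf f0; apply: EFin_inj; rewrite EFinD !EFinM !ExE//.
have mf : measurable_fun setT (EFin \o f) by apply/measurable_EFinP; case: bf.
rewrite (eq_measure_integral mix); last by move=> A mA _; exact: law_mixture.
rewrite /mix ge0_integral_measure_add//; last by move=> x _; rewrite lee_fin.
by rewrite !ge0_integral_mscale//; move=> x _; rewrite lee_fin.
Qed.

(** The mixture identity is only integrated for nonnegative functions, so M is
    added to f first. *)
Lemma law_perturb f M : bm f -> (forall x, `|f x| <= M) ->
  `|Ex Q f - Ex (ucube R m) f| <= theta * (2 * M / theta1).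
Proof.
move=> bf fM.
have M0 : 0 <= M by apply: le_trans (fM point).
have bfM : bm (fun x => f x + M) by apply: bmD => //; exact: bm_cst.
have fM0 x : 0 <= f x + M by have := fM x; rewrite ler_norml => /andP[? _]; lra.
have := Ex_mixture_ge0 bfM fM0.
rewrite !ExD ?Ex_cst//; try exact: bm_cst.
move=> E; have -> : Ex Q f - Ex (ucube R m) f = lam * (Ex Q1 f - Ex (ucube R m) f) by lra.
rewrite normrM (ger0_norm lam0) (_ : theta * _ = lam * (2 * M)); last by rewrite /lam; field; rewrite gt_eqF.
rewrite ler_wpM2l// (le_trans (ler_normB _ _))//.
by rewrite mulr_natl mulr2n lerD// norm_Ex_bound.
Qed.

End mixture.
End model_law.

(** * Moments of the score under independence *)

Section uniform_moments.
Context (R : realType) (m : nat).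
Implicit Types (x y : vec R m).
Local Notation E0 := (Ex (ucube R m)).
Local Notation U := (@unif R).
Local Notation w := (half_pow R m).

Let bs : bm (fun s : measurableTypeR R => usurv (s : R)).
Proof. by apply: bm_usurv. Qed.

Lemma Ex_unif_usurv1 : Ex U (fun s => usurv s) = 2^-1.
Proof. by rewrite -(Ex_unif_usurv R 1); congr Ex; apply/funext => s; rewrite expr1. Qed.

Lemma prod_half_others (j : 'I_m) : \prod_(l < m | l != j) 2^-1 = 2 * w :> R.
Proof.
have : \prod_(l < m) 2^-1 = w :> R by rewrite prodr_const card_ord exprVn.
by rewrite (bigD1 j)//= => <-; rewrite mulrA divff ?mul1r.
Qed.

Lemma ucube_others (j : 'I_m) (q : measurableTypeR R -> R) : bm q ->
  E0 (fun x => q (tnth x j) * others j x) = 2 * w * Ex U q.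
Proof.
move=> bq.
pose p (l : 'I_m) := if l == j then q else fun s : measurableTypeR R => usurv (s : R).
have bp l : bm (p l) by rewrite /p; case: (l == j).
transitivity (E0 (fun x => \prod_l p l (tnth x l))).
  congr Ex; apply/funext => x; rewrite [RHS](bigD1 j)//= {1}/p eqxx; congr (_ * _).
  by apply: eq_bigr => l /negbTE lj; rewrite /p lj.
rewrite Ex_prod_tnth// (bigD1 j)//= {1}/p eqxx mulrC; congr (_ * _).
rewrite -(prod_half_others j); apply: eq_bigr => l /negbTE lj.
by rewrite /p lj Ex_unif_usurv1.
Qed.

Lemma ucube_kern y : E0 ((@kern R m)^~ y) = 0.
Proof.
have bq j : bm (fun s : measurableTypeR R => ((s : R) < tnth y j)%R%:R - usurv (s : R)).
  by apply: bmB => //; apply: bm_bool; apply: measurable_fun_ltr.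
have be j : bm (fun x => exceed j x y * others j x).
  by apply: bmM; [exact: (bm_pair2 (@bm_exceed R m j) y)|exact: bm_others].
rewrite /kern Ex_sum; last by move=> j; apply: bmB; [exact: be|exact: bm_cst].
apply: big1 => j _; rewrite ExB ?Ex_cst; [|exact: be|exact: bm_cst].
rewrite (ucube_others _ (bq j)) ExB//; last by apply: bm_bool; apply: measurable_fun_ltr.
rewrite Ex_unif_lt Ex_unif_usurv1 /surv usurvE; by field.
Qed.

Lemma ucube_score_sq :
  E0 (fun x => score x ^+ 2) = w ^+ 2 * ((4 / 3) ^+ m - m%:R / 3 - 1).
Proof.
pose c (s : measurableTypeR R) := usurv (s : R) - 2^-1.
have bc : bm c by apply: bmB => //; exact: bm_cst.
pose A x := \prod_j surv x j.
pose S x := \sum_j c (tnth x j).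
have bA : bm A by apply: bm_prod => j; exact: bm_surv.
have bS : bm S by apply: bm_sum => j; exact: (bm_tnth j bc).
have bA2 := bm_exp 2 bA; have bS2 := bm_exp 2 bS; have bAS := bmM bA bS.
have EA2 : E0 (fun x => A x ^+ 2) = 3^-1 ^+ m.
  transitivity (E0 (fun x => \prod_j usurv (tnth x j : R) ^+ 2)).
    by congr Ex; apply/funext => x; rewrite /A -prodrXl.
  rewrite (@Ex_prod_tnth _ _ _ U m (fun j (s : measurableTypeR R) => usurv (s : R) ^+ 2)).
    by under eq_bigr do rewrite Ex_unif_usurv; rewrite prodr_const card_ord.
  by move=> j; exact: bm_exp.
have EA : E0 A = w.
  rewrite (@Ex_prod_tnth _ _ _ U m (fun j (s : measurableTypeR R) => usurv (s : R)))//.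
  by under eq_bigr do rewrite Ex_unif_usurv1; rewrite prodr_const card_ord exprVn.
have c0 : Ex U c = 0 by rewrite ExB ?Ex_cst ?Ex_unif_usurv1 ?subrr//; exact: bm_cst.
have c2 : Ex U (fun s => c s ^+ 2) = 12^-1.
  transitivity (Ex U (fun s => usurv s ^+ 2 - usurv s + 4^-1)).
    by congr Ex; apply/funext => s; rewrite /c; field.
  have b2 := bm_exp 2 bs.
  rewrite ExD ?ExB ?Ex_cst ?Ex_unif_usurv ?Ex_unif_usurv1//; try exact: bm_cst; try exact: bmB.
  by field.
have ES : E0 S = 0.
  rewrite Ex_sum; last by move=> j; exact: (bm_tnth j bc).
  by apply: big1 => j _; rewrite (Ex_tnth _ j bc).
have ES2 : E0 (fun x => S x ^+ 2) = m%:R * 12^-1 by rewrite -c2; exact: iidsum_var.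
have EAS : E0 (fun x => A x * S x) = m%:R * (w / 6).
  have bq : bm (fun s : measurableTypeR R => usurv (s : R) * c s) by exact: bmM.
  have bj j : bm (fun x => usurv (tnth x j : R) * c (tnth x j) * others j x).
    by apply: bmM; [exact: (bm_tnth j bq)|exact: bm_others].
  transitivity (E0 (fun x => \sum_j usurv (tnth x j : R) * c (tnth x j) * others j x)).
    congr Ex; apply/funext => x; rewrite /S mulr_sumr; apply: eq_bigr => j _.
    by rewrite /A (bigD1 j)//= mulrAC.
  rewrite Ex_sum//.
  transitivity (\sum_(j < m) w / 6); last by rewrite sumr_const card_ord mulr_natl.
  apply: eq_bigr => j _; rewrite (ucube_others _ bq).
  rewrite (_ : Ex U _ = 12^-1); first by field.
  transitivity (Ex U (fun s => usurv s ^+ 2 - 2^-1 * usurv s)).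
    by congr Ex; apply/funext => s; rewrite /c; ring.
  have b2 := bm_exp 2 bs.
  by rewrite ExB ?ExZ ?Ex_unif_usurv ?Ex_unif_usurv1//; [field|exact: bmZ].
transitivity (E0 (fun x => (A x ^+ 2 + 4 * w ^+ 2 * S x ^+ 2)
    - (2 * w * A x + 4 * w * (A x * S x)) + 4 * w ^+ 2 * S x + w ^+ 2)).
  by congr Ex; apply/funext => x; rewrite /score -/(A x) -/(S x); ring.
have b1 : bm (fun x => A x ^+ 2 + 4 * w ^+ 2 * S x ^+ 2) by apply: bmD => //; exact: bmZ.
have b2 : bm (fun x => 2 * w * A x + 4 * w * (A x * S x)) by apply: bmD; exact: bmZ.
have b3 : bm (fun x => 4 * w ^+ 2 * S x) by exact: bmZ.
have b12 := bmB b1 b2; have b123 := bmD b12 b3.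
rewrite ExD//; last exact: bm_cst.
rewrite ExD// ExB// ExD//; last exact: bmZ.
rewrite [X in _ - X]ExD; [|exact: bmZ|exact: bmZ].
rewrite Ex_cst !ExZ// EA2 EA ES ES2 EAS.
have w34 : w ^+ 2 * (4 / 3) ^+ m = 3^-1 ^+ m.
  rewrite /half_pow -exprVn -exprM mulnC exprM -exprMn; congr (_ ^+ _); by field.
rewrite [RHS](_ : _ = w ^+ 2 * (4 / 3) ^+ m - w ^+ 2 * (m%:R / 3) - w ^+ 2); last by ring.
by rewrite w34; field.
Qed.

End uniform_moments.

(** * From Lipschitz test functions to probabilities *)

Section ramp.
Context (R : realType).
Local Notation p := (@normal_pdf R 0 1).
Notation mu := (@lebesgue_measure R).

(** The function equal to 1 below z, to 0 above z + e, and affine in between. *)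
Definition ramp (z e x : R) : R := clip ((z + e - x) / e).

Lemma clip_lip (s t : R) : `|clip s - clip t| <= `|s - t|.
Proof.
suff H a : s - t <= a -> t - s <= a -> `|clip s - clip t| <= a.
  by apply: H; [exact: ler_norm|rewrite distrC; exact: ler_norm].
move=> H1 H2; rewrite /clip !minEle !maxEle.
by case: (leP 1 s) => Hs; case: (leP 1 t) => Ht; do ?[case: ifPn; rewrite -?ltNge => ?]; rewrite ler_norml; apply/andP; split; lra.
Qed.

Variables (e : R).
Hypothesis e0 : 0 < e.

Lemma ramp01 z x : 0 <= ramp z e x <= 1. Proof. exact: clip01. Qed.

Lemma ramp_lip z x y : `|ramp z e x - ramp z e y| <= e^-1 * `|x - y|.
Proof.
have eV : 0 <= e^-1 by rewrite invr_ge0 ltW.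
rewrite (le_trans (clip_lip _ _))// -mulrBl normrM mulrC (ger0_norm eV) ler_wpM2l//.
by rewrite distrC (_ : _ - (_ - _) = x - y)//; ring.
Qed.

Lemma ramp_ge z x : (x <= z)%R%:R <= ramp z e x.
Proof.
have [xz|_] := leP x z; last by case/andP: (ramp01 z x).
have H : 1 <= (z + e - x) / e by rewrite ler_pdivlMr// mul1r; lra.
by rewrite /ramp /clip min_l// max_r.
Qed.

Lemma ramp_le z x : ramp z e x <= (x <= z + e)%R%:R.
Proof.
have [_|xz] := leP x (z + e); first by case/andP: (ramp01 z x).
have H : (z + e - x) / e <= 0 by rewrite ler_pdivrMr// mul0r; lra.
by rewrite /ramp /clip ge_max lexx ge_min H orbT.
Qed.

Lemma ramp_shift z d x : ramp z e (x + d) = ramp (z - d) e x.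
Proof. by rewrite /ramp; congr (clip (_ / _)); ring. Qed.

Lemma ramp_continuous z : continuous (ramp z e).
Proof.
apply: (@lipschitz_continuous _ _ e^-1); first by rewrite invr_ge0 ltW.
exact: ramp_lip.
Qed.

Lemma PhiE (z : R) : Phi z = \int[mu]_(x in `]-oo, z]) p x.
Proof. by []. Qed.

Lemma Phi_ind (z : R) : Phi z = \int[mu]_x ((x <= z)%R%:R * p x).
Proof.
rewrite PhiE Rintegral_mkcond; apply: eq_Rintegral => x _.
rewrite patchE mem_setE in_itv/=; case: (x <= z); by rewrite ?mul1r ?mul0r.
Qed.

Lemma indic_pdf_integrable (z : R) : mu.-integrable setT (EFin \o (fun x => (x <= z)%R%:R * p x)).
Proof.
apply: (@le_integrable _ _ _ mu setT measurableT _ (EFin \o p)) => //; last exact: pdf_integrable.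
  apply/measurable_EFinP; apply: measurable_funM; last exact: measurable_normal_pdf.
  by case: (@bm_le R z).
move=> x _ /=; rewrite lee_fin normrM ler_piMl//.
by case: (x <= z); rewrite ?normr1 ?normr0.
Qed.

Lemma ramp_pdf_integrable z : mu.-integrable setT (EFin \o (fun x => ramp z e x * p x)).
Proof.
apply: (@le_integrable _ _ _ mu setT measurableT _ (EFin \o p)) => //; last exact: pdf_integrable.
  apply/measurable_EFinP; apply: measurable_funM; last exact: measurable_normal_pdf.
  by apply: continuous_measurable_fun; exact: ramp_continuous.
move=> x _ /=; rewrite lee_fin normrM ler_piMl//.
by have /andP[? ?] := ramp01 z x; rewrite ger0_norm.
Qed.

Lemma Phi_le_ramp z : Phi z <= gauss_mean (ramp z e).
Proof.
rewrite Phi_ind; apply: le_Rintegral => //; [exact: indic_pdf_integrable|exact: ramp_pdf_integrable|].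
by move=> x _; rewrite ler_wpM2r ?normal_pdf_ge0// ramp_ge.
Qed.

Lemma ramp_le_Phi z : gauss_mean (ramp z e) <= Phi (z + e).
Proof.
rewrite Phi_ind; apply: le_Rintegral => //; [exact: ramp_pdf_integrable|exact: indic_pdf_integrable|].
by move=> x _; rewrite ler_wpM2r ?normal_pdf_ge0// ramp_le.
Qed.

Lemma Phi_lip z : Phi (z + e) <= Phi z + e * normal_peak 1.
Proof.
have ip A : measurable A -> mu.-integrable A (EFin \o p) by exact: pdf_integrable.
have E : Phi (z + e) = Phi z + \int[mu]_(x in `]z, (z + e)]) p x.
  rewrite !PhiE -Rintegral_setU//.
  - by congr Rintegral; rewrite -itv_bndbnd_setU//= bnd_simp; rewrite lerDl ltW.
  - by apply: ip; exact: measurableU.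
  - apply/disj_set2P/seteqP; split => // t [] /=.
    by rewrite !in_itv/= => /le_lt_trans tz /andP[/tz]; rewrite ltxx.
rewrite E lerD2l.
apply: (@le_trans _ _ (\int[mu]_(x in `]z, (z + e)]) normal_peak 1)).
  apply: le_Rintegral => //; first exact: ip.
    apply: measurable_bounded_integrable => //.
      by rewrite [X in (X < _)%E]lebesgue_measure_itv/=; case: ifP => _; rewrite ltry.
    by exists (normal_peak 1); split; [exact: num_real|move=> M H x _ /=; rewrite ger0_norm ?normal_peak_ge0// ltW].
  by move=> x _; exact: normal_pdf_ub.
rewrite Rintegral_cst//= [X in fine X]lebesgue_measure_itv/= lte_fin ltrDl e0.
by rewrite -EFinD /= [z + e]addrC addrK mulrC.
Qed.

End ramp.

(** The indicator of {x <= z} lies between the ramps that end and start at z.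
    Replacing V by W + delta costs the Lipschitz constant e^-1 times the distance
    in mean, and the ramps differ from the indicator under the normal law by at
    most e times the maximal density. *)
Lemma prob_le_Phi d (T : measurableType d) (R : realType) (Q : probability T R)
    (V W : T -> R) (delta z e eta eps : R) : 0 < e -> bm V -> bm W ->
  (forall z', `|Ex Q (fun x => ramp z' e (W x)) - gauss_mean (ramp z' e)| <= eta) ->
  Ex Q (fun x => `|V x - (W x + delta)|) <= eps ->
  `|Ex Q (fun x => (V x <= z)%R%:R) - Phi (z - delta)|
    <= eta + e^-1 * eps + e * normal_peak 1.
Proof.
move=> e0 bV bW Heta Heps.
have eV : 0 <= e^-1 by rewrite invr_ge0 ltW.
have br z' : bm (fun x => ramp z' e (V x)) by exact: (bm_continuous (@ramp_continuous _ _ e0 z') bV).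
have brW z' : bm (fun x => ramp z' e (W x)) by exact: (bm_continuous (@ramp_continuous _ _ e0 z') bW).
have bW' : bm (fun x => W x + delta) by apply: bmD => //; exact: bm_cst.
have brW' z' : bm (fun x => ramp z' e (W x + delta)) by exact: (bm_continuous (@ramp_continuous _ _ e0 z') bW').
have bD : bm (fun x => `|V x - (W x + delta)|) by apply: bm_norm; exact: bmB.
have bi : bm (fun x => (V x <= z)%R%:R : R).
  by apply: bm_bool; apply: measurable_fun_ler => //; case: bV.
have close z' : `|Ex Q (fun x => ramp z' e (V x)) - gauss_mean (ramp (z' - delta) e)| <= eta + e^-1 * eps.
  have H1 : `|Ex Q (fun x => ramp z' e (V x)) - Ex Q (fun x => ramp z' e (W x + delta))| <= e^-1 * eps.
    apply: le_trans (ler_wpM2l eV Heps); rewrite -ExZ//.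
    by apply: norm_ExB_le => //; [exact: bmZ|move=> x; exact: ramp_lip].
  have H2 := Heta (z' - delta).
  have E : (fun x => ramp z' e (W x + delta)) = fun x => ramp (z' - delta) e (W x).
    by apply/funext => x; rewrite ramp_shift.
  rewrite E in H1; rewrite [leRHS]addrC -(subrKA (Ex Q (fun x => ramp (z' - delta) e (W x)))).
  by rewrite (le_trans (ler_normD _ _))// lerD.
have U1 : Ex Q (fun x => (V x <= z)%R%:R) <= Ex Q (fun x => ramp z e (V x)).
  by apply: le_Ex => // x; exact: ramp_ge.
have L1 : Ex Q (fun x => ramp (z - e) e (V x)) <= Ex Q (fun x => (V x <= z)%R%:R).
  by apply: le_Ex => // x; rewrite (le_trans (ramp_le e0 _ _))// subrK.
have U2 := ramp_le_Phi e0 (z - delta).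
have L2 := Phi_le_ramp e0 (z - e - delta).
have U3 := Phi_lip e0 (z - delta).
have L3 := Phi_lip e0 (z - e - delta).
have c1 := close z; have c2 := close (z - e).
rewrite (_ : z - e - delta + e = z - delta) in L3; last by ring.
move: U1 L1 U2 L2 U3 L3 c1 c2; rewrite !ler_norml => ? ? ? ? ? ? /andP[? ?] /andP[? ?].
by apply/andP; split; lra.
Qed.

(** * The normalizing constants *)

Section power_sums.
Context (R : realType).

(** The mean value theorem for powers, by induction. *)
Lemma exprB_bounds (a b : R) m : 0 <= a <= b ->
  m.+1%:R * a ^+ m * (b - a) <= b ^+ m.+1 - a ^+ m.+1 <= m.+1%:R * b ^+ m * (b - a).
Proof.
move=> /andP[a0 ab]; have b0 := le_trans a0 ab.
have ba : 0 <= b - a by rewrite subr_ge0.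
have am k : 0 <= a ^+ k by exact: exprn_ge0.
have abk k : a ^+ k <= b ^+ k by rewrite lerXn2r.
elim: m => [|m /andP[H1 H2]]; first by rewrite !expr0 !mulr1 !mul1r !expr1 lexx.
have E : b ^+ m.+2 - a ^+ m.+2 = b * (b ^+ m.+1 - a ^+ m.+1) + a ^+ m.+1 * (b - a).
  by rewrite !exprS; ring.
have E' : b ^+ m.+2 - a ^+ m.+2 = a * (b ^+ m.+1 - a ^+ m.+1) + b ^+ m.+1 * (b - a).
  by rewrite !exprS; ring.
have K1 := ler_wpM2l a0 H1; have K2 := ler_wpM2l b0 H2.
have L := ler_wpM2r ba (abk m.+1).
apply/andP; split.
  rewrite E' (le_trans _ (lerD K1 L))// -natr1 [a ^+ m.+1]exprS; lra.
rewrite E (le_trans (lerD K2 L))// -natr1 [b ^+ m.+1]exprS; lra.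
Qed.

Lemma sum_pow_bounds m n :
  (n%:R : R) ^+ m.+1 <= m.+1%:R * \sum_(1 <= i < n.+1) (i%:R : R) ^+ m <=
  n%:R ^+ m.+1 + m.+1%:R * n%:R ^+ m.
Proof.
elim: n => [|n /andP[H1 H2]].
  by rewrite big_geq// mulr0 expr0n lexx/= add0r mulr_ge0// exprn_ge0.
rewrite big_nat_recr//= mulrDr.
have n01 : 0 <= (n%:R : R) <= n.+1%:R by rewrite ler0n ler_nat leqnSn.
have := exprB_bounds m n01.
rewrite -[X in X - _]natr1 addrAC subrr add0r !mulr1 => /andP[K1 K2].
by apply/andP; split; lra.
Qed.

Lemma expr_lip (a b : R) m : 0 <= a <= 1 -> 0 <= b <= 1 ->
  `|a ^+ m - b ^+ m| <= m%:R * `|a - b|.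
Proof.
wlog ab : a b / a <= b => [H a01 b01|].
  have [ab|/ltW ba] := leP a b; first exact: H.
  by rewrite distrC [`|a - b|]distrC H.
move=> /andP[a0 a1] /andP[b0 b1]; case: m => [|m].
  by rewrite !expr0 subrr normr0 mul0r.
have /(exprB_bounds m)/andP[_ H] : 0 <= a <= b by rewrite a0.
rewrite distrC ger0_norm; last by rewrite subr_ge0 lerXn2r.
rewrite distrC ger0_norm ?subr_ge0// (le_trans H)// ler_wpM2r ?subr_ge0//.
by rewrite ler_piMr// exprn_ile1.
Qed.

End power_sums.

Section constants.
Context (R : realType) (m : nat).
Hypothesis hm : (2 <= m)%N.
Local Notation w := (half_pow R m).

(** The variance of the score at theta = 0, multiplied by 4^m. *)
Definition var_factor : R := (4 / 3) ^+ m - m%:R / 3 - 1.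
(** The limit of C_(m,n) / n^m. *)
Definition norm_limit : R := m.+1%:R^-1 - w.
Definition score_sd : R := w * Num.sqrt var_factor.

Lemma var_factor_gt0 : 0 < var_factor.
Proof.
rewrite /var_factor; elim: m hm => // k ih; rewrite leq_eqVlt => /predU1P[<-|k2].
  by rewrite expr2; lra.
have := ih k2; rewrite exprS -[k.+1%:R]natr1; have : 0 <= k%:R :> R by [].
move: (_ ^+ k) (k%:R) => a b ? ?; lra.
Qed.

Lemma norm_limit_gt0 : 0 < norm_limit.
Proof.
rewrite /norm_limit /half_pow subr_gt0 ltf_pV2 ?posrE ?exprn_gt0//.
rewrite -natrX ltr_nat.
by elim: m hm => // k ih; rewrite leq_eqVlt => /predU1P[<-//|/ih k2]; rewrite expnS; lia.
Qed.

Lemma half_pow_gt0 : 0 < w. Proof. by rewrite /half_pow invr_gt0 exprn_gt0. Qed.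

Lemma score_sd_gt0 : 0 < score_sd.
Proof. by rewrite mulr_gt0 ?half_pow_gt0// sqrtr_gt0 var_factor_gt0. Qed.

Lemma score_sd_sq : score_sd ^+ 2 = w ^+ 2 * var_factor.
Proof. by rewrite exprMn sqr_sqrtr// ltW// var_factor_gt0. Qed.

Lemma sqrt_sigma2 : Num.sqrt (sigma2 R m) = score_sd / norm_limit.
Proof.
have c0 := norm_limit_gt0; have w0 := half_pow_gt0.
have -> : sigma2 R m = (w / norm_limit) ^+ 2 * var_factor.
  have : 0 < (2 ^+ m)^-1 :> R := w0; rewrite invr_gt0 => t0.
  have : m.+1%:R^-1 - (2 ^+ m)^-1 != 0 :> R by rewrite gt_eqF.
  rewrite /sigma2 /norm_limit /var_factor /half_pow -[m.+1%:R]natr1.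
  have : m%:R + 1 != 0 :> R by rewrite natr1.
  move: (m%:R) (2 ^+ m) t0 => k t t0 k1 H.
  have tk : t - (k + 1) != 0.
    apply: contraNneq H => E; have -> : t = k + 1 by apply/eqP; rewrite -subr_eq0 E.
    by rewrite subrr.
  congr (_ * _).
  by field; rewrite gt_eqF// k1 mulN1r tk.
rewrite sqrtrM ?sqr_ge0// sqrtr_sqr ger0_norm; last by rewrite divr_ge0 ?ltW.
by rewrite /score_sd mulrAC.
Qed.

End constants.

(** * Moments of the score under the alternatives *)

Section score_moments.
Context (R : realType) (m : nat) (Omega : vec R m -> R).
Implicit Types (x y : vec R m).
Hypothesis hm : (2 <= m)%N.
Hypothesis Omega1 : forall x k, cube x -> (forall j, j != k -> tnth x j = 1) -> Omega x = 0.
Variables (theta theta1 : R) (Q Q1 : probability (vec R m) R).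
Hypotheses (theta_ge0 : 0 <= theta) (theta_le : theta <= theta1) (theta1_gt0 : 0 < theta1).
Hypothesis Qcdf : forall x, cube x ->
  mcdf Q x = ((\prod_(j < m) (tnth x j : R)) + theta * Omega x)%:E.
Hypothesis Q1cdf : forall x, cube x ->
  mcdf Q1 x = ((\prod_(j < m) (tnth x j : R)) + theta1 * Omega x)%:E.

Local Notation I0 := (\int[lebesgue_vec R m]_(x in @cube R m) Omega x).
Local Notation s := (score_sd R m).

Let m0 : (0 < m)%N. Proof. exact: ltnW. Qed.
Let bO : bm (fun x => Omega (clipv x)).
Proof.
by apply: (bm_Omega_clipv Omega1 Q1cdf m0); rewrite gt_eqF.
Qed.

Lemma score_le x : `|score x| <= m%:R + 2.
Proof.
have /andP[w0 w1] := half_pow01 R m.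
have H1 : `|\prod_j surv x j| <= 1.
  rewrite ger0_norm; last by apply: prodr_ge0 => j _; case/andP: (surv01 x j).
  by apply: prodr_ile1 => j _; exact: surv01.
have H2 : `|2 * half_pow R m * \sum_j (surv x j - 2^-1)| <= m%:R.
  rewrite normrM ger0_norm ?mulr_ge0//.
  apply: (@le_trans _ _ (2 * (m%:R * 2^-1))); last by rewrite mulrCA divff ?mulr1.
  rewrite -mulrA ler_wpM2l// -[leRHS]mul1r ler_pM//.
  rewrite (le_trans (ler_norm_sum _ _ _))//.
  apply: (@le_trans _ _ (\sum_(j < m) 2^-1)); last by rewrite sumr_const card_ord mulr_natl.
  apply: ler_sum => j _; have /andP[? ?] := surv01 x j.
  by rewrite ler_norml; apply/andP; split; lra.
rewrite /score (le_trans (ler_normB _ _))// addrC lerD//.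
rewrite (le_trans (ler_normB _ _))// (_ : 2 = 1 + 1)// lerD//.
by rewrite ger0_norm.
Qed.

Lemma Ex_score : Ex Q (@score R m) = theta * I0.
Proof.
have bA : bm (fun x => \prod_j surv x j) by apply: bm_prod => j; exact: bm_surv.
have bc j : bm (fun x => surv x j - 2^-1) by apply: bmB; [exact: bm_surv|exact: bm_cst].
have bS : bm (fun x => \sum_j (surv x j - 2^-1)) by apply: bm_sum.
rewrite /score ExB; [|by apply: bmB => //; exact: bm_cst|exact: bmZ].
rewrite ExB//; last exact: bm_cst.
rewrite Ex_cst ExZ// Ex_sum// big1; last first.
  move=> j _; rewrite ExB; [|exact: bm_surv|exact: bm_cst].
  by rewrite Ex_cst (law_half Omega1 Qcdf m0) subrr.
rewrite (Ex_prod_surv Omega1 Qcdf m0 bO) (int_Omega_cube bO).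
by ring.
Qed.

Lemma Ex_score_sq :
  `|Ex Q (fun x => score x ^+ 2) - s ^+ 2| <= theta * (2 * (m%:R + 2) ^+ 2 / theta1).
Proof.
rewrite (score_sd_sq R hm) /var_factor -[w in w ^+ 2 * _]/(half_pow R m).
rewrite (_ : _ * _ = Ex (ucube R m) (fun x => score x ^+ 2)); last first.
  by rewrite ucube_score_sq.
apply: (law_perturb Omega1 m0 theta_ge0 theta_le theta1_gt0 Qcdf Q1cdf).
  exact: (bm_exp 2 (@bm_score R m)).
by move=> x; rewrite normrX lerXn2r ?nnegrE ?score_le// addr_ge0.
Qed.

(** The kernel is centred under the uniform law, so only the perturbation is
    left. *)
Lemma Ex_kern_le y : `|Ex Q ((@kern R m)^~ y)| <= theta * (2 * (2 * m%:R) / theta1).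
Proof.
rewrite -[X in `|X|]subr0 -(ucube_kern y).
apply: (law_perturb Omega1 m0 theta_ge0 theta_le theta1_gt0 Qcdf Q1cdf).
  exact: (bm_pair2 (@bm_kern R m) y).
by move=> x; exact: kern_le.
Qed.

Variable n : nat.
Hypothesis n0 : (0 < n)%N.
Local Notation EN := (Ex (iid Q n)).
Local Notation u := ((Num.sqrt n%:R)^-1 : R).

Let n0' : 0 < n%:R :> R. Proof. by rewrite ltr0n. Qed.
Let u0 : 0 < u. Proof. by rewrite invr_gt0 sqrtr_gt0. Qed.
Let nu2 : n%:R * u ^+ 2 = 1 :> R.
Proof. by rewrite exprVn sqr_sqrtr ?(ltW n0')// divff// gt_eqF. Qed.
Let s0 : 0 < s. Proof. exact: score_sd_gt0. Qed.

Definition zscore x : R := (score x - theta * I0) * (u / s).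
Definition var_err : R := (theta * (2 * (m%:R + 2) ^+ 2 / theta1) + theta ^+ 2 * I0 ^+ 2) / s ^+ 2.
Definition clt_err (e : R) : R := 2 * var_err +
  u * (2 * (2 * (m%:R + 2)) ^+ 3 / s ^+ 3 * (stein_cst e^-1 + 2 * (3 + var_err))).

Lemma bm_zscore : bm zscore.
Proof.
rewrite (_ : zscore = fun x => (u / s) * (score x - theta * I0)).
  by apply: bmZ; apply: bmB; [exact: bm_score|exact: bm_cst].
by apply/funext => x; rewrite mulrC.
Qed.

Lemma Ex_zscore : Ex Q zscore = 0.
Proof.
rewrite (_ : zscore = fun x => (u / s) * (score x - theta * I0)).
  rewrite ExZ; last by apply: bmB; [exact: bm_score|exact: bm_cst].
  rewrite ExB; [|exact: bm_score|exact: bm_cst].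
  by rewrite Ex_score Ex_cst subrr mulr0.
by apply/funext => x; rewrite mulrC.
Qed.

Lemma zscore_var : `|n%:R * Ex Q (fun x => zscore x ^+ 2) - 1| <= var_err.
Proof.
have b2 := bm_exp 2 (@bm_score R m); have b1 := @bm_score R m.
have s2 : s ^+ 2 != 0 by rewrite gt_eqF// exprn_gt0.
have E : Ex Q (fun x => zscore x ^+ 2) =
    (u ^+ 2 / s ^+ 2) * (Ex Q (fun x => score x ^+ 2) - theta ^+ 2 * I0 ^+ 2).
  rewrite (_ : (fun x => _) = fun x => (u ^+ 2 / s ^+ 2) *
     (score x ^+ 2 - (2 * (theta * I0)) * score x + (theta * I0) ^+ 2)); last first.
    apply/funext => x; rewrite /zscore; field.
    by rewrite (gt_eqF s0) gt_eqF// sqrtr_gt0.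
  rewrite ExZ; last by apply: bmD; [apply: bmB => //; exact: bmZ|exact: bm_cst].
  rewrite ExD; [|by apply: bmB => //; exact: bmZ|exact: bm_cst].
  rewrite ExB//; last exact: bmZ.
  rewrite ExZ// Ex_cst Ex_score; congr (_ * _); ring.
rewrite E 2!mulrA nu2 mul1r mulrC -[1](divff s2) -mulrBl normrM normfV.
rewrite [X in _ / X]ger0_norm ?exprn_ge0 ?(ltW s0)// ler_wpM2r ?invr_ge0 ?exprn_ge0 ?(ltW s0)//.
rewrite addrAC (le_trans (ler_normB _ _))// lerD ?Ex_score_sq//.
by rewrite -exprMn ger0_norm// sqr_ge0.
Qed.

Lemma var_err_ge0 : 0 <= var_err.
Proof. by apply: le_trans zscore_var. Qed.

Lemma zscore_le x : `|zscore x| <= 2 * (m%:R + 2) * (u / s).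
Proof.
have us : 0 <= u / s by rewrite divr_ge0 ?ltW.
rewrite /zscore normrM (ger0_norm us) ler_wpM2r//.
rewrite (le_trans (ler_normB _ _))// mulr_natl mulr2n lerD ?score_le//.
rewrite -Ex_score; apply: norm_Ex_bound; [exact: bm_score|exact: score_le].
Qed.

(** [clt_bound] applied to the standardized scores; u^3 n = u makes the error of
    order n^-1/2. *)
Lemma zscore_clt (e z : R) : 0 < e -> 2 * (m%:R + 2) * (u / s) <= 1 ->
  `|EN (fun X => ramp z e (iidsum zscore X)) - gauss_mean (ramp z e)| <= clt_err e.
Proof.
move=> e0 b1; have eV : 0 <= e^-1 by rewrite invr_ge0 ltW.
have bnd := clt_bound n bm_zscore Ex_zscore zscore_le b1 eV (ramp_lip e0 z)
  (ramp01 e z).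
apply: (le_trans bnd).
have V := zscore_var.
have nt : n%:R * Ex Q (fun x => zscore x ^+ 2) <= 1 + var_err.
  by move: V; rewrite ler_norml => /andP[_ ?]; lra.
rewrite /clt_err lerD ?ler_wpM2l//.
set B := 2 * (m%:R + 2).
have B0 : 0 <= B by rewrite mulr_ge0// addr_ge0.
have -> : n%:R * (2 * (B * (u / s)) ^+ 3 * (stein_cst e^-1 +
     2 * (2 + n%:R * Ex Q (fun x => zscore x ^+ 2)))) =
  u * (2 * B ^+ 3 / s ^+ 3 * (stein_cst e^-1 + 2 * (2 + n%:R * Ex Q (fun x => zscore x ^+ 2)))).
  have u3 : n%:R * u ^+ 3 = u by rewrite exprS mulrCA nu2 mulr1.
  rewrite -[X in _ = X * _]u3; move: (Ex _ _) => t; field.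
  by rewrite (gt_eqF s0) gt_eqF// sqrtr_gt0.
rewrite ler_wpM2l ?(ltW u0)// ler_wpM2l//.
  apply: divr_ge0; last by apply: exprn_ge0; exact: ltW.
  by apply: mulr_ge0 => //; exact: exprn_ge0.
by rewrite lerD2l ler_wpM2l//; lra.
Qed.

Lemma Ex_zsum : EN (fun X => `|iidsum zscore X|) <= 1 + var_err.
Proof.
have v0 := var_err_ge0.
rewrite (le_trans (Ex_norm_le_sqrt _ (bm_iidsum n bm_zscore)))//.
rewrite (iidsum_var _ bm_zscore Ex_zscore).
have nt : n%:R * Ex Q (fun x => zscore x ^+ 2) <= 1 + var_err.
  by have := zscore_var; rewrite ler_norml => /andP[_ ?]; lra.
rewrite -[leRHS]ger0_norm ?addr_ge0// -sqrtr_sqr ler_wsqrtr// (le_trans nt)//.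
by rewrite expr2 ler_peMr// ?addr_ge0// lerDl.
Qed.

End score_moments.

(** * The power for a fixed sample size *)

Section spearman_error.
Context (R : realType) (m : nat) (Omega : vec R m -> R).
Implicit Types (x y : vec R m).
Hypothesis hm : (2 <= m)%N.
Hypothesis Omega1 : forall x k, cube x -> (forall j, j != k -> tnth x j = 1) -> Omega x = 0.
Variables (h theta1 : R) (n : nat) (Q Q1 : probability (vec R m) R).
Hypothesis n0 : (0 < n)%N.
Local Notation u := ((Num.sqrt n%:R)^-1 : R).
Local Notation theta := (h / Num.sqrt n%:R).
Hypotheses (h0 : 0 <= h) (theta_le : theta <= theta1) (theta1_gt0 : 0 < theta1).
Hypothesis Qcdf : forall x, cube x ->
  mcdf Q x = ((\prod_(j < m) (tnth x j : R)) + theta * Omega x)%:E.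
Hypothesis Q1cdf : forall x, cube x ->
  mcdf Q1 x = ((\prod_(j < m) (tnth x j : R)) + theta1 * Omega x)%:E.

Local Notation I0 := (\int[lebesgue_vec R m]_(x in @cube R m) Omega x).
Local Notation s := (score_sd R m).
Local Notation w := (half_pow R m).
Local Notation EN := (Ex (iid Q n)).
Local Notation verr := (var_err Omega theta theta1).

Let n0' : 0 < n%:R :> R. Proof. by rewrite ltr0n. Qed.
Let sn0 : 0 < Num.sqrt n%:R :> R. Proof. by rewrite sqrtr_gt0. Qed.
Let u0 : 0 < u. Proof. by rewrite invr_gt0. Qed.
Let s0 : 0 < s. Proof. exact: score_sd_gt0. Qed.
Let theta_ge0 : 0 <= theta. Proof. by rewrite divr_ge0// ltW. Qed.
Let nu2 : n%:R * u ^+ 2 = 1 :> R.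
Proof. by rewrite exprVn sqr_sqrtr ?(ltW n0')// divff// gt_eqF. Qed.
Let snE : Num.sqrt n%:R = n%:R * u :> R.
Proof. by apply: (mulIf (lt0r_neq0 u0)); rewrite -mulrA -expr2 nu2 divff// gt_eqF. Qed.

Definition midpow : R := ((n%:R + 1) / (2 * n%:R)) ^+ m.
Definition normratio : R := n%:R ^+ m * norm_limit R m / Cconst R m n.
Definition std_stat (X : n.-tuple (vec R m)) : R :=
  Num.sqrt n%:R * spearman X / Num.sqrt (sigma2 R m).
Definition drift : R := h * I0 / s.

(** sigma_m (0) is [score_sd] divided by the limit of C_(m,n) / n^m, and
    [normratio] is that limit divided by C_(m,n) / n^m. *)
Lemma std_statE X : std_stat X = normratio / s * (Num.sqrt n%:R * (rankmean X - midpow)).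
Proof.
have rE : n%:R^-1 * \sum_(i < n) \prod_(j < m) (n%:R + 1 - (rank X i j)%:R)
    = n%:R ^+ m * rankmean X.
  rewrite /rankmean mulrCA; congr (_ * _); rewrite mulr_sumr; apply: eq_bigr => i _.
  rewrite -[in n%:R ^+ m](card_ord m) -prodr_const -big_split/=; apply: eq_bigr => j _.
  by rewrite /relrank mulrA divff ?mul1r// gt_eqF.
have mE : ((n%:R + 1) / 2) ^+ m = n%:R ^+ m * midpow.
  by rewrite /midpow -exprMn; congr (_ ^+ _); field; rewrite gt_eqF.
have c0 := norm_limit_gt0 R hm.
rewrite /std_stat /spearman rE mE (sqrt_sigma2 R hm) /normratio.
by rewrite -mulrBr; move: (Cconst R m n)^-1 => C; field; rewrite (gt_eqF s0) (gt_eqF c0).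
Qed.

Lemma midpow_close : `|Num.sqrt n%:R * (w - midpow)| <= m%:R / 2 * u.
Proof.
(* midpow and w are the m-th powers of two numbers at distance 1 / (2 n). *)
have n1 : 1 <= n%:R :> R by rewrite ler1n.
have a01 : 0 <= ((n%:R + 1) / (2 * n%:R) : R) <= 1.
  rewrite divr_ge0 ?addr_ge0 ?mulr_ge0//= ler_pdivrMr ?mulr_gt0// mul1r; lra.
have h01 : 0 <= (2^-1 : R) <= 1 by apply/andP; split; lra.
have H := expr_lip m h01 a01.
have K : Num.sqrt n%:R * n%:R^-1 = u.
  by apply: (mulIf (lt0r_neq0 n0')); rewrite mulfVK ?gt_eqF// mulrC; exact: snE.
rewrite /half_pow /midpow -exprVn normrM (ger0_norm (ltW sn0)).
rewrite (le_trans (ler_wpM2l (ltW sn0) H))//.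
rewrite (_ : 2^-1 - _ = - (2 * n%:R)^-1); last by field; rewrite gt_eqF.
rewrite normrN ger0_norm; last by rewrite invr_ge0 mulr_ge0// ltW.
rewrite [leLHS](_ : _ = m%:R / 2 * (Num.sqrt n%:R * n%:R^-1)); first by rewrite K.
by field; rewrite gt_eqF.
Qed.

Definition lin_err : R := (4 * m%:R ^+ 2 + 3 * m%:R) * u +
  Num.sqrt (8 * m%:R ^+ 2 * u ^+ 2 + 2 * m%:R * (theta * (2 * (2 * m%:R) / theta1))).

Definition std_stat_err : R :=
  `|normratio| / s * (lin_err + m%:R / 2 * u) + `|normratio - 1| * (1 + verr + `|drift|).

Let zs := zscore Omega theta n.

Lemma bm_std_stat : bm std_stat.
Proof.
rewrite (_ : std_stat = fun X => normratio / s * (Num.sqrt n%:R * (rankmean X - midpow))).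
  by apply: bmZ; apply: bmZ; apply: bmB; [exact: bm_rankmean|exact: bm_cst].
by apply/funext => X; exact: std_statE.
Qed.

(** sqrt n (rankmean - w) is the sum of scores up to [lin_err]; replacing midpow
    by its limit w, and normratio by 1, gives the remaining errors. *)
Lemma std_stat_linear : EN (fun X => `|std_stat X - (iidsum zs X + drift)|) <= std_stat_err.
Proof.
have m0 : (0 < m)%N by exact: ltnW.
pose S (X : n.-tuple (vec R m)) := \sum_i score (tnth X i) : R.
pose D (X : n.-tuple (vec R m)) := Num.sqrt n%:R * (rankmean X - w) - u * S X.
have bz : bm zs by exact: bm_zscore.
have bS : bm S by apply: bm_sum => i; exact: (bm_tnth i (@bm_score R m)).
have bD : bm D.
  apply: bmB; last exact: bmZ.
  by apply: bmZ; apply: bmB; [exact: bm_rankmean|exact: bm_cst].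
have bZ := bm_iidsum n bz.
have bDn := bm_norm bD; have bZn := bm_norm bZ.
have HD : EN (fun X => `|D X|) <= lin_err.
  have := rankmean_linear n0 (law_margin Omega1 Qcdf m0) (law_half Omega1 Qcdf m0)
    (Ex_kern_le hm Omega1 theta_ge0 theta_le theta1_gt0 Qcdf Q1cdf).
  by rewrite /lin_err exprVn sqr_sqrtr// ltW.
have HZ : EN (fun X => `|iidsum zs X|) <= 1 + verr.
  exact: (Ex_zsum hm Omega1 theta_ge0 theta_le theta1_gt0 Qcdf Q1cdf n0).
have ZE X : iidsum zs X + drift = u / s * S X.
  rewrite /iidsum /zs /zscore -mulr_suml sumrB sumr_const card_ord -[_ *+ n]mulr_natl.
  rewrite -/(S X) mulrBl [S X * _]mulrC -[RHS]addr0 -addrA; congr (_ + _).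
  rewrite /drift (_ : n%:R * (theta * I0) * (u / s) = (n%:R * u ^+ 2) * (h * I0 / s)).
    by rewrite nu2 mul1r addrC subrr.
  by field; rewrite (gt_eqF s0) (gt_eqF sn0).
have k0 : 0 <= `|normratio| / s by rewrite divr_ge0// ltW.
have key X : `|std_stat X - (iidsum zs X + drift)| <=
    `|normratio| / s * (`|D X| + m%:R / 2 * u) + `|normratio - 1| * (`|iidsum zs X| + `|drift|).
  have -> : std_stat X - (iidsum zs X + drift) =
      normratio / s * (D X + Num.sqrt n%:R * (w - midpow))
      + (normratio - 1) * (iidsum zs X + drift).
    by rewrite ZE std_statE /D; field; rewrite (gt_eqF s0) (gt_eqF sn0).
  rewrite (le_trans (ler_normD _ _))// (normrM (normratio / s)) (normrM normratio) (normrM (normratio - 1)) lerD//.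
    rewrite normfV (ger0_norm (ltW s0)) ler_wpM2l// (le_trans (ler_normD _ _))// lerD//.
    exact: midpow_close.
  by rewrite ler_wpM2l// ler_normD.
have b1 : bm (fun X => `|D X| + m%:R / 2 * u) by apply: bmD => //; exact: bm_cst.
have b2 := bmD bZn (bm_cst _ `|drift|).
apply: (@le_trans _ _ (EN (fun X => `|normratio| / s * (`|D X| + m%:R / 2 * u)
    + `|normratio - 1| * (`|iidsum zs X| + `|drift|)))).
  apply: le_Ex; [|by apply: bmD; exact: bmZ|exact: key].
  by apply: bm_norm; apply: bmB; [exact: bm_std_stat|apply: bmD => //; exact: bm_cst].
rewrite ExD; [|exact: bmZ|exact: bmZ].
rewrite !ExZ// ExD//; last exact: bm_cst.
rewrite [X in _ + _ * X]ExD//; last exact: bm_cst.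
by rewrite !Ex_cst /std_stat_err lerD// ler_wpM2l// lerD2r.
Qed.

Lemma power_bound (e z : R) : 0 < e -> 2 * (m%:R + 2) * (u / s) <= 1 ->
  `|fine (power_measure Q n [set X | z < std_stat X]) - (1 - Phi (z - drift))| <=
    clt_err Omega theta theta1 n e + e^-1 * std_stat_err + e * normal_peak 1.
Proof.
move=> e0 b1.
have bi : bm (fun X => (std_stat X <= z)%R%:R : R).
  by apply: bm_bool; apply: measurable_fun_ler => //; case: bm_std_stat.
have mz : measurable [set X | z < std_stat X].
  rewrite -[X in measurable X]setTI; apply: measurable_fun_ltr => //.
  by case: bm_std_stat.
have -> : fine (power_measure Q n [set X | z < std_stat X]) = 1 - EN (fun X => (std_stat X <= z)%R%:R).
  rewrite -[LHS]/(fine (iid Q n _)) -Ex_indic// -[X in X - _](Ex_cst (iid Q n)) -ExB//; last exact: bm_cst.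
  congr Ex; apply/funext => X; rewrite indicE.
  have -> : (X \in [set X | z < std_stat X]) = (z < std_stat X) by apply/idP/idP => [/set_mem|/mem_set].
  by rewrite ltNge; case: (std_stat X <= z); rewrite ?subrr ?subr0.
rewrite (_ : _ - _ - _ = - (EN (fun X => (std_stat X <= z)%R%:R) - Phi (z - drift))); last by ring.
rewrite normrN.
have bz : bm zs by exact: bm_zscore.
apply: (@prob_le_Phi _ _ _ (iid Q n) std_stat (iidsum zs) drift z e _ _ e0 bm_std_stat
  (bm_iidsum n bz) _ std_stat_linear) => z'.
exact: (zscore_clt hm Omega1 theta_ge0 theta_le theta1_gt0 Qcdf Q1cdf n0).
Qed.

End spearman_error.

(** * The limiting power *)

Section limits.
Context (R : realType) (m : nat) (Omega : vec R m -> R) (h theta1 : R).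
Hypothesis hm : (2 <= m)%N.

Lemma inv_sqrt_cvg : (Num.sqrt n%:R)^-1 @[n --> \oo] --> (0 : R).
Proof.
apply/cvgrPdist_le => e e0; near=> n.
have n0 : (0 < n)%N by near: n; exact: nbhs_infty_gt.
have s0 : 0 < Num.sqrt n%:R :> R by rewrite sqrtr_gt0 ltr0n.
rewrite sub0r normrN ger0_norm ?invr_ge0 ?(ltW s0)//.
rewrite -[e]invrK lef_pV2 ?posrE ?invr_gt0//.
rewrite -[leLHS]ger0_norm ?invr_ge0 ?(ltW e0)// -sqrtr_sqr ler_wsqrtr//.
near: n; exact: nbhs_infty_ger.
Unshelve. all: by end_near. Qed.

Lemma theta_cvg : h / Num.sqrt n%:R @[n --> \oo] --> (0 : R).
Proof. by rewrite -[X in _ --> X](mulr0 h); apply: cvgM; [exact: cvg_cst|exact: inv_sqrt_cvg]. Qed.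

Lemma var_err_cvg : var_err Omega (h / Num.sqrt n%:R) theta1 @[n --> \oo] --> (0 : R).
Proof.
pose A : R := 2 * (m%:R + 2) ^+ 2 / theta1; pose s : R := score_sd R m ^+ 2.
rewrite [X in _ --> X](_ : 0 = (0 * A + 0 * 0 * (\int[lebesgue_vec R m]_(x in @cube R m) Omega x) ^+ 2) / s); last by rewrite !mul0r addr0 mul0r.
apply: cvgM; last exact: cvg_cst.
apply: cvgD; first by apply: cvgM; [exact: theta_cvg|exact: cvg_cst].
apply: cvgM; last exact: cvg_cst.
by apply: cvgM; exact: theta_cvg.
Qed.

Lemma clt_err_cvg e : clt_err Omega (h / Num.sqrt n%:R) theta1 n e @[n --> \oo] --> (0 : R).
Proof.
pose B : R := 2 * (2 * (m%:R + 2)) ^+ 3 / score_sd R m ^+ 3.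
rewrite [X in _ --> X](_ : 0 = 2 * 0 + 0 * (B * (stein_cst e^-1 + 2 * (3 + 0)))); last by rewrite mulr0 mul0r addr0.
apply: cvgD; first by apply: cvgM; [exact: cvg_cst|exact: var_err_cvg].
apply: cvgM; first exact: inv_sqrt_cvg.
apply: cvgM; first exact: cvg_cst.
apply: cvgD; first exact: cvg_cst.
apply: cvgM; first exact: cvg_cst.
by apply: cvgD; [exact: cvg_cst|exact: var_err_cvg].
Qed.

Lemma lin_err_cvg : lin_err m h theta1 n @[n --> \oo] --> (0 : R).
Proof.
pose A : R := 8 * m%:R ^+ 2; pose B : R := 2 * (2 * m%:R) / theta1.
rewrite [X in _ --> X](_ : 0 = (4 * m%:R ^+ 2 + 3 * m%:R) * 0 +
    Num.sqrt (A * (0 * 0) + 2 * m%:R * (0 * B))); last first.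
  by rewrite !mul0r !mulr0 addr0 sqrtr0 addr0.
apply: cvgD; first by apply: cvgM; [exact: cvg_cst|exact: inv_sqrt_cvg].
apply: (cvg_comp _ Num.sqrt); last exact: sqrt_continuous.
apply: cvgD.
  by apply: cvgM; [exact: cvg_cst|apply: cvgM; exact: inv_sqrt_cvg].
apply: cvgM; first exact: cvg_cst.
by apply: cvgM; [exact: theta_cvg|exact: cvg_cst].
Qed.

Lemma midpow_cvg : midpow R m n @[n --> \oo] --> half_pow R m.
Proof.
apply/cvgrPdist_le => e e0; near=> n.
have n0 : (0 < n)%N by near: n; exact: nbhs_infty_gt.
have n0' : 0 < n%:R :> R by rewrite ltr0n.
have sn1 : 1 <= Num.sqrt n%:R :> R by rewrite -[leLHS]sqrtr1 ler_wsqrtr// ler1n.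
have := @midpow_close R m n n0.
rewrite normrM ger0_norm ?sqrtr_ge0// => H.
rewrite (@le_trans _ _ (Num.sqrt n%:R * `|half_pow R m - midpow R m n|))//.
  by rewrite ler_peMl.
rewrite (le_trans H)//.
near: n; apply: (cvgr_le 0) => //.
by rewrite -[X in _ --> X](mulr0 (m%:R / 2)); apply: cvgM; [exact: cvg_cst|exact: inv_sqrt_cvg].
Unshelve. all: by end_near. Qed.

Lemma normratio_cvg : normratio R m n @[n --> \oo] --> (1 : R).
Proof.
have c0 := norm_limit_gt0 R hm.
have avg_cvg : (n%:R ^+ m.+1)^-1 * \sum_(1 <= i < n.+1) i%:R ^+ m @[n --> \oo] --> (m.+1%:R^-1 : R).
  apply/cvgrPdist_le => e e0; near=> n.
  have n0 : (0 < n)%N by near: n; exact: nbhs_infty_gt.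
  have n0' : 0 < n%:R :> R by rewrite ltr0n.
  have p0 : 0 < n%:R ^+ m.+1 :> R by rewrite exprn_gt0.
  have /andP[H1 H2] := sum_pow_bounds R m n.
  have k0 : 0 < m.+1%:R :> R by [].
  set S := \sum_(1 <= i < n.+1) _ in H1 H2 *.
  rewrite (_ : _ - _ = - ((m.+1%:R * S - n%:R ^+ m.+1) / (m.+1%:R * n%:R ^+ m.+1))); last first.
    by field; rewrite !gt_eqF.
  rewrite normrN ger0_norm; last by rewrite divr_ge0 ?subr_ge0// ltW// mulr_gt0.
  apply: (@le_trans _ _ (n%:R^-1)).
    rewrite ler_pdivrMr ?mulr_gt0// exprS mulrCA mulKf ?gt_eqF//.
    by rewrite lerBlDl -exprS.
  rewrite -[e]invrK lef_pV2 ?posrE ?invr_gt0//.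
  near: n; exact: nbhs_infty_ger.
have C_cvg : (n%:R ^+ m)^-1 * Cconst R m n @[n --> \oo] --> norm_limit R m.
  apply: (@cvg_trans _ ((n%:R ^+ m.+1)^-1 * \sum_(1 <= i < n.+1) i%:R ^+ m - midpow R m n @[n --> \oo])); last first.
    by apply: cvgB; [exact: avg_cvg|exact: midpow_cvg].
  apply: near_eq_cvg; near=> n.
  have n0 : (0 < n)%N by near: n; exact: nbhs_infty_gt.
  have n0' : n%:R != 0 :> R by rewrite pnatr_eq0 -lt0n.
  rewrite /Cconst /midpow mulrBr; congr (_ - _).
    by rewrite mulrA exprSr invfM [_^-1 * n%:R^-1]mulrC.
  by rewrite -[in RHS]exprVn -[RHS]exprMn; congr (_ ^+ _); field.
have inv_cvg : ((n%:R ^+ m)^-1 * Cconst R m n)^-1 * norm_limit R m @[n --> \oo] --> (1 : R).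
  rewrite -[X in _ --> X](@mulVf _ (norm_limit R m)) ?gt_eqF//.
  apply: cvgM; last exact: cvg_cst.
  by apply: cvgV => //; rewrite gt_eqF.
apply: cvg_trans inv_cvg; apply: near_eq_cvg; near=> n.
by rewrite /normratio invfM invrK; ring.
Unshelve. all: by end_near. Qed.

Lemma std_stat_err_cvg : std_stat_err Omega h theta1 n @[n --> \oo] --> (0 : R).
Proof.
pose S : R := `|drift Omega h|; pose s : R := score_sd R m.
rewrite [X in _ --> X](_ : 0 = `|1| / s * (0 + m%:R / 2 * 0) + `|1 - 1| * (1 + 0 + S)); last first.
  by rewrite mulr0 addr0 mulr0 subrr normr0 mul0r addr0.
apply: cvgD.
  apply: cvgM.
    by apply: cvgM; [apply: cvg_norm; exact: normratio_cvg|exact: cvg_cst].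
  apply: cvgD; first exact: lin_err_cvg.
  by apply: cvgM; [exact: cvg_cst|exact: inv_sqrt_cvg].
apply: cvgM.
  by apply: cvg_norm; apply: cvgB; [exact: normratio_cvg|exact: cvg_cst].
apply: cvgD; last exact: cvg_cst.
by apply: cvgD; [exact: cvg_cst|exact: var_err_cvg].
Qed.

End limits.

Lemma dependence_one_free (R : realType) (m : nat) (Omega : vec R m -> R) :
  (2 <= m)%N -> dependence_function Omega ->
  forall x k, cube x -> (forall j, j != k -> tnth x j = 1) -> Omega x = 0.
Proof. by case: m Omega => [|[|p]]// Omega _ [_ _ H _]; exact: H. Qed.

Theorem lemma2 (R : realType) (m : nat) (hm : (2 <= m)%N)
    (Omega : vec R m -> R) (P : R -> probability (vec R m) R)
    (hC123 : dependence_function Omega)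
    (hC4 : L2_mixed_derivative Omega)
    (hmodel : dependence_model Omega P)
    (alpha : R) (halpha : 0 < alpha < 1) (h : R) (hh : 0 <= h) :
  power_fun n P alpha (h / Num.sqrt n%:R) @[n --> \oo] -->
  1 - Phi (zquantile alpha -
           2 ^+ m / Num.sqrt ((4 / 3) ^+ m - m%:R / 3 - 1) *
           (h * \int[lebesgue_vec R m]_(x in @cube R m) Omega x)).
Proof.
have Omega1 := dependence_one_free hm hC123.
have [theta0 theta0_gt0 model] := hmodel.
(* The parameter of the fixed law of the mixture. *)
pose theta1 := theta0 / 2.
have theta1_gt0 : 0 < theta1 by rewrite divr_gt0.
have theta1_lt : theta1 < theta0 by rewrite /theta1; lra.
have cdf1 := (model theta1 (introT andP (conj (ltW theta1_gt0) theta1_lt))).2.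
rewrite (_ : _ * (h * _) = drift Omega h); last first.
  rewrite /drift /score_sd /half_pow -/(var_factor R m).
  have c0 : Num.sqrt (var_factor R m) != 0 by rewrite gt_eqF// sqrtr_gt0 var_factor_gt0.
  have t0 : 2 ^+ m != 0 :> R by rewrite expf_neq0.
  by field; rewrite c0 t0.
set z := zquantile alpha.
have pk : 0 < normal_peak 1 :> R by rewrite normal_peak_gt0.
apply/cvgrPdist_le => eps eps0.
(* The width of the ramp accounts for half of the error. *)
pose e := eps / (2 * normal_peak 1).
have e0 : 0 < e by rewrite divr_gt0// mulr_gt0.
have err_cvg : clt_err Omega (h / Num.sqrt n%:R) theta1 n e +
    e^-1 * std_stat_err Omega h theta1 n @[n --> \oo] --> (0 : R).
  rewrite [X in _ --> X](_ : 0 = 0 + e^-1 * 0); last by rewrite mulr0 addr0.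
  apply: cvgD; first exact: clt_err_cvg.
  by apply: cvgM; [exact: cvg_cst|exact: std_stat_err_cvg].
near=> n.
have n0 : (0 < n)%N by near: n; exact: nbhs_infty_gt.
have th0 : 0 <= h / Num.sqrt n%:R by rewrite divr_ge0 ?sqrtr_ge0.
have th1 : h / Num.sqrt n%:R <= theta1.
  by near: n; apply: (cvgr_le 0) => //; exact: theta_cvg.
have cdfn := (model _ (introT andP (conj th0 (le_lt_trans th1 theta1_lt)))).2.
have small : 2 * (m%:R + 2) * ((Num.sqrt n%:R)^-1 / score_sd R m) <= 1.
  near: n; apply: (cvgr_le 0) => //.
  rewrite [X in _ --> X](_ : 0 = 2 * (m%:R + 2) * (0 / score_sd R m)); last by rewrite mul0r mulr0.
  apply: cvgM; first exact: cvg_cst.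
  by apply: cvgM; [exact: inv_sqrt_cvg|exact: cvg_cst].
have bound := power_bound hm Omega1 n0 hh th1 theta1_gt0 cdfn cdf1 z e0 small.
rewrite distrC (le_trans bound)// (_ : e * _ = eps / 2); last first.
  by rewrite /e; field; rewrite gt_eqF.
rewrite [leRHS](_ : _ = eps / 2 + eps / 2); last by field.
rewrite lerD2r.
by near: n; apply: (cvgr_le 0) => //; rewrite divr_gt0.
Unshelve. all: by end_near. Qed.
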